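(* Let $(M,L)$ be a Finsler manifold of dimension $n\ge 4$, and let $k\in C^\infty(\mathcal{T}M)$ be positively homogeneous of degree zero in $y$. Then $(M,L)$ is of $H_p$-scalar curvature $k$ if and only if the h-curvature tensor $R^{\circ}$ of its Berwald connection satisfies, for all $\pi$-vector fields $\overline{X},\overline{Y},\overline{Z},\overline{W}$, $$\begin{aligned} R^{\circ}(\overline{X},\overline{Y},\overline{Z},\overline{W}) ={}& L^{-1}\{\ell(\overline{Z})\widehat{R}(\overline{X},\overline{Y},\overline{W})-\ell(\overline{W})\widehat{R}(\overline{X},\overline{Y},\overline{Z})\}\\ &+\mathfrak{A}_{\overline{X},\overline{Y}}\Big\{L^{-1}\ell(\overline{X})\big\{\widehat{R}(\overline{Z},\overline{W},\overline{Y})-T(H(\overline{Z}),\overline{W},\overline{Y})+T(H(\overline{W}),\overline{Z},\overline{Y})\\ &\qquad\qquad -T(H(\overline{Y}),\overline{Z},\overline{W})-(D^{\circ}_{\beta\overline{\eta}}\widehat{P})(\overline{Z},\overline{W},\overline{Y})\big\}\\ &\qquad -L^{-2}\big\{\widehat{R}(\overline{\eta},\overline{X},\overline{Z})\ell(\overline{Y})\ell(\overline{W})+\widehat{R}(\overline{\eta},\overline{Y},\overline{W})\ell(\overline{X})\ell(\overline{Z})-kL^{2}\hbar(\overline{X},\overline{Z})\hbar(\overline{Y},\overline{W})\big\}\Big\}. \end{aligned}$$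
   Context: Pullback formalism. $M$ is a smooth $n$-dimensional manifold, $\pi:\mathcal{T}M\to M$ the bundle of nonzero tangent vectors, $\pi^{-1}(TM)\to\mathcal{T}M$ the pullback of $TM$. Sections of $\pi^{-1}(TM)$ are called $\pi$-vector fields (written with bars), tensor fields on $\pi^{-1}(TM)$ are called $\pi$-tensor fields, and $\overline{\eta}(u)=(u,u)$ is the fundamental $\pi$-vector field. There is an exact sequence $0\to\pi^{-1}(TM)\xrightarrow{\gamma}T(\mathcal{T}M)\xrightarrow{\rho}\pi^{-1}(TM)\to0$, with $\rho=(\pi_{\mathcal{T}M},\pi_* )$ (where $\pi_{\mathcal{T}M}:T(\mathcal{T}M)\to\mathcal{T}M$ is the projection) and $\gamma$ the vertical lift. A connection $D$ on $\pi^{-1}(TM)$ is regular if $T_u(\mathcal{T}M)=V_u\oplus H_u$ for all $u$, where $V_u$ is the vertical space and $H_u=\{X: D_X\overline{\eta}=0\}$; its horizontal map is $\beta=(\rho|_{H})^{-1}$. Torsion and curvature (note the sign convention) are $\mathbf{T}(X,Y)=D_X\rho Y-D_Y\rho X-\rho[X,Y]$ and $\mathbf{K}(X,Y)\rho Z=-D_XD_Y\rho Z+D_YD_X\rho Z+D_{[X,Y]}\rho Z$. The mixed torsion is $T(\overline{X},\overline{Y})=\mathbf{T}(\gamma\overline{X},\beta\overline{Y})$; the h- and hv-curvatures are $R(\overline{X},\overline{Y})\overline{Z}=\mathbf{K}(\beta\overline{X},\beta\overline{Y})\overline{Z}$ and $P(\overline{X},\overline{Y})\overline{Z}=\mathbf{K}(\beta\overline{X},\gamma\overline{Y})\overline{Z}$;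 and $\widehat{R}(\overline{X},\overline{Y})=R(\overline{X},\overline{Y})\overline{\eta}$ ((v)h-torsion), $\widehat{P}(\overline{X},\overline{Y})=P(\overline{X},\overline{Y})\overline{\eta}$ ((v)hv-torsion). For a Finsler manifold $(M,L)$ with Finsler metric $g$ on $\pi^{-1}(TM)$ (locally $g_{ij}=\frac12\partial^2L^2/\partial y^i\partial y^j$): the Cartan connection $\nabla$ is the unique regular connection with $\nabla g=0$, $\mathbf{T}(\beta\overline{X},\beta\overline{Y})=0$ and $g(T(\overline{X},\overline{Y}),\overline{Z})=g(T(\overline{X},\overline{Z}),\overline{Y})$. The Berwald connection $D^{\circ}$ is the unique regular connection on $\pi^{-1}(TM)$ that is torsion-free ($\mathbf{T}^{\circ}=0$), has vanishing (v)hv-torsion ($\widehat{P^{\circ}}=0$), and satisfies $D^{\circ}_{h^{\circ}X}L=0$, $h^{\circ}=\beta\circ\rho$ being its horizontal projector. The two connections have the same horizontal map $\beta$ and the same (v)h-torsion. Notation: $T$, $\widehat{R}$, $\widehat{P}$ are the mixed torsion (Cartan tensor), (v)h-torsion and (v)hv-torsion of the Cartan connection, and $T(\overline{X},\overline{Y},\overline{Z}):=g(T(\overline{X},\overline{Y}),\overline{Z})$, and similarly $\widehat{R}(\overline{X},\overline{Y},\overline{Z}):=g(\widehat{R}(\overline{X},\overline{Y}),\overline{Z})$, $\widehat{P}(\overline{X},\overline{Y},\overline{Z}):=g(\widehat{P}(\overline{X},\overline{Y}),\overline{Z})$; $D^{\circ}_{\beta\overline{\eta}}\widehat{P}$ is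 the derivative of the $(0,3)$-tensor $\widehat{P}$. $R^{\circ}$ is the h-curvature of the Berwald connection, $R^{\circ}(\overline{X},\overline{Y},\overline{Z},\overline{W}):=g(R^{\circ}(\overline{X},\overline{Y})\overline{Z},\overline{W})$. $H(\overline{X}):=\widehat{R^{\circ}}(\overline{\eta},\overline{X})=\widehat{R}(\overline{\eta},\overline{X})$ is the deviation tensor. $\ell(\overline{X}):=L^{-1}g(\overline{\eta},\overline{X})$, $\phi(\overline{X}):=\overline{X}-L^{-1}\ell(\overline{X})\overline{\eta}$, $\hbar(\overline{X},\overline{Y}):=g(\overline{X},\overline{Y})-\ell(\overline{X})\ell(\overline{Y})$. $\mathfrak{A}_{\overline{X},\overline{Y}}\{\omega(\overline{X},\overline{Y})\}:=\omega(\overline{X},\overline{Y})-\omega(\overline{Y},\overline{X})$. The projection operator $\mathcal{P}$ on a $(0,p)$ $\pi$-tensor field $\omega$ is $(\mathcal{P}\cdot\omega)(\overline{X}_1,\dots,\overline{X}_p):=\omega(\phi(\overline{X}_1),\dots,\phi(\overline{X}_p))$. Definition: a Finsler manifold of dimension $n\ge4$ is of $H_p$-scalar curvature $\varepsilon$, where $\varepsilon\in C^\infty(\mathcal{T}M)$ is positively homogeneous of degree zero in $y$, if $(\mathcal{P}\cdot R^{\circ})(\overline{X},\overline{Y},\overline{Z},\overline{W})=\varepsilon\,\mathfrak{A}_{\overline{X},\overline{Y}}\{\hbar(\overline{X},\overline{Z})\hbar(\overline{Y},\overline{W})\}$. *)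

(* Defs.v *)
From HB Require Import structures.
From mathcomp Require Import all_boot all_order all_algebra.
From mathcomp Require Import all_classical all_reals all_analysis.

Set Implicit Arguments.
Unset Strict Implicit.
Unset Printing Implicit Defensive.

Import Order.TTheory GRing.Theory Num.Theory.
Import numFieldNormedType.Exports.

Local Open Scope classical_set_scope.
Local Open Scope ring_scope.

(* C^k and C^oo on an open subset of a finite-dimensional space: the iterated
   directional derivatives exist and are continuous (Frechet differentiability
   at each stage is automatic for C^1 maps).  Only used with U open. *)

Fixpoint Ck (R : realType) (V W : normedModType R) (k : nat) (U : set V)
    (f : V -> W) : Prop :=
  match k with
  | 0 => forall x, U x -> {for x, continuous f}
  | k'.+1 => (forall x, U x -> differentiable f x) /\
             (forall v, Ck k' U ('D_v f))
  end.

Definition smooth_on (R : realType) (V W : normedModType R) (U : set V)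
  (f : V -> W) : Prop := forall k, Ck k U f.

(* Charts on a set; [chart_at p] is a preferred chart around p, used to evaluate
   expressions which do not depend on the chart.  The axioms of a manifold are
   in [smooth_manifold] below. *)

Record atlas (R : realType) (n : nat) (T : Type) := Atlas {
  chart : Type;
  dom : chart -> set T;
  crd : chart -> T -> 'rV[R]_n;
  chart_at : T -> chart }.

Section Atlas.
Context {R : realType} {n : nat} {T : Type} (A : atlas R n T).
Implicit Types (p : T) (i j : chart A).

(* F \o (crd i)^-1 on crd i @` dom i, and 0 elsewhere *)
Definition local_expr {W : zmodType} i (F : T -> W) : 'rV[R]_n -> W :=
  fun x => match pselect (exists2 p, dom i p & crd i p = x) with
           | left e => F (s2val (cid2 e))
           | right _ => 0
           end.

Definition smooth {W : normedModType R} (F : T -> W) : Prop :=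
  forall i, smooth_on (crd i @` dom i) (local_expr i F).

(* A tangent vector at p is given by its components in all the charts around p,
   which are subject to the usual transformation rule; the components in the
   other charts are set to 0, so that equality of tangent vectors is equality. *)
Definition tvec : Type := chart A -> 'rV[R]_n.

Definition tangent p (v : tvec) : Prop :=
  (forall i, ~ dom i p -> v i = 0) /\
  (forall i j, dom i p -> dom j p ->
     v j = 'D_(v i) (local_expr i (crd j)) (crd i p)).

Definition dirder {W : normedModType R} p (v : tvec) (F : T -> W) : W :=
  'D_(v (chart_at A p)) (local_expr (chart_at A p) F) (crd (chart_at A p) p).

Definition vfield (X : T -> tvec) : Prop :=
  (forall p, tangent p (X p)) /\
  (forall i, smooth_on (crd i @` dom i) (local_expr i (fun p => X p i))).

Definition lie (X Y : T -> tvec) : T -> tvec := fun p i =>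
  if `[< dom i p >] then
    'D_(X p i) (local_expr i (fun q => Y q i)) (crd i p)
    - 'D_(Y p i) (local_expr i (fun q => X q i)) (crd i p)
  else 0.

End Atlas.

Definition tmap (R : realType) (m n : nat) (S T : Type) (B : atlas R m S)
    (A : atlas R n T) (f : S -> T) (p : S) (v : tvec B) : tvec A :=
  fun j => if `[< dom j (f p) >] then dirder p v (crd j \o f) else 0.

Definition smooth_manifold (R : realType) (n : nat) (M : topologicalType)
    (A : atlas R n M) : Prop :=
  [/\ hausdorff_space M, @second_countable M,
      forall p, dom (chart_at A p) p
    & forall i : chart A,
      [/\ open (dom i),
          set_inj (dom i) (crd i),
          forall B, B `<=` dom i -> (open B <-> open (crd i @` B))
        & forall j : chart A,
          smooth_on (crd i @` (dom i `&` dom j)) (local_expr i (crd j))]].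

(* The bundle of nonzero tangent vectors and its induced charts (x, y). *)

Record slit (R : realType) (n : nat) (M : Type) (A : atlas R n M) := Slit {
  base : M;
  dir : tvec A;
  dir_tangent : tangent base dir;
  dir_neq0 : dir <> 0 }.

Definition slit_atlas (R : realType) (n : nat) (M : Type) (A : atlas R n M) :
    atlas R (n + n) (slit A) :=
  {| chart := chart A;
     dom := fun i u => dom i (base u);
     crd := fun i u => row_mx (crd i (base u)) (dir u i);
     chart_at := fun u => chart_at A (base u) |}.

Section Pullback.
Context {R : realType} {n : nat} {M : Type} (A : atlas R n M).
Local Notation TM := (slit A).
Local Notation SA := (slit_atlas A).

(* pi-vector fields: smooth sections of the bundle over TM whose fibre at u is
   the tangent space of M at [base u] *)
Definition pfield (X : TM -> tvec A) : Prop :=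
  (forall u, tangent (base u) (X u)) /\
  (forall i : chart SA,
     smooth_on (crd i @` dom i) (local_expr i (fun u => X u i))).

(* the fundamental pi-vector field u |-> (u, u) *)
Definition fund : TM -> tvec A := @dir R n M A.

Definition poshomogeneous (d : nat) (F : TM -> R) : Prop :=
  forall (u w : TM) (c : R), 0 < c -> base w = base u -> dir w = c *: dir u ->
    F w = c ^+ d * F u.

Definition rho (u : TM) (v : tvec SA) : tvec A := 
  tmap (A := A) (@base R n M A) u v.

(* the components of the velocity at t = 0 of t |-> (x, y + t w) *)
Definition gamma (w : tvec A) : tvec SA := fun i => row_mx 0 (w i).

Definition rho_f (X : TM -> tvec SA) : TM -> tvec A := fun u => rho u (X u).
Definition gamma_f (X : TM -> tvec A) : TM -> tvec SA := fun u => gamma (X u).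

(* A connection on the pullback bundle, as (u, v, X) |-> (D_v X)(u) for v a
   tangent vector to TM at u and X a pi-vector field. *)
Definition connection : Type :=
  TM -> tvec SA -> (TM -> tvec A) -> tvec A.

Definition cov (D : connection) (V : TM -> tvec SA) (X : TM -> tvec A) :
  TM -> tvec A := fun u => D u (V u) X.

Definition is_connection (D : connection) : Prop :=
  [/\ forall V X, vfield V -> pfield X -> pfield (cov D V X),
      forall u (v w : tvec SA) (c : R) X, tangent u v -> tangent u w ->
        pfield X -> D u (c *: v + w) X = c *: D u v X + D u w X,
      forall u (v : tvec SA) X Y, tangent u v -> pfield X -> pfield Y ->
        D u v (fun w => X w + Y w) = D u v X + D u v Y,
      forall u (v : tvec SA) (F : TM -> R) X, tangent u v -> smooth SA F ->
        pfield X ->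
        D u v (fun w => F w *: X w) = dirder u v F *: X u + F u *: D u v X
    & forall u (v : tvec SA) X, tangent u v -> pfield X ->
        tangent (base u) (D u v X)].

Definition vertical (u : TM) : set (tvec SA) :=
  [set v | tangent u v /\ rho u v = 0].

Definition horizontal (D : connection) (u : TM) : set (tvec SA) :=
  [set v | tangent u v /\ D u v fund = 0].

Definition regular (D : connection) : Prop := forall u,
  vertical u `&` horizontal D u = [set 0] /\
  forall v, tangent u v ->
    exists a b, [/\ vertical u a, horizontal D u b & v = a + b].

(* the horizontal map, inverse of the restriction of rho to the horizontal
   space *)
Definition beta (D : connection) (u : TM) (w : tvec A) : tvec SA :=
  xget 0 [set v | horizontal D u v /\ rho u v = w].

Definition beta_f (D : connection) (X : TM -> tvec A) : TM -> tvec SA :=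
  fun u => beta D u (X u).

Definition torsion (D : connection) (X Y : TM -> tvec SA) : TM -> tvec A :=
  fun u => cov D X (rho_f Y) u - cov D Y (rho_f X) u - rho u (lie X Y u).

Definition curvature (D : connection) (X Y : TM -> tvec SA)
    (Z : TM -> tvec A) : TM -> tvec A :=
  fun u => - cov D X (cov D Y Z) u + cov D Y (cov D X Z) u
           + cov D (lie X Y) Z u.

Definition mixed_torsion (D : connection) (X Y : TM -> tvec A) :=
  torsion D (gamma_f X) (beta_f D Y).

Definition h_curv (D : connection) (X Y Z : TM -> tvec A) :=
  curvature D (beta_f D X) (beta_f D Y) Z.

Definition hv_curv (D : connection) (X Y Z : TM -> tvec A) :=
  curvature D (beta_f D X) (gamma_f Y) Z.

Definition vh_torsion (D : connection) (X Y : TM -> tvec A) :=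
  h_curv D X Y fund.

Definition vhv_torsion (D : connection) (X Y : TM -> tvec A) :=
  hv_curv D X Y fund.

Definition deviation (D : connection) (X : TM -> tvec A) :=
  vh_torsion D fund X.

(* covariant derivative of a (0,3) pi-tensor field *)
Definition cov3 (D : connection) (V : TM -> tvec SA)
    (w : (TM -> tvec A) -> (TM -> tvec A) -> (TM -> tvec A) -> TM -> R)
    (X Y Z : TM -> tvec A) : TM -> R :=
  fun u => dirder u (V u) (w X Y Z)
           - w (cov D V X) Y Z u - w X (cov D V Y) Z u - w X Y (cov D V Z) u.

Section Finsler.
Variable L : TM -> R.

(* g_ab = 1/2 d^2 L^2 / dy^a dy^b in the chart i *)
Definition metric_coef (i : chart SA) (u : TM) (a b : 'I_n) : R :=
  let e (c : 'I_n) : 'rV[R]_(n + n) := row_mx 0 (delta_mx 0 c) in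
  2^-1 * 'D_(e a) ('D_(e b) (local_expr i (fun w => L w ^+ 2))) (crd i u).

Definition metric (u : TM) (v w : tvec A) : R :=
  let i := chart_at SA u in
  \sum_(a < n) \sum_(b < n) metric_coef i u a b * v i 0 a * w i 0 b.

Definition gm (X Y : TM -> tvec A) : TM -> R := fun u => metric u (X u) (Y u).

Definition finsler : Prop :=
  [/\ smooth SA L, forall u, 0 < L u, poshomogeneous 1 L
    & forall u (v : tvec A), tangent (base u) v -> v <> 0 -> 0 < metric u v v].

Definition lower2 (B : (TM -> tvec A) -> (TM -> tvec A) -> TM -> tvec A)
  (X Y Z : TM -> tvec A) : TM -> R := gm (B X Y) Z.

Definition lower3
  (B : (TM -> tvec A) -> (TM -> tvec A) -> (TM -> tvec A) -> TM -> tvec A)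
  (X Y Z W : TM -> tvec A) : TM -> R := gm (B X Y Z) W.

Definition is_cartan (D : connection) : Prop :=
  [/\ is_connection D, regular D,
      forall u (v : tvec SA) Y Z, tangent u v -> pfield Y -> pfield Z ->
        dirder u v (gm Y Z) = metric u (D u v Y) (Z u) + metric u (Y u) (D u v Z),
      forall X Y, pfield X -> pfield Y ->
        forall u, torsion D (beta_f D X) (beta_f D Y) u = 0
    & forall X Y Z, pfield X -> pfield Y -> pfield Z -> forall u,
        gm (mixed_torsion D X Y) Z u = gm (mixed_torsion D X Z) Y u].

Definition is_berwald (D : connection) : Prop :=
  [/\ is_connection D, regular D,
      forall X Y, vfield X -> vfield Y -> forall u, torsion D X Y u = 0,
      forall X Y, pfield X -> pfield Y -> forall u, vhv_torsion D X Y u = 0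
    & forall u (v : tvec SA), tangent u v ->
        dirder u (beta D u (rho u v)) L = 0].

Definition ell (X : TM -> tvec A) : TM -> R := fun u => (L u)^-1 * gm fund X u.

Definition phi (X : TM -> tvec A) : TM -> tvec A :=
  fun u => X u - ((L u)^-1 * ell X u) *: fund u.

Definition hbar (X Y : TM -> tvec A) : TM -> R :=
  fun u => gm X Y u - ell X u * ell Y u.

Definition proj4
    (w : (TM -> tvec A) -> (TM -> tvec A) -> (TM -> tvec A) ->
         (TM -> tvec A) -> TM -> R)
    (X Y Z W : TM -> tvec A) : TM -> R :=
  w (phi X) (phi Y) (phi Z) (phi W).

(* the alternating sum over X, Y, denoted by a Gothic A *)
Definition alt (w : (TM -> tvec A) -> (TM -> tvec A) -> R)
  (X Y : TM -> tvec A) : R := w X Y - w Y X.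

(* D is meant to be the Berwald connection of L *)
Definition Hp_scalar_curvature (D : connection) (e : TM -> R) : Prop :=
  forall X Y Z W, pfield X -> pfield Y -> pfield Z -> pfield W -> forall u,
    proj4 (lower3 (h_curv D)) X Y Z W u =
    e u * alt (fun X Y => hbar X Z u * hbar Y W u) X Y.

End Finsler.
End Pullback.

(* Main.v *)
Require Import Defs.
From HB Require Import structures.
From mathcomp Require Import all_boot all_order all_algebra.
From mathcomp Require Import all_classical all_reals all_analysis.
From mathcomp Require Import ring lra.
Set Implicit Arguments.
Unset Strict Implicit.
Unset Printing Implicit Defensive.
Import Order.TTheory GRing.Theory Num.Theory.
Import numFieldNormedType.Exports.
Local Open Scope classical_set_scope.
Local Open Scope ring_scope.

(** The theorem is pointwise, and it amounts to one identity: the brace on the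
right-hand side, the one multiplied by [ell X], equals [R°(eta, Y, Z, W)] when
[Y] is its distinguished argument.  Once this is known, the equivalence is the
expansion of [R°(phi X, phi Y, phi Z, phi W)], where
[phi X = X - L^-2 g(eta, X) eta]: the terms with [eta] in both of the first
two, or both of the last two, slots vanish, the terms with [eta] in the third or
fourth slot are values of the (v)h-torsion because
[R°(X, Y, Z, eta) = - R°(X, Y, eta, Z)], and the terms with [eta] in the first
or second slot alone are values of [R°(eta, ., ., .)]
([projection_value], [projected_curvature_iff]).

The identity is proved in an induced chart [(x, y)], writing [F = L^2], so that
[g(a, b)] is half of the second derivative of [F] in the vertical directions [a]
and [b].  Vanishing torsion makes the Berwald connection purely horizontal, with
coefficients [Gam(a, c)] symmetric in [a] and [c]; its horizontal map is
[bet a = (a, - N a)] with [N a = Gam(a, y)], and the vanishing of its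
(v)hv-torsion says that the vertical derivative of [N a] along [b] is
[Gam(a, b)].  Differentiating [bet a . F = 0] twice vertically shows that
[G(a, b, c) := (D°_{bet a} g)(b, c)] is half of the derivative of [F] along the
vertical vector [d_c Gam(a, b)] ([GtE]).  Hence [G] is totally symmetric, and it
vanishes as soon as one argument is [y].

The Ricci identity for [g], that is, the commutator of [D°_{bet a}] and
[D°_{bet c}] applied to [g], gives ([Rc_skew])
[g(R(a,c)e, w) + g(R(a,c)w, e) = (D_a G)(c,e,w) - (D_c G)(a,e,w) - (d_{R(a,c)y} g)(e,w)],
where [d] is the vertical derivative.  Putting [w = y] yields the skew-symmetry
of [R°] against [eta]; putting [a = y] leaves one [D_y G] term and one [d g]
term.  As in Riemannian geometry the first Bianchi identity turns this into an
exchange of pairs, with these terms as corrections ([pair_exchange]).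

The corrections have a meaning for the Cartan connection.  Comparing it with the
Berwald connection by the trick of Koszul shows that the horizontal maps
coincide ([bet'_bet]) and that the difference of the horizontal parts is [G / 2]
([cartan_berwald]).  Therefore the lowered (v)hv-torsion is [- G / 2], the
lowered mixed torsion is half of the vertical derivative of [g] ([mixed_T3]), and
the (v)h-torsions agree.

The link between global objects and chart expressions uses bump functions: a
connection is only given on global smooth sections, so its locality, its local
coefficients and their smoothness come from cut-off frames
([connection_local]). *)

(** * Differential calculus and C^k maps on open sets *)

Section Calculus.
Context {R : realType}.

Lemma near_open (T : topologicalType) (U : set T) (P : T -> Prop) x :
  open U -> U x -> (forall z, U z -> P z) -> \forall z \near x, P z.
Proof. by move=> oU Ux UP; apply: filterS UP _; apply: open_nbhs_nbhs; split. Qed.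

(** Differentiability depends on the germ only: the two maps have the same first-order expansion. *)
Lemma near_eq_differentiable (V W : normedModType R) (f g : V -> W) x :
  {near x, f =1 g} -> differentiable f x -> differentiable g x.
Proof.
move=> fg df.
have nfg : \forall z \near (0 : V), f (z + x) = g (z + x).
  have := fg; rewrite [X in X -> _](near_shift 0 x (fun z => f z = g z)).
  by apply: filterS => z /=; rewrite subr0.
have dg : g \o shift x = cst (g x) + 'd f x +o_ 0 id.
  apply/eqaddoP => e e0.
  have /eqaddoP/(_ e e0) := diff_locally df.
  move=> H; near=> z.
  have -> : (g \o shift x - (cst (g x) + 'd f x)) z
    = (f \o shift x - (cst (f x) + 'd f x)) z.
    rewrite !fctE /= (nbhs_singleton fg); congr (_ - _).
    by rewrite (near nfg z).
  by near: z.
apply/diff_locallyP.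
have E := diff_unique (diff_continuous df) dg.
by rewrite E; split => //; exact: diff_continuous.
Unshelve. all: by end_near. Qed.

Lemma scale_is_bilinear (W : normedModType R) :
  bilinear_for (GRing.Scale.Law.clone R W *:%R _) (GRing.Scale.Law.clone R W *:%R _)
    (fun (k : R) (w : W) => k *: w).
Proof.
split=> [u'|u] a x y /=; first by rewrite scalerDl scalerA.
by rewrite scalerDr !scalerA mulrC.
Qed.

Section Leibniz.
Context {V W : normedModType R}.
Implicit Types (a : V -> R) (f g : V -> W) (x v : V).

Lemma diff_scale a f x : differentiable a x -> differentiable f x ->
  differentiable (fun y => a y *: f y) x /\
  forall v, 'D_v (fun y => a y *: f y) x = 'D_v a x *: f x + a x *: 'D_v f x.
Proof.
move=> da df.
pose bM := bilinear_isBilinear.Build _ _ _ _ _ _ _ (@scale_is_bilinear W).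
pose b : {bilinear R -> W -> W} := HB.pack (fun (k : R) (w : W) => k *: w) bM.
have bc : continuous (fun p => b p.1 p.2) by exact: scale_continuous.
have dp : differentiable (fun y => (a y, f y)) x by exact: differentiable_pair.
have db := differentiable_bilin (a x, f x) bc.
have E : (fun y => a y *: f y) = (fun p => b p.1 p.2) \o (fun y => (a y, f y)).
  by [].
split; first by rewrite E; apply: differentiable_comp.
move=> v; rewrite E deriveE; last exact: differentiable_comp.
rewrite diff_comp //= (diff_bilin (f := b) (a x, f x)) //=.
by rewrite diff_pair //= addrC -!deriveE.
Qed.

Lemma derive_scale a f x v : differentiable a x -> differentiable f x ->
  'D_v (fun y => a y *: f y) x = 'D_v a x *: f x + a x *: 'D_v f x.
Proof. by move=> da df; have [_ ->] := diff_scale da df. Qed.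

Lemma derive_add f g x v : differentiable f x -> differentiable g x ->
  'D_v (fun y => f y + g y) x = 'D_v f x + 'D_v g x.
Proof. by move=> df dg; rewrite -deriveD //; exact: diff_derivable. Qed.

Lemma derive_sub f g x v : differentiable f x -> differentiable g x ->
  'D_v (fun y => f y - g y) x = 'D_v f x - 'D_v g x.
Proof. by move=> df dg; rewrite -deriveB //; exact: diff_derivable. Qed.

Lemma derive_linear f x : differentiable f x -> linear (fun v => 'D_v f x).
Proof. by move=> df k u v; rewrite !deriveE // linearP. Qed.

Lemma deriveDv f x v w : differentiable f x ->
  'D_(v + w) f x = 'D_v f x + 'D_w f x.
Proof. by move=> df; rewrite !deriveE // linearD. Qed.

Lemma deriveNv f x v : differentiable f x -> 'D_(- v) f x = - 'D_v f x.
Proof. by move=> df; rewrite !deriveE // linearN. Qed.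

Lemma deriveZv f x k v : differentiable f x -> 'D_(k *: v) f x = k *: 'D_v f x.
Proof. by move=> df; rewrite !deriveE // linearZ. Qed.

Lemma derive_sumv I (r : seq I) (P : pred I) f x (v : I -> V) :
  differentiable f x ->
  'D_(\sum_(i <- r | P i) v i) f x = \sum_(i <- r | P i) 'D_(v i) f x.
Proof.
move=> df; rewrite deriveE // linear_sum; apply: eq_bigr => i _.
by rewrite deriveE.
Qed.

End Leibniz.

Lemma derive_comp (V V' W : normedModType R) (f : V -> V') (g : V' -> W) x v :
  differentiable f x -> differentiable g (f x) ->
  'D_v (g \o f) x = 'D_('D_v f x) g (f x).
Proof.
move=> df dg; rewrite !deriveE //; last exact: differentiable_comp.
by rewrite diff_comp.
Qed.

Lemma derive_lin (V W W' : normedModType R) (l : {linear W -> W'}) (f : V -> W) x v :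
  continuous l -> differentiable f x -> 'D_v (fun y => l (f y)) x = l ('D_v f x).
Proof.
move=> lc df; rewrite -[LHS]/('D_v (l \o f) x) derive_comp //; last first.
  exact: linear_differentiable.
by rewrite deriveE ?diff_lin //; exact: linear_differentiable.
Qed.

Section CkTheory.
Context {V : normedModType R} (U : set V) (oU : open U).

Lemma Ck_cong (W : normedModType R) k (f g : V -> W) :
  (forall x, U x -> f x = g x) -> Ck k U f -> Ck k U g.
Proof.
elim: k f g => [|k IH] f g fg.
  move=> cf x Ux; have n : \near x, f x = g x by exact: near_open fg.
  suff : g @ x --> g x by [].
  rewrite -(fg x Ux); by apply: cvg_trans (cf x Ux); apply: near_eq_cvg; apply: filterS n.
have n x : U x -> \near x, f x = g x by move=> Ux; exact: near_open fg.
move=> [df Df]; split=> [x Ux|v].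
  exact: near_eq_differentiable (n x Ux) (df x Ux).
by apply: IH (Df v) => x Ux; apply: near_eq_derive; exact: n.
Qed.

Lemma CkW (W : normedModType R) k (f : V -> W) : Ck k.+1 U f -> Ck k U f.
Proof.
elim: k f => [|k IH] f [df Df].
  by move=> x Ux; apply: differentiable_continuous; exact: df.
by split => // v; apply: IH.
Qed.

Lemma Ck_diff (W : normedModType R) k (f : V -> W) x : Ck k.+1 U f -> U x ->
  differentiable f x.
Proof. by case=> df _ /df. Qed.

Lemma Ck_cst (W : normedModType R) k (c : W) : Ck k U (fun=> c).
Proof.
elim: k c => [|k IH] c; first by move=> x _; exact: cst_continuous.
split=> [x _|v]; first exact: differentiable_cst.
by apply: Ck_cong (IH 0) => x _; rewrite derive_cst.
Qed.

Lemma CkD (W : normedModType R) k (f g : V -> W) :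
  Ck k U f -> Ck k U g -> Ck k U (fun x => f x + g x).
Proof.
elim: k f g => [|k IH] f g cf cg.
  by move=> x Ux; apply: continuousD; [exact: cf|exact: cg].
split=> [x Ux|v]; first by apply: differentiableD; [exact: cf.1|exact: cg.1].
apply: Ck_cong (IH _ _ (cf.2 v) (cg.2 v)) => x Ux.
by rewrite derive_add //; [exact: cf.1|exact: cg.1].
Qed.

Lemma CkZ (W : normedModType R) k (a : V -> R) (f : V -> W) :
  Ck k U a -> Ck k U f -> Ck k U (fun x => a x *: f x).
Proof.
elim: k a f => [|k IH] a f ca cf.
  by move=> x Ux; apply: continuousZ; [exact: ca|exact: cf].
split=> [x Ux|v]; first by apply: (diff_scale _ _).1; [exact: ca.1|exact: cf.1].
apply: Ck_cong (CkD (IH _ _ (ca.2 v) (CkW cf)) (IH _ _ (CkW ca) (cf.2 v))) => x Ux.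
by rewrite derive_scale //; [exact: ca.1|exact: cf.1].
Qed.

Lemma CkM k (a f : V -> R) : Ck k U a -> Ck k U f -> Ck k U (fun x => a x * f x).
Proof. exact: CkZ. Qed.

Lemma CkN (W : normedModType R) k (f : V -> W) :
  Ck k U f -> Ck k U (fun x => - f x).
Proof.
move=> cf; apply: Ck_cong (CkZ (Ck_cst k (-1 : R)) cf) => x _.
by rewrite scaleN1r.
Qed.

Lemma CkB (W : normedModType R) k (f g : V -> W) :
  Ck k U f -> Ck k U g -> Ck k U (fun x => f x - g x).
Proof. by move=> cf /CkN; exact: CkD. Qed.

Lemma Ck_sum (W : normedModType R) k I (r : seq I) (P : pred I) (f : I -> V -> W) :
  (forall i, P i -> Ck k U (f i)) -> Ck k U (fun x => \sum_(i <- r | P i) f i x).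
Proof.
move=> cf; elim: r => [|i r IH].
  by apply: Ck_cong (Ck_cst k 0) => x _; rewrite big_nil.
have [Pi|Pi] := boolP (P i).
  by apply: Ck_cong (CkD (cf _ Pi) IH) => x _; rewrite big_cons Pi.
by apply: Ck_cong IH => x _; rewrite big_cons (negbTE Pi).
Qed.

Lemma Ck_lin (W W' : normedModType R) k (l : {linear W -> W'}) (f : V -> W) :
  continuous l -> Ck k U f -> Ck k U (fun x => l (f x)).
Proof.
move=> lc; elim: k f => [|k IH] f cf.
  by move=> x Ux; apply: continuous_comp; [exact: cf|exact: lc].
split=> [x Ux|v].
  by apply: differentiable_comp; [exact: cf.1|exact: linear_differentiable].
by apply: Ck_cong (IH _ (cf.2 v)) => x Ux; rewrite derive_lin //; exact: cf.1.
Qed.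

Lemma Ck_inv k (a : V -> R) : (forall x, U x -> a x != 0) ->
  Ck k U a -> Ck k U (fun x => (a x)^-1).
Proof.
move=> a0; elim: k => [|k IH] ca.
  by move=> x Ux; apply: continuousV; [exact: a0|exact: ca].
split=> [x Ux|v]; first by apply: differentiableV; [exact: ca.1|exact: a0].
have IH' := IH (CkW ca).
apply: Ck_cong (CkN (CkM (CkM IH' IH') (ca.2 v))) => x Ux.
have da : differentiable a x by exact: ca.1.
rewrite deriveV ?a0 //; last exact: diff_derivable.
by rewrite -invfM -expr2 scaleNr.
Qed.

Lemma Ck_locally (W : normedModType R) k (f : V -> W) :
  (forall x, U x -> exists2 U', U' x & Ck k U' f) -> Ck k U f.
Proof.
elim: k f => [|k IH] f cf.
  by move=> x Ux; have [U' U'x] := cf x Ux; apply.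
split=> [x Ux|v].
  by have [U' U'x [df _]] := cf x Ux; exact: df.
apply: IH => x Ux; have [U' U'x [_ Df]] := cf x Ux.
by exists U' => //; exact: Df.
Qed.

Lemma CkS (W : normedModType R) k (U' : set V) (f : V -> W) :
  U' `<=` U -> Ck k U f -> Ck k U' f.
Proof.
move=> sU; elim: k f => [|k IH] f cf; first by move=> x /sU /cf.
by split=> [x /sU /cf.1 //|v]; apply: IH; exact: cf.2.
Qed.

End CkTheory.

Lemma Ck_id (V : normedModType R) (U : set V) k : open U -> Ck k U id.
Proof.
move=> oU; case: k => [|k]; first by move=> x _ ; exact: cvg_id.
split=> [x _|v]; first exact: ex_diff.
by apply: Ck_cong (Ck_cst oU k v) => // x _; rewrite derive_id.
Qed.

Section Comp.
Context {V V' W : normedModType R} {m : nat}.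
Variables (c : 'I_m -> {linear V' -> R}) (e : 'I_m -> V').
Hypothesis cc : forall j, continuous (c j).
Hypothesis ce : forall y, y = \sum_j c j y *: e j.

(** Chain rule for [C^k] maps, by induction on [k].  Expanding the velocity in a
basis turns the derivative of a composite into a finite sum of products in which
only derivatives of [g] in fixed directions occur, and to these the induction
hypothesis applies. *)
Lemma Ck_comp_basis k (U : set V) (U' : set V') (f : V -> V') (g : V' -> W) :
  open U -> (forall x, U x -> U' (f x)) -> Ck k U f -> Ck k U' g ->
  Ck k U (g \o f).
Proof.
move=> oU fU; elim: k f g fU => [|k IH] f g fU cf cg.
  by move=> x Ux; apply: continuous_comp; [exact: cf|apply: cg; exact: fU].
split=> [x Ux|v].
  by apply: differentiable_comp; [exact: cf.1|apply: cg.1; exact: fU].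
have cj j : Ck k U (fun x => c j ('D_v f x) *: (('D_(e j) g) \o f) x).
  apply: CkZ => //; first by apply: Ck_lin => //; exact: cf.2.
  by apply: IH => //; [exact: CkW cf|exact: cg.2].
apply: Ck_cong (Ck_sum oU (index_enum _) (P := xpredT) (fun j _ => cj j)) => // x Ux.
have dg : differentiable g (f x) by apply: cg.1; exact: fU.
rewrite derive_comp //; last exact: cf.1.
rewrite [in RHS](ce ('D_v f x)) derive_sumv //.
by apply: eq_bigr => j _; rewrite deriveZv.
Qed.
End Comp.

End Calculus.

(** * Maps on row vectors and symmetry of second derivatives *)

Section Coordinates.
Context {R : realType}.

Definition coordl m (j : 'I_m) (v : 'rV[R]_m) : R := v 0 j.

Lemma coordl_is_linear m (j : 'I_m) : linear (coordl j).
Proof. by move=> k u v; rewrite /coordl !mxE. Qed.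

HB.instance Definition _ m (j : 'I_m) :=
  GRing.isLinear.Build R 'rV[R]_m R _ (@coordl m j) (coordl_is_linear j).

Lemma coordl_continuous m (j : 'I_m) : continuous (coordl j).
Proof. exact: coord_continuous. Qed.

Lemma rV_linear_continuous m (W : normedModType R) (l : {linear 'rV[R]_m -> W}) :
  continuous l.
Proof.
have E : (l : 'rV[R]_m -> W) = fun x => \sum_j coordl j x *: l (delta_mx 0 j).
  rewrite funeqE => x; rewrite {1}(row_sum_delta x) linear_sum.
  by apply: eq_bigr => j _; rewrite linearZ.
have : Ck 0 setT (fun x => \sum_j coordl j x *: l (delta_mx 0 j)).
  apply: (Ck_sum openT) => j _; apply: (CkZ openT); last exact: (Ck_cst openT).
  by move=> x _; exact: coordl_continuous.
by rewrite -E => c x; exact: c.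
Qed.

Lemma rV_linear_diff m (W : normedModType R) (l : {linear 'rV[R]_m -> W}) x :
  differentiable l x.
Proof. by apply: linear_differentiable; exact: rV_linear_continuous. Qed.

Lemma rV_derive_lin m (W : normedModType R) (l : {linear 'rV[R]_m -> W}) x v :
  'D_v l x = l v.
Proof.
by rewrite deriveE ?diff_lin //; [exact: rV_linear_continuous|exact: rV_linear_diff].
Qed.

Lemma smooth_rV_lin m (W : normedModType R) (l : {linear 'rV[R]_m -> W}) U :
  open U -> smooth_on U l.
Proof.
by move=> oU k; apply: (Ck_lin oU (l := l) (f := id)) (Ck_id k oU); exact: rV_linear_continuous.
Qed.

Lemma Ck_comp m (V W : normedModType R) k (U : set V) (U' : set 'rV[R]_m)
    (f : V -> 'rV[R]_m) (g : 'rV[R]_m -> W) :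
  open U -> (forall x, U x -> U' (f x)) -> Ck k U f -> Ck k U' g ->
  Ck k U (g \o f).
Proof.
move=> oU fU cf cg.
apply: (Ck_comp_basis (c := fun j => @coordl m j) (e := delta_mx 0)
  _ _ oU fU cf cg).
  exact: coordl_continuous.
by move=> y; exact: row_sum_delta.
Qed.

Lemma Ck_comp1 (V W : normedModType R) k (U : set V) (U' : set R)
    (f : V -> R) (g : R -> W) :
  open U -> (forall x, U x -> U' (f x)) -> Ck k U f -> Ck k U' g ->
  Ck k U (g \o f).
Proof.
move=> oU fU cf cg.
apply: (Ck_comp_basis (c := fun j : 'I_1 => idfun) (e := fun=> 1)
  _ _ oU fU cf cg).
  by move=> _ x; exact: cvg_id.
by move=> y; rewrite big_ord1 /=; exact: esym (mulr1 _).
Qed.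

Lemma Ck_rV m (V : normedModType R) k (U : set V) (f : V -> 'rV[R]_m) :
  open U -> (forall j, Ck k U (fun x => f x 0 j)) -> Ck k U f.
Proof.
move=> oU cf.
have cj j : Ck k U (fun x => f x 0 j *: delta_mx 0 j : 'rV[R]_m).
  by apply: CkZ => //; exact: Ck_cst.
apply: (Ck_cong oU) (Ck_sum oU (index_enum _) (P := xpredT) (fun j _ => cj j)) => x Ux.
by rewrite [RHS]row_sum_delta.
Qed.

Lemma Ck_coord m (V : normedModType R) k (U : set V) (f : V -> 'rV[R]_m) j :
  open U -> Ck k U f -> Ck k U (fun x => f x 0 j).
Proof.
move=> oU; apply: (Ck_lin oU (l := @coordl m j)); exact: coordl_continuous.
Qed.

Lemma derive_coord m (V : normedModType R) (f : V -> 'rV[R]_m) j x v :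
  differentiable f x -> 'D_v (fun y => f y 0 j) x = 'D_v f x 0 j.
Proof.
move=> df; apply: (derive_lin (l := @coordl m j)) => //; exact: coordl_continuous.
Qed.

Lemma smooth_derive (V W : normedModType R) U (f : V -> W) v :
  smooth_on U f -> smooth_on U ('D_v f).
Proof. by move=> sf k; exact: (sf k.+1).2. Qed.

Lemma smooth_diff (V W : normedModType R) U (f : V -> W) x :
  smooth_on U f -> U x -> differentiable f x.
Proof. by move=> sf; exact: Ck_diff (sf 1%N). Qed.

Lemma smooth_deriveV m (W : normedModType R) U (f : 'rV[R]_m -> W)
    (w : 'rV[R]_m -> 'rV[R]_m) :
  open U -> smooth_on U f -> smooth_on U w ->
  smooth_on U (fun x => 'D_(w x) f x).
Proof.
move=> oU sf sw k.
have cj j : Ck k U (fun x => w x 0 j *: 'D_(delta_mx 0 j) f x).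
  exact: (CkZ oU (Ck_coord j oU (sw k)) (smooth_derive (delta_mx 0 j) sf k)).
apply: (Ck_cong oU) (Ck_sum oU (index_enum _) (P := xpredT) (fun j _ => cj j)) => x Ux.
rewrite [in RHS](row_sum_delta (w x)) derive_sumv; last exact: smooth_diff sf Ux.
by apply: eq_bigr => j _; rewrite deriveZv //; exact: smooth_diff sf Ux.
Qed.

End Coordinates.

Section Schwarz.
Context {R : realType} {V : normedModType R}.
Variables (U : set V) (oU : open U).

Lemma derive_line (f : V -> R) (p v : V) (s : R) : differentiable f (p + s *: v) ->
  is_derive s 1 (fun t => f (p + t *: v)) ('D_v f (p + s *: v)).
Proof.
move=> df; pose l (t : R) := p + t *: v.
have di : differentiable (id : R -> R) s by exact: ex_diff.
have [ds Ds] := diff_scale di (differentiable_cst v s).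
have dl : differentiable l s.
  by apply: differentiableD; [exact: differentiable_cst|exact: ds].
have Dl : 'D_1 l s = v.
  rewrite /l derive_add; [|exact: differentiable_cst|exact: ds].
  by rewrite derive_cst add0r Ds derive_cst derive_id scaler0 addr0 scale1r.
rewrite -[X in is_derive _ _ X _]/(f \o l).
have dc : differentiable (f \o l) s by exact: differentiable_comp.
apply: DeriveDef; first exact: diff_derivable.
by rewrite derive_comp // Dl.
Qed.

Lemma MVT_line (f : V -> R) (p v : V) (h : R) : 0 < h ->
  (forall t, 0 <= t <= h -> differentiable f (p + t *: v)) ->
  exists2 s, 0 <= s <= h & f (p + h *: v) - f p = h * 'D_v f (p + s *: v).
Proof.
move=> h0 df; pose F t := f (p + t *: v).
have dF t : 0 <= t <= h -> is_derive t 1 F ('D_v f (p + t *: v)).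
  by move=> vert; apply: derive_line; exact: df.
have [||c] := @MVT_segment R F (fun t => 'D_v f (p + t *: v)) 0 h (ltW h0).
- move=> t; rewrite in_itv/= => /andP[a b]; apply: dF; rewrite (ltW a) (ltW b)//.
- apply: derivable_within_continuous => t; rewrite in_itv/= => vert.
  by have [] := dF t vert.
rewrite in_itv/= => ch; rewrite /F scale0r addr0 subr0 mulrC => E.
by exists c.
Qed.

(** The mixed second difference is evaluated by the mean value theorem, first in
the direction [v] and then in the direction [w]; only one of the two iterated
derivatives enters, so that exchanging the roles of [v] and [w] compares both with
the same quantity. *)
Lemma second_difference (f : V -> R) x v w (e : R) : Ck 2 U f -> U x -> 0 < e ->
  exists2 d, 0 < d & forall h, 0 < h < d ->
    `| (f (x + h *: w + h *: v) - f (x + h *: v) - (f (x + h *: w) - f x))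
       - h ^+ 2 * 'D_w ('D_v f) x | < h ^+ 2 * e.
Proof.
move=> cf Ux e0.
have cD : {for x, continuous ('D_w ('D_v f))} by have [_ /(_ v)[_ /(_ w)]] := cf; exact.
have [r r0 Hr] : exists2 r : R, 0 < r & forall y, `|x - y| < r ->
    U y /\ `|'D_w ('D_v f) x - 'D_w ('D_v f) y| < e.
  have n : \forall y \near x, U y /\ `|'D_w ('D_v f) x - 'D_w ('D_v f) y| < e.
    near=> y; split; near: y; first exact: open_nbhs_nbhs.
    by move/cvgrPdist_lt : cD => /(_ _ e0).
  have /nbhs_ballP[r /= r0 H] := n.
  by exists r => // y xy; apply: H; rewrite -ball_normE.
(* [h M] bounds every displacement [s w + t v] with [s], [t] at most [h]. *)
pose M := `|v| + `|w| + 1.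
have M0 : 0 < M by rewrite /M ltr_wpDl // addr_ge0.
exists (r / M); first by rewrite divr_gt0.
move=> h /andP[h0 hd].
have hM : h * M < r by rewrite -ltr_pdivlMr.
have inU s t : 0 <= s <= h -> 0 <= t <= h -> `|x - (x + s *: w + t *: v)| < r.
  move=> /andP[s0 sh] /andP[t0 vert].
  have -> : x - (x + s *: w + t *: v) = - (s *: w + t *: v).
    by rewrite opprD addrA opprD addrA subrr add0r opprD.
  rewrite normrN (le_lt_trans (ler_normD _ _))// !normrZ !ger0_norm//.
  apply: le_lt_trans hM; rewrite /M !mulrDr mulr1 addrC.
  rewrite -[leLHS]addr0 lerD ?(ltW h0)// lerD// ler_wpM2r//.
have df y : `|x - y| < r -> differentiable f y.
  by move=> /Hr[Uy _]; have [+ _] := cf; exact.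
have dDf y : `|x - y| < r -> differentiable ('D_v f) y.
  by move=> /Hr[Uy _]; have [_ /(_ v)[+ _]] := cf; exact.
have hh : 0 <= h <= h by rewrite (ltW h0) lexx.
have h00 : 0 <= (0 : R) <= h by rewrite lexx (ltW h0).
pose F y := f (y + h *: w) - f y.
have sh y : differentiable f (y + h *: w) ->
    differentiable (fun z => f (z + h *: w)) y /\
    'D_v (fun z => f (z + h *: w)) y = 'D_v f (y + h *: w).
  move=> d1; have ds : differentiable (fun z : V => z + h *: w) y.
    by apply: differentiableD; [exact: ex_diff|exact: differentiable_cst].
  have E : (fun z => f (z + h *: w)) = f \o (fun z => z + h *: w) by [].
  split; first by rewrite E; exact: differentiable_comp.
  rewrite E derive_comp //; congr ('D_ _ _ _).
  by rewrite derive_add ?derive_cst ?addr0 ?derive_id //.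
have [s sh1 Es] : exists2 s, 0 <= s <= h & F (x + h *: v) - F x
    = h * ('D_v f (x + h *: w + s *: v) - 'D_v f (x + s *: v)).
  have d1 t : 0 <= t <= h -> differentiable f (x + t *: v + h *: w).
    by move=> vert; rewrite addrAC; apply: df; exact: inU.
  have d2 t : 0 <= t <= h -> differentiable f (x + t *: v).
    move=> vert; apply: df; have := inU 0 t h00 vert.
    by rewrite scale0r addr0.
  have [t vert|s sh1 E] := @MVT_line F x v h h0.
    by apply: differentiableB; [exact: (sh _ (d1 _ vert)).1|exact: d2].
  exists s => //; rewrite E derive_sub; last exact: d2.
    by rewrite (sh _ (d1 _ sh1)).2 [x + h *: w + _]addrAC.
  exact: (sh _ (d1 _ sh1)).1.
have [t vert Et] : exists2 t, 0 <= t <= h &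
    'D_v f (x + h *: w + s *: v) - 'D_v f (x + s *: v)
    = h * 'D_w ('D_v f) (x + t *: w + s *: v).
  have [t vert|t vert E] := @MVT_line ('D_v f) (x + s *: v) w h h0.
    by apply: dDf; rewrite addrAC; exact: inU.
  exists t; first exact: vert.
  by rewrite [x + t *: w + _]addrAC -E [x + h *: w + _]addrAC.
have -> : f (x + h *: w + h *: v) - f (x + h *: v) - (f (x + h *: w) - f x)
    = F (x + h *: v) - F x by rewrite /F [x + h *: v + _]addrAC.
rewrite Es Et mulrA -expr2 -mulrBr normrM ger0_norm ?sqr_ge0//.
by rewrite ltr_pM2l ?exprn_gt0// distrC; have [] := Hr _ (inU t s vert sh1).
Unshelve. all: by end_near. Qed.

Lemma close_twice (D a b c : R) : 0 < c ->
  `|D - c * a| < c * (`|a - b| / 2) -> `|D - c * b| < c * (`|a - b| / 2) -> False.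
Proof.
move=> c0 A1 A2.
have : `|c * (a - b)| < c * `|a - b|.
  have -> : c * (a - b) = (D - c * b) - (D - c * a) by ring.
  apply: le_lt_trans (ler_normB _ _) _.
  by rewrite [X in _ < c * X]splitr mulrDr ltrD.
by rewrite normrM gtr0_norm // ltxx.
Qed.

Lemma schwarz (f : V -> R) x v w : Ck 2 U f -> U x ->
  'D_w ('D_v f) x = 'D_v ('D_w f) x.
Proof.
move=> cf Ux; apply/eqP; rewrite -subr_eq0 -normr_eq0; apply/negPn/negP => n0.
set a := 'D_w ('D_v f) x in n0 *; set b := 'D_v ('D_w f) x in n0 *.
pose e := `|a - b| / 2.
have ab0 : 0 < `|a - b| by rewrite lt_neqAle eq_sym n0 normr_ge0.
have e0 : 0 < e by rewrite divr_gt0.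
have [d1 d10 H1] := second_difference v w cf Ux e0.
have [d2 d20 H2] := second_difference w v cf Ux e0.
pose h := Num.min d1 d2 / 2.
have m0 : 0 < Num.min d1 d2 by rewrite lt_min d10.
have h0 : 0 < h by rewrite divr_gt0.
have hm : h < Num.min d1 d2 by rewrite ltr_pdivrMr // ltr_pMr // ltr1n.
have /H1 A1 : 0 < h < d1 by rewrite h0 (lt_le_trans hm)// ge_min lexx.
have /H2 A2 : 0 < h < d2 by rewrite h0 (lt_le_trans hm)// ge_min lexx orbT.
have E : f (x + h *: v + h *: w) - f (x + h *: w) - (f (x + h *: v) - f x)
  = f (x + h *: w + h *: v) - f (x + h *: v) - (f (x + h *: w) - f x).
  have -> : x + h *: v + h *: w = x + h *: w + h *: v by rewrite addrAC.
  have swap (a1 a2 a3 a4 : R) : a1 - a2 - (a3 - a4) = a1 - a3 - (a2 - a4) by ring.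
  exact: swap.
rewrite E in A2.
have hh0 : 0 < h ^+ 2 by exact: exprn_gt0.
exact: (close_twice hh0 A1 A2).
Qed.

End Schwarz.

Lemma schwarz_rV (R : realType) (V : normedModType R) m (U : set V)
    (f : V -> 'rV[R]_m) x v w : open U -> Ck 2 U f -> U x ->
  'D_w ('D_v f) x = 'D_v ('D_w f) x.
Proof.
move=> oU cf Ux; apply/rowP => j.
have D u y : U y -> 'D_u f y 0 j = 'D_u (fun z => f z 0 j) y.
  by move=> Uy; rewrite derive_coord //; exact: cf.1.
have D2 u u' : 'D_u' ('D_u f) x 0 j = 'D_u' (fun z => 'D_u f z 0 j) x.
  by apply/esym/derive_coord; exact: (cf.2 u).1.
have E u : \near x, 'D_u f x 0 j = 'D_u (fun z => f z 0 j) x.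
  by apply: near_open oU Ux _ => z Uz; exact: D.
apply: etrans (D2 v w) _; apply: etrans _ (esym (D2 w v)).
apply: etrans (near_eq_derive _ (E v)) _.
apply: etrans _ (esym (near_eq_derive _ (E w))).
exact: (schwarz oU v w (Ck_coord j oU cf) Ux).
Qed.

(** * Smooth bump functions *)

Section Bump.
Context {R : realType}.

(** The powers of [1/t] are kept in the family because it is then stable under
differentiation ([flat_derive]), which makes smoothness an induction. *)
Definition flat (m : nat) (t : R) : R := if 0 < t then t ^- m * expR (- t^-1) else 0.

Lemma flat_ge0 m t : 0 <= flat m t.
Proof.
rewrite /flat; case: ifP => // t0.
by rewrite mulr_ge0 ?expR_ge0 // invr_ge0 exprn_ge0 // ltW.
Qed.

Lemma flat_gt0 m t : 0 < t -> 0 < flat m t.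
Proof. by move=> t0; rewrite /flat t0 mulr_gt0 ?expR_gt0 // invr_gt0 exprn_gt0. Qed.

Lemma flat_le0 m t : t <= 0 -> flat m t = 0.
Proof. by move=> t0; rewrite /flat ltNge t0. Qed.

(** A quadratic bound at the origin is all that is needed for the derivative there to
vanish.  It follows from [x <= exp x] at [x = 1 / (t (m + 2))], raised to the power
[m + 2]. *)
Lemma flat_bound m t : flat m t <= (m.+2)%:R ^+ m.+2 * t ^+ 2.
Proof.
rewrite /flat; case: ifP => [t0|_]; last first.
  by apply: mulr_ge0; [apply: exprn_ge0; exact: ler0n|exact: sqr_ge0].
pose N : R := (m.+2)%:R; have N0 : 0 < N by rewrite ltr0n.
have tN : 0 < t * N by rewrite mulr_gt0.
have e1 : (t * N)^-1 <= expR ((t * N)^-1).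
  by apply: le_trans (expR_ge1Dx _); rewrite lerDr.
have e2 : expR (- t^-1) <= (t * N) ^+ m.+2.
  have -> : - t^-1 = (- (t * N)^-1) * (m.+2)%:R.
    by rewrite -/N invfM mulNr -mulrA mulVf ?gt_eqF // mulr1.
  rewrite expRM_natr lerXn2r ?nnegrE ?expR_ge0 ?(ltW tN)//.
  by rewrite expRN -[leRHS]invrK lef_pV2 ?posrE ?expR_gt0 ?invr_gt0.
have tm : 0 < t ^+ m by rewrite exprn_gt0.
rewrite ler_pdivrMl //; apply: le_trans e2 _.
by rewrite -/N mulrCA -exprD addn2 -exprMn [N * t]mulrC.
Qed.

Lemma flat_derive (m : nat) (t : R) :
  is_derive t 1 (flat m) (- m%:R * flat m.+1 t + flat m.+2 t).
Proof.
have [t0|t0|->] := ltgtP t 0.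
- have E : \near t, cst 0 t = flat m t.
    near=> z; rewrite flat_le0 //; apply: ltW; near: z; exact: lt_nbhsl.
  apply: (near_eq_is_derive E).
  by rewrite !(flat_le0 _ (ltW t0)) mulr0 addr0; exact: is_derive_cst.
- pose F (z : R) := (z^-1) ^+ m * expR (- z^-1).
  have E : \near t, F t = flat m t.
    near=> z; have z0 : 0 < z by near: z; exact: lt_nbhsr.
    by rewrite /F /flat z0 exprVn.
  apply: (near_eq_is_derive E).
  have tn0 : t != 0 by rewrite gt_eqF.
  have dV : is_derive t 1 (fun z : R => z^-1) (- t ^- 2).
    apply: is_derive_eq; first exact: (@is_deriveV R id t 1 1 tn0 _).
    by rewrite /= -[RHS]mulr1.
  have dN : is_derive t 1 (fun z : R => - z^-1) (t ^- 2).
    by apply: is_derive_eq; rewrite opprK.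
  have dE : is_derive t 1 (fun z : R => expR (- z^-1)) (expR (- t^-1) * t ^- 2).
    exact: (is_derive1_comp (is_derive_expR _) dN).
  have dX : is_derive t 1 (fun z : R => z^-1 ^+ m) (- m%:R * t ^- m.+1).
    case: m {F E} => [|m].
      rewrite oppr0 mul0r; under eq_fun do rewrite expr0; exact: is_derive_cst.
    have -> : (fun z : R => z^-1 ^+ m.+1) = (fun z : R => z^-1) ^+ m.+1.
      by rewrite exprfctE.
    apply: is_derive_eq.
    rewrite /= /GRing.scale /= exprVn mulrN mulNr -mulr_natl -!mulrA -!exprVn.
    by rewrite -exprD addn2.
  have -> : F = (fun z => z^-1 ^+ m) * (fun z => expR (- z^-1)) by [].
  apply: is_derive_eq.
  rewrite /flat t0 /GRing.scale /= -!exprVn addrC.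
  by rewrite mulrA [_ * (_ * _ ^+ 2)]mulrCA -exprD addn2; ring.
- rewrite !flat_le0 // mulr0 addr0.
  set C : R := (m.+2)%:R ^+ m.+2.
  have C0 : 0 < C by rewrite exprn_gt0 // ltr0n.
  have lim0 : h^-1 *: (flat m (h *: 1 + 0) - flat m 0) @[h --> 0^'] --> (0 : R).
    apply/cvgrPdist_le => e e0; near=> h.
    rewrite sub0r normrN [flat m 0]flat_le0 // subr0 addr0 [h *: 1]mulr1.
    have h0 : h != 0 by near: h; exact: nbhs_dnbhs_neq.
    rewrite normrM normfV ler_pdivrMl ?normr_gt0 // ger0_norm ?flat_ge0 //.
    apply: le_trans (flat_bound m h) _.
    have -> : h ^+ 2 = `|h| * `|h| by rewrite -expr2 real_normK ?num_real.
    rewrite mulrCA ler_wpM2l // -/C.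
    rewrite mulrC -ler_pdivlMr //.
    by near: h; apply: dnbhs0_le; rewrite divr_gt0.
  apply: DeriveDef; first by apply/cvg_ex; exists 0.
  exact: cvg_lim.
Unshelve. all: by end_near. Qed.

Lemma Ck_flat k m : Ck k setT (flat m).
Proof.
elim: k m => [|k IH] m.
  move=> t _; apply: differentiable_continuous; apply/derivable1_diffP.
  by have [] := flat_derive m t.
have d t : differentiable (flat m) t.
  by apply/derivable1_diffP; have [] := flat_derive m t.
split=> [t _|v]; first exact: d.
have c : Ck k setT (fun t => v *: (- m%:R * flat m.+1 t + flat m.+2 t)).
  apply: (CkZ openT); first exact: (Ck_cst openT).
  by apply: (CkD openT) => //; apply: (CkM openT) => //; exact: (Ck_cst openT).
apply: (Ck_cong openT) c => t _.
have [_ <-] := flat_derive m t; rewrite -(deriveZv v (1 : R) (d t)); congr ('D_ _ _ _); exact: mulr1.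
Qed.

Definition step (t : R) : R := flat 0 t * (flat 0 t + flat 0 (1 - t))^-1.

Lemma step_den t : flat 0 t + flat 0 (1 - t) != 0.
Proof.
have [t0|t0] := ltP 0 t.
  by rewrite gt_eqF // ltr_pwDl ?flat_gt0 ?flat_ge0.
by rewrite gt_eqF // ltr_wpDl ?flat_gt0 ?flat_ge0 // subr_gt0 (le_lt_trans t0).
Qed.

Lemma step1 t : 1 <= t -> step t = 1.
Proof.
move=> t1; have := step_den t; rewrite /step (flat_le0 0 (t := 1 - t)) ?subr_le0 // addr0.
by move=> n0; rewrite divff.
Qed.

Lemma step0 t : t <= 0 -> step t = 0.
Proof. by move=> t0; rewrite /step flat_le0 // mul0r. Qed.

Lemma Ck_step k : Ck k setT step.
Proof.
have cf : Ck k setT (flat 0) by exact: Ck_flat.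
have cg : Ck k setT (fun t : R => flat 0 (1 - t)).
  apply: (Ck_comp1 (U' := setT) (f := fun t : R => 1 - t)) => //; first exact: openT.
  by apply: (CkB openT); [exact: (Ck_cst openT)|exact: (Ck_id _ openT)].
apply: (CkM openT) => //; apply: (Ck_inv openT); first by move=> t _; exact: step_den.
exact: (CkD openT).
Qed.

Lemma bump_exists n (U : set 'rV[R]_n) x0 : open U -> U x0 ->
  exists psi : 'rV[R]_n -> R, exists K : set 'rV[R]_n,
    [/\ smooth_on setT psi, \near x0, psi x0 = 1, compact K, K `<=` U
      & forall x, ~ K x -> psi x = 0].
Proof.
move=> oU Ux0.
have /nbhs_ballP[r' /= r'0 Br] : nbhs x0 U by exact: open_nbhs_nbhs.
pose r := r' / 2; have r0 : 0 < r by rewrite divr_gt0.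
have rr' : r < r' by rewrite ltr_pdivrMr // ltr_pMr // ltr1n.
(* The Euclidean square, unlike the norm, is smooth. *)
pose Q (x : 'rV[R]_n) : R := \sum_j (x 0 j - x0 0 j) ^+ 2.
(* [q] is [2] at [x0] and nonpositive outside the cube [K] of half-side [r]. *)
pose q (x : 'rV[R]_n) : R := 2 - (2 / r ^+ 2) * Q x.
pose K := [set x : 'rV[R]_n | forall j, `[x0 0 j - r, x0 0 j + r]%classic (x 0 j)].
have cQ k : Ck k setT Q.
  apply: (Ck_sum openT) => j _.
  have c1 : Ck k setT (fun x : 'rV[R]_n => x 0 j - x0 0 j).
    apply: (CkB openT); last exact: (Ck_cst openT).
    by apply: (Ck_coord (f := id) _ openT); exact: (Ck_id _ openT).
  exact: (CkM openT c1 c1).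
have cq k : Ck k setT q.
  apply: (CkB openT); first exact: (Ck_cst openT).
  by apply: (CkM openT) => //; exact: (Ck_cst openT).
exists (fun x => step (q x)), K; split.
- move=> k; exact: (Ck_comp1 (U' := setT) (g := step) openT _ (cq k) (Ck_step k)).
- have q0 : 1 < q x0.
    rewrite /q /Q big1 ?mulr0 ?subr0 ?ltr1n // => j _.
    by rewrite subrr expr0n.
  have cqx : {for x0, continuous q} by exact: (cq 0%N).
  near=> x; apply: step1; apply: ltW; near: x.
  by have := cqx _ (lt_nbhsr q0).
- apply: (@rV_compact R n (fun j => `[x0 0 j - r, x0 0 j + r]%classic)) => j.
  exact: segment_compact.
- move=> x Kx; apply: Br; rewrite -ball_normE /=.
  apply: le_lt_trans rr'; rewrite [leLHS]mx_normrE; apply: bigmax_le; first exact: ltW.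
  move=> [i j] _ /=; rewrite !mxE ord1 ler_distlC.
  by have := Kx j; rewrite /= in_itv /=.
- move=> x nKx; apply: step0; rewrite /q subr_le0 leNgt; apply/negP => qx.
  apply: nKx => j; rewrite /= in_itv /= -ler_distlC distrC.
  have Qr : Q x < r ^+ 2.
    move: qx; rewrite mulrAC ltr_pdivrMr ?exprn_gt0 // ltr_pM2l //.
  have : (x 0 j - x0 0 j) ^+ 2 <= r ^+ 2.
    apply: le_trans (ltW Qr); rewrite /Q (bigD1 j) //= lerDl.
    by apply: sumr_ge0 => i _; exact: sqr_ge0.
  by move=> H; rewrite -(@ler_pXn2r _ 2) ?nnegrE ?normr_ge0 ?(ltW r0) // real_normK ?num_real.
Unshelve. all: by end_near. Qed.

End Bump.

(** * Charts, tangent vectors and vector fields *)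

Section Frozen.
Context {R : realType} {V W : normedModType R} {m : nat}.
Variables (U : set V) (x : V) (B : V -> 'rV[R]_m -> W).
Hypotheses (oU : open U) (Ux : U x).
Hypothesis (Blin : forall z, U z -> linear (B z)).
Hypothesis (Bdiff : forall c, differentiable (B^~ c) x).

Let e j : 'rV[R]_m := delta_mx 0 j.

Lemma linear_expand z c : U z -> B z c = \sum_j c 0 j *: B z (e j).
Proof.
move=> Uz; pose lM := GRing.isLinear.Build _ _ _ _ (B z) (Blin Uz).
pose l : {linear 'rV[R]_m -> W} := HB.pack (B z) lM.
rewrite -[B z]/(l : _ -> _) {1}(row_sum_delta c) linear_sum.
by apply: eq_bigr => j _; rewrite linearZ.
Qed.

Lemma derive_sum_scale (a : V -> 'rV[R]_m) v : differentiable a x ->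
  differentiable (fun z => \sum_j a z 0 j *: B z (e j)) x /\
  'D_v (fun z => \sum_j a z 0 j *: B z (e j)) x =
  \sum_j ('D_v a x 0 j *: B x (e j) + a x 0 j *: 'D_v (B^~ (e j)) x).
Proof.
move=> da.
have dc j : differentiable (fun z => a z 0 j) x.
  apply: (differentiable_comp (f := a) (g := @coordl R m j)) => //.
  exact: rV_linear_diff.
have dj j : differentiable (fun z => a z 0 j *: B z (e j)) x.
  by apply: (diff_scale _ _).1.
have -> : (fun z => \sum_j a z 0 j *: B z (e j)) = \sum_j (fun z => a z 0 j *: B z (e j)).
  by apply: funext => z; rewrite fct_sumE.
split; first exact: differentiable_sum.
rewrite derive_sum; last by move=> j; exact: diff_derivable.
apply: eq_bigr => j _.
apply: etrans (derive_scale v (dc j) (Bdiff (e j))) _.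
by rewrite derive_coord.
Qed.

(** A family of linear maps applied to a moving vector is a finite sum of products
once the vector is expanded in the standard basis; so differentiability with
frozen vectors suffices. *)
Lemma diff_frozen (w : V -> 'rV[R]_m) : differentiable w x ->
  differentiable (fun z => B z (w z)) x.
Proof.
move=> dw; have [d _] := derive_sum_scale 0 dw.
apply: near_eq_differentiable d; apply: near_open oU Ux _ => z Uz.
by rewrite linear_expand.
Qed.

(** Leibniz rule: differentiate the linear map with the vector frozen, then the vector. *)
Lemma derive_frozen (w : V -> 'rV[R]_m) v : differentiable w x ->
  'D_v (fun z => B z (w z)) x = 'D_v (B^~ (w x)) x + B x ('D_v w x).
Proof.
move=> dw.
have E (a : V -> 'rV[R]_m) :
    \near x, (\sum_j a x 0 j *: B x (e j)) = B x (a x).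
  by apply: near_open oU Ux _ => z Uz; rewrite linear_expand.
have [_ D1] := derive_sum_scale v dw.
have [_ D2] := derive_sum_scale v (differentiable_cst (w x) x).
have D3 := etrans (esym D1) (near_eq_derive v (E w)).
have D4 := etrans (esym D2) (near_eq_derive v (E (cst (w x)))).
rewrite -D3 -[X in _ = X + _]D4 (linear_expand ('D_v w x) Ux) -big_split /=.
apply: eq_bigr => j _; rewrite addrC; congr (_ + _).
by rewrite derive_cst mxE scale0r add0r.
Qed.
End Frozen.

Lemma smooth_frozen (R : realType) (V W : normedModType R) m (U : set V)
    (B : V -> 'rV[R]_m -> W) (w : V -> 'rV[R]_m) : open U ->
  (forall z, U z -> linear (B z)) -> (forall c, smooth_on U (B^~ c)) ->
  smooth_on U w -> smooth_on U (fun z => B z (w z)).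
Proof.
move=> oU Bl sB sw k.
have cj j : Ck k U (fun z => w z 0 j *: B z (delta_mx 0 j)).
  by apply: (CkZ oU _ (sB _ k)); exact: Ck_coord oU (sw k).
apply: (Ck_cong oU) (Ck_sum oU (index_enum _) (P := xpredT) (fun j _ => cj j)) => z Uz.
by rewrite [RHS](linear_expand Bl).
Qed.

Section Atlas.
Context {R : realType} {n : nat} {T : Type} (A : atlas R n T).
Implicit Types (p q : T) (i j : chart A).

(** The part of a manifold structure that calculus in charts uses.  It does not
mention a topology on [T], so it also applies to the slit tangent bundle, which
carries only its charts. *)
Definition good_atlas :=
  [/\ forall p, dom (chart_at A p) p,
      forall i, set_inj (dom i) (crd i),
      forall i j, open (crd i @` (dom i `&` dom j))
    & forall i j, smooth_on (crd i @` (dom i `&` dom j)) (local_expr i (crd j))].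

Hypothesis G : good_atlas.

Lemma good_open i : open (crd i @` dom i).
Proof. by have [_ _ /(_ i i) + _] := G; rewrite setIid. Qed.

Lemma local_exprE (W : zmodType) i (F : T -> W) p :
  dom i p -> local_expr i F (crd i p) = F p.
Proof.
move=> ip; rewrite /local_expr; case: pselect => [e|[]]; last by exists p.
have [_ /(_ i) inj _ _] := G; congr F; apply: inj.
- by rewrite inE; exact: (s2valP (cid2 e)).
- by rewrite inE.
- exact: (s2valP' (cid2 e)).
Qed.

Lemma near_chart i j p (P : 'rV[R]_n -> Prop) : dom i p -> dom j p ->
  (forall q, dom i q -> dom j q -> P (crd i q)) -> \forall x \near crd i p, P x.
Proof.
move=> ip jp H; have [_ _ /(_ i j) o _] := G.
by apply: near_open o _ _; [exists p|move=> _ [q [iq jq] <-]; exact: H].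
Qed.

Lemma near_chart1 i p (P : 'rV[R]_n -> Prop) : dom i p ->
  (forall q, dom i q -> P (crd i q)) -> \forall x \near crd i p, P x.
Proof. by move=> ip H; apply: (near_chart ip ip) => q iq _; exact: H. Qed.

Lemma trans_diff i j p : dom i p -> dom j p ->
  differentiable (local_expr i (crd j)) (crd i p).
Proof.
by move=> ip jp; have [_ _ _ /(_ i j) s] := G; apply: smooth_diff s _; exists p.
Qed.

Lemma trans_refl i p v : dom i p -> 'D_v (local_expr i (crd i)) (crd i p) = v.
Proof.
move=> ip; rewrite -[RHS](derive_id (crd i p)); apply: near_eq_derive.
by apply: (near_chart1 ip) => q iq; rewrite local_exprE.
Qed.

Lemma near_chart_change (W : zmodType) i j (F : T -> W) p : dom i p -> dom j p ->
  \forall x \near crd i p, (local_expr j F \o local_expr i (crd j)) x = local_expr i F x.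
Proof.
by move=> ip jp; apply: (near_chart ip jp) => q iq jq; rewrite /= !local_exprE.
Qed.

Definition diff_at (W : normedModType R) i (F : T -> W) p :=
  differentiable (local_expr i F) (crd i p).

(** The chain rule for a change of charts.  Applied to the coordinates of a third
chart it says that the transformation rule of tangent vectors is consistent. *)
Lemma derive_change (W : normedModType R) i j (F : T -> W) p v :
  dom i p -> dom j p -> diff_at j F p ->
  'D_v (local_expr i F) (crd i p)
  = 'D_('D_v (local_expr i (crd j)) (crd i p)) (local_expr j F) (crd j p).
Proof.
move=> ip jp dF.
have E := local_exprE (crd j) ip.
apply: etrans (esym (near_eq_derive _ (near_chart_change F ip jp))) _.
have dF' : differentiable (local_expr j F) (local_expr i (crd j) (crd i p)).
  by rewrite E.
by apply: etrans (derive_comp _ (trans_diff ip jp) dF') _; rewrite E.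
Qed.

Lemma dirderE (W : normedModType R) i (F : T -> W) p (v : tvec A) :
  dom i p -> tangent p v -> diff_at i F p ->
  dirder p v F = 'D_(v i) (local_expr i F) (crd i p).
Proof.
move=> ip [_ tv] dF; have [/(_ p) cp _ _ _] := G.
by rewrite /dirder (derive_change _ cp ip dF) -tv.
Qed.

(** The tangent vector at [p] with components [w] in the chart [i]. *)
Definition push i p (w : 'rV[R]_n) : tvec A := fun j =>
  if `[< dom j p >] then 'D_w (local_expr i (crd j)) (crd i p) else 0.

Lemma pushE i p w j : dom j p -> push i p w j = 'D_w (local_expr i (crd j)) (crd i p).
Proof. by move=> jp; rewrite /push asboolT. Qed.

Lemma push_refl i p w : dom i p -> push i p w i = w.
Proof. by move=> ip; rewrite pushE // trans_refl. Qed.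

Lemma push_tangent i p w : dom i p -> tangent p (push i p w).
Proof.
move=> ip; split=> [j njp|j k jp kp]; first by rewrite /push asboolF.
rewrite (pushE _ _ kp) (pushE _ _ jp).
exact: derive_change w ip jp (trans_diff jp kp).
Qed.

Lemma tangent_push i p v : dom i p -> tangent p v -> push i p (v i) = v.
Proof.
move=> ip [v0 tv]; apply: funext => j; rewrite /push.
by case: asboolP => jp; [exact/esym/tv|exact/esym/v0].
Qed.

Lemma tangent_inj i p v w : dom i p -> tangent p v -> tangent p w -> v i = w i -> v = w.
Proof.
move=> ip tv tw E.
exact: etrans (esym (tangent_push ip tv)) (etrans (congr1 (push i p) E) (tangent_push ip tw)).
Qed.

Lemma push_linear i p : dom i p -> linear (push i p).
Proof.
move=> ip k v w; apply: funext => j; rewrite /push [RHS]/GRing.add /= [in RHS]/GRing.scale /=.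
case: asboolP => jp; last by rewrite scaler0 addr0.
by rewrite deriveDv ?deriveZv //; exact: trans_diff.
Qed.

Lemma tangent0 p : tangent p (0 : tvec A).
Proof.
by split=> // i j ip jp; rewrite derive0.
Qed.

Lemma tangentP p k (v w : tvec A) : tangent p v -> tangent p w -> tangent p (k *: v + w).
Proof.
move=> tv tw; have [/(_ p) cp _ _ _] := G; set i := chart_at A p in cp *.
have E : push i p (k *: v i + w i) = k *: v + w.
  by apply: etrans (push_linear cp _ _ _) _; rewrite (tangent_push cp tv) (tangent_push cp tw).
by rewrite -E; exact: push_tangent.
Qed.

Lemma tangentD p (v w : tvec A) : tangent p v -> tangent p w -> tangent p (v + w).
Proof. by move=> tv tw; have := tangentP 1 tv tw; rewrite scale1r. Qed.

Lemma tangentZ p k (v : tvec A) : tangent p v -> tangent p (k *: v).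
Proof. by move=> tv; have := tangentP k tv (tangent0 p); rewrite addr0. Qed.

Lemma tangentN p (v : tvec A) : tangent p v -> tangent p (- v).
Proof. by move=> tv; have := tangentZ (-1) tv; rewrite scaleN1r. Qed.

Definition smooth_near (W : normedModType R) i p (F : T -> W) :=
  exists O : set 'rV[R]_n, [/\ open O, O (crd i p), O `<=` crd i @` dom i
    & smooth_on O (local_expr i F)].

Lemma smooth_on_near (W : normedModType R) i p (F : T -> W) : dom i p ->
  smooth_on (crd i @` dom i) (local_expr i F) -> smooth_near i p F.
Proof.
move=> ip s; exists (crd i @` dom i); by split=> //; exact: good_open.
Qed.

Lemma smooth_near_on (W : normedModType R) i (F : T -> W) :
  (forall p, dom i p -> smooth_near i p F) ->
  smooth_on (crd i @` dom i) (local_expr i F).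
Proof.
move=> s k; apply: Ck_locally => _ [p ip <-].
by have [ O [_ Op _ sO]] := s p ip; exists O.
Qed.

(** Smoothness near a point may be tested in any chart around it, since the
transition maps are smooth and the neighbourhood can be shrunk to their common
domain. *)
Lemma smooth_near_change (W : normedModType R) i j p (F : T -> W) :
  dom i p -> dom j p -> smooth_near i p F -> smooth_near j p F.
Proof.
move=> ip jp [ O [oO Op sO s]]; have [_ _ /(_ j i) o /(_ j i) st] := G.
pose O' := crd j @` (dom j `&` dom i `&` [set q | O (crd i q)]).
have E : O' = [set x | (crd j @` (dom j `&` dom i)) x] `&` local_expr j (crd i) @^-1` O.
  apply/seteqP; split => [_ [q [[jq iq] /= Oq] <-]|_ [[q [jq iq] <-]] /=].
    by split; [exists q|rewrite /= local_exprE].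
  by rewrite local_exprE // => Oq; exists q.
have oO' : open O'.
  rewrite E openE => _ [[q [jq iq] <-]] Oq; apply: filterI.
    by apply: open_nbhs_nbhs; split => //; exists q.
  have c : {for crd j q, continuous (local_expr j (crd i))}.
    by apply: differentiable_continuous; exact: trans_diff.
  by apply: c; apply: open_nbhs_nbhs; split.
exists O'; split=> //.
- by exists p.
- by move=> _ [q [[jq _] _] <-]; exists q.
have sub : O' `<=` crd j @` (dom j `&` dom i).
  by move=> _ [q [[jq iq] _] <-]; exists q.
move=> k; apply: (Ck_cong oO' (f := local_expr i F \o local_expr j (crd i))).
  by move=> _ [q [[jq iq] Oq] <-]; rewrite /= !local_exprE.
apply: (Ck_comp oO' _ _ (s k)); last exact: CkS sub (st k).
by rewrite E => x [].
Qed.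

Lemma smooth_near_all (W : normedModType R) (F : T -> W) :
  (forall p, exists2 i, dom i p & smooth_near i p F) -> smooth A F.
Proof.
move=> H j; apply: smooth_near_on => p jp; have [i ip s] := H p.
exact: smooth_near_change s.
Qed.

Lemma smooth_near_cong (W : normedModType R) i p (F : T -> W)
   (f : 'rV[R]_n -> W) (O : set 'rV[R]_n) : dom i p -> open O -> O (crd i p) ->
   (forall q, dom i q -> O (crd i q) -> F q = f (crd i q)) ->
   smooth_on O f -> smooth_near i p F.
Proof.
move=> ip oO Op Ff s; have o : open (crd i @` dom i) by exact: good_open.
have oO' := openI oO o.
exists (O `&` crd i @` dom i); split.
- exact: oO'.
- by split=> //; exists p.
- by move=> x [].
move=> k; apply: (Ck_cong oO' (f := f)).
  by move=> x [Ox [q iq qx]]; rewrite -qx local_exprE // Ff // qx.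
by apply: CkS (s k) => x [].
Qed.

(** The components of a tangent vector in another chart are derivatives of the
transition map along its components in the given one, so smoothness near each
point in one chart is enough. *)
Lemma vfield_near (X : T -> tvec A) : (forall p, tangent p (X p)) ->
  (forall p, exists2 i, dom i p & smooth_near i p (fun q => X q i)) -> vfield X.
Proof.
move=> tX H; split=> // j; apply: smooth_near_on => p jp; have [i ip s] := H p.
have [_ _ /(_ i j) oij /(_ i j) sij] := G.
have [ O [oO Op sub sO]] := s.
apply: (smooth_near_change ip jp).
pose f x := 'D_(local_expr i (fun q => X q i) x) (local_expr i (crd j)) x.
apply: (smooth_near_cong (O := O `&` crd i @` (dom i `&` dom j)) (f := f)) => //.
- exact: openI.
- by split=> //; exists p.
- move=> q iq [Oq [q' [iq' jq'] qq']].
  have qE : q' = q.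
    by have [_ /(_ i) inj _ _] := G; apply: inj; rewrite ?inE.
  rewrite qE in jq'; rewrite /f local_exprE //.
  by have [_ t] := tX q; exact: t.
have oI := openI oO oij.
apply: smooth_deriveV => //.
  by move=> k; apply: CkS (sij k) => x [].
by move=> k; apply: CkS (sO k) => x [].
Qed.

Lemma vfield_diff (X : T -> tvec A) i p : vfield X -> dom i p ->
  diff_at i (fun q => X q i) p.
Proof. by move=> [_ s] ip; apply: smooth_diff (s i) _; exists p. Qed.

Lemma lieE (X Y : T -> tvec A) p i : dom i p -> lie X Y p i =
    'D_(X p i) (local_expr i (fun q => Y q i)) (crd i p)
    - 'D_(Y p i) (local_expr i (fun q => X q i)) (crd i p).
Proof. by move=> ip; rewrite /lie asboolT. Qed.

End Atlas.

(** * Induced charts of the slit tangent bundle *)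

Section Split.
Context {R : realType} {n : nat}.

Definition hh (a : 'rV[R]_n) : 'rV[R]_(n + n) := row_mx a 0.
Definition vv (b : 'rV[R]_n) : 'rV[R]_(n + n) := row_mx 0 b.

Lemma hh_is_linear : linear hh.
Proof. by move=> k a b; rewrite /hh scale_row_mx add_row_mx scaler0 addr0. Qed.
Lemma vv_is_linear : linear vv.
Proof. by move=> k a b; rewrite /vv scale_row_mx add_row_mx scaler0 addr0. Qed.

HB.instance Definition _ :=
  GRing.isLinear.Build R 'rV[R]_n 'rV[R]_(n + n) _ hh hh_is_linear.
HB.instance Definition _ :=
  GRing.isLinear.Build R 'rV[R]_n 'rV[R]_(n + n) _ vv vv_is_linear.

Lemma hvE a b : row_mx a b = hh a + vv b.
Proof. by rewrite /hh /vv add_row_mx addr0 add0r. Qed.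

Definition lsub (v : 'rV[R]_(n + n)) : 'rV[R]_n := lsubmx v.
Definition rsub (v : 'rV[R]_(n + n)) : 'rV[R]_n := rsubmx v.

Lemma lsubH a : lsub (hh a) = a. Proof. exact: row_mxKl. Qed.
Lemma lsubV b : lsub (vv b) = 0. Proof. exact: row_mxKl. Qed.
Lemma rsubH a : rsub (hh a) = 0. Proof. exact: row_mxKr. Qed.
Lemma rsubV b : rsub (vv b) = b. Proof. exact: row_mxKr. Qed.
Lemma hvsubK (v : 'rV[R]_(n + n)) : v = hh (lsub v) + vv (rsub v).
Proof. by rewrite -hvE /lsub /rsub hsubmxK. Qed.

Lemma lsub_is_linear : linear lsub.
Proof. by move=> k a b; rewrite /lsub linearP. Qed.
Lemma rsub_is_linear : linear rsub.
Proof. by move=> k a b; rewrite /rsub linearP. Qed.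
HB.instance Definition _ :=
  GRing.isLinear.Build R 'rV[R]_(n + n) 'rV[R]_n _ lsub lsub_is_linear.
HB.instance Definition _ :=
  GRing.isLinear.Build R 'rV[R]_(n + n) 'rV[R]_n _ rsub rsub_is_linear.

Lemma Ck_row_mx (V : normedModType R) k (U : set V) (f g : V -> 'rV[R]_n) :
  open U -> Ck k U f -> Ck k U g -> Ck k U (fun x => row_mx (f x) (g x)).
Proof.
move=> oU cf cg; apply: (Ck_cong oU (f := fun x => hh (f x) + vv (g x))).
  by move=> x _; rewrite hvE.
by apply: (CkD oU); apply: (Ck_lin oU) => //; exact: rV_linear_continuous.
Qed.

Lemma open_slit (W : set 'rV[R]_n) : open W ->
  open [set z : 'rV[R]_(n + n) | W (lsubmx z) /\ rsubmx z <> 0].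
Proof.
move=> oW; have -> : [set z : 'rV[R]_(n + n) | W (lsubmx z) /\ rsubmx z <> 0]
   = lsub @^-1` W `&` rsub @^-1` (~` [set 0]).
  by apply/seteqP; split => z [].
apply: openI; apply: open_comp => //.
- by move=> z _; exact: rV_linear_continuous.
- by move=> z _; exact: rV_linear_continuous.
- rewrite openC; apply: accessible_closed_set1; apply: hausdorff_accessible.
  exact: norm_hausdorff.
Qed.

End Split.

Section Slit.
Context {R : realType} {n : nat} {M : Type} (A : atlas R n M).
Hypothesis G : good_atlas A.
Local Notation SA := (slit_atlas A).
Local Notation crdS := (crd (a := slit_atlas A)).
Implicit Types (u w : slit A) (i j : chart A).

Lemma slit_ext u w : base u = base w -> dir u = dir w -> u = w.
Proof.
case: u w => [b d t n0] [b' d' t' n0'] /= eb ed; subst.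
by rewrite (Prop_irrelevance t t') (Prop_irrelevance n0 n0').
Qed.

Lemma slit_ext_chart i u w : dom i (base u) -> crdS i u = crdS i w ->
  dom i (base w) -> u = w.
Proof.
move=> iu + iw; rewrite /= => /eq_row_mx[eb ed].
have ebase : base u = base w.
  by have [_ /(_ i) inj _ _] := G; apply: inj; rewrite ?inE.
have tw : tangent (base u) (dir w) by rewrite ebase; exact: dir_tangent.
apply: (slit_ext ebase).
exact: (tangent_inj iu (dir_tangent u) tw ed).
Qed.

Lemma slit_exists i p y : dom i p -> y <> 0 -> exists2 u, base u = p & dir u i = y.
Proof.
move=> ip y0.
have d0 : push i p y <> (0 : tvec A).
  by move=> E; apply: y0; rewrite -(push_refl G y ip) E.
by exists (Slit (push_tangent G y ip) d0) => //=; exact: push_refl.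
Qed.

Lemma dir_chart_neq0 u i : dom i (base u) -> dir u i <> 0.
Proof.
move=> iu E; apply: (@dir_neq0 _ _ _ _ u).
by apply: (tangent_inj iu (dir_tangent u) (tangent0 _ _)).
Qed.

(** Every nonzero vector of components is realised, so the image of an induced chart
is an open set of base coordinates times the nonzero vectors. *)
Lemma slit_image i (S : set M) : S `<=` dom i ->
  crdS i @` [set u | S (base u)] =
  [set z | (crd i @` S) (lsubmx z) /\ rsubmx z <> 0].
Proof.
move=> Si; apply/seteqP; split => [_ [u Su <-]|z [[p Sp px] y0]].
  rewrite /= row_mxKl row_mxKr; split; first by exists (base u).
  by apply: dir_chart_neq0; exact: Si.
have [u bu du] := slit_exists (Si _ Sp) y0.
exists u; first by rewrite /= bu.
by rewrite /= bu du px hsubmxK.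
Qed.

Definition trans i j : 'rV[R]_n -> 'rV[R]_n := local_expr i (crd j).

Lemma slit_trans i j u : dom i (base u) -> dom j (base u) ->
  crdS j u =
    row_mx (trans i j (crd i (base u))) ('D_(dir u i) (trans i j) (crd i (base u))).
Proof.
move=> iu ju; rewrite /= /trans local_exprE //; congr row_mx.
by have [_ /(_ i j)] := dir_tangent u; apply.
Qed.

Lemma slit_good : good_atlas SA.
Proof.
have [cp inj o st] := G; split.
- by move=> u; exact: cp.
- move=> i u w; rewrite !inE /= => iu iw E; exact: (slit_ext_chart (i := i)).
- move=> i j; rewrite [X in open X](@slit_image i (dom (a := A) i `&` dom (a := A) j)); last by move=> ? [].
  by apply: open_slit; exact: o.
move=> i j k.
set S := _ @` _.
have SE : S = [set z | (crd (a := A) i @` (dom (a := A) i `&` dom (a := A) j)) (lsubmx z) /\ rsubmx z <> 0].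
  by rewrite -slit_image //; move=> ? [].
have oS : open S by rewrite SE; apply: open_slit; exact: o.
apply: (Ck_cong oS
  (f := fun z => row_mx (trans i j (lsub z)) ('D_(rsub z) (trans i j) (lsub z)))).
  move=> _ [u [iu ju] <-]; rewrite [in RHS]/local_expr; case: pselect => [e|[]]; last first.
    by exists u.
  have E : s2val (cid2 e) = u.
    apply: (slit_ext_chart (i := i)) => //; first exact: (s2valP (cid2 e)).
    exact: (s2valP' (cid2 e)).
  by rewrite E (slit_trans iu ju) /lsub /rsub /= row_mxKl row_mxKr.
have sl : smooth_on S (@lsub R n) by exact: smooth_rV_lin.
have sr : smooth_on S (@rsub R n) by exact: smooth_rV_lin.
have lS z : S z -> (crd (a := A) i @` (dom (a := A) i `&` dom (a := A) j)) (lsub z) by rewrite SE => -[].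
apply: (Ck_row_mx oS); first exact: Ck_comp oS lS (sl k) (st i j k).
apply: (smooth_frozen (B := fun z c => 'D_c (trans i j) (lsub z))) => //.
  by move=> z /lS Sz; apply: derive_linear; exact: smooth_diff (st i j) Sz.
move=> c k'; exact: (Ck_comp oS lS (sl k') (smooth_derive c (st i j) k')).
Qed.

Lemma near_slit_trans i j u : dom i (base u) -> dom j (base u) ->
  \forall z \near crdS i u,
   row_mx (trans i j (lsub z)) ('D_(rsub z) (trans i j) (lsub z))
   = local_expr (A := SA) i (crdS j) z.
Proof.
move=> iu ju; apply: (near_chart slit_good iu ju) => w iw jw.
rewrite (local_exprE slit_good) // (slit_trans iw jw) /lsub /rsub /=.
by rewrite row_mxKl row_mxKr.
Qed.

(** The derivative of the transition map [(x, y) |-> (t x, Dt(x) y)] of the slit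
bundle; the second derivative of [t] appears in the vertical component only. *)
Lemma derive_slit_trans i j u v : dom i (base u) -> dom j (base u) ->
  'D_v (local_expr (A := SA) i (crdS j)) (crdS i u) =
  row_mx ('D_(lsub v) (trans i j) (crd i (base u)))
    ('D_(lsub v) ('D_(dir u i) (trans i j)) (crd i (base u))
     + 'D_(rsub v) (trans i j) (crd i (base u))).
Proof.
move=> iu ju; have [_ _ o st] := G.
set z := crdS i u.
have lz : lsub z = crd i (base u) by rewrite /lsub /z /= row_mxKl.
have rz : rsub z = dir u i by rewrite /rsub /z /= row_mxKr.
have dl y : differentiable (@lsub R n) y by exact: rV_linear_diff.
have dr y : differentiable (@rsub R n) y by exact: rV_linear_diff.
have W : (crd i @` (dom i `&` dom j)) (crd i (base u)) by exists (base u).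
have dt : differentiable (trans i j) (lsub z) by rewrite lz; exact: smooth_diff (st i j) W.
have dDt c : differentiable ('D_c (trans i j)) (lsub z).
  by rewrite lz; exact: smooth_diff (smooth_derive c (st i j)) W.
pose S := [set z : 'rV[R]_(n+n) | (crd i @` (dom i `&` dom j)) (lsubmx z) /\ rsubmx z <> 0].
have oS : open S by apply: open_slit; exact: o.
have Sz : S z.
  by rewrite /S /= row_mxKl row_mxKr; split=> //; exact: dir_chart_neq0.
have Bl y : S y -> linear (fun c => 'D_c (trans i j) (lsub y)).
  by move=> [Wy _]; apply: derive_linear; exact: smooth_diff (st i j) Wy.
have Bd c : differentiable (fun y => 'D_c (trans i j) (lsub y)) z.
  by apply: (differentiable_comp (g := 'D_c (trans i j))).
have d1 : differentiable (trans i j \o @lsub R n) z by exact: differentiable_comp.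
have d2 := diff_frozen oS Sz Bl Bd (dr z).
have D2 := derive_frozen oS Sz Bl Bd v (dr z).
have D1 := derive_comp v (dl z) dt.
have Dl : 'D_v (@lsub R n) z = lsub v by exact: rV_derive_lin.
have Dr : 'D_v (@rsub R n) z = rsub v by exact: rV_derive_lin.
have D3 := derive_comp v (dl z) (dDt (rsub z)).
apply: etrans (esym (near_eq_derive v (near_slit_trans iu ju))) _.
have -> : (fun z => row_mx (trans i j (lsub z)) ('D_(rsub z) (trans i j) (lsub z)))
  = (fun z => hh (trans i j (lsub z)) + vv ('D_(rsub z) (trans i j) (lsub z))).
  by apply: funext => y; rewrite hvE.
have lc m (l : {linear 'rV[R]_n -> 'rV[R]_m}) : continuous l by exact: rV_linear_continuous.
have dh : differentiable (fun z => hh (trans i j (lsub z))) z.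
  by apply: (differentiable_comp (g := @hh R n) d1); exact: rV_linear_diff.
have dv : differentiable (fun z => vv ('D_(rsub z) (trans i j) (lsub z))) z.
  by apply: (differentiable_comp (g := @vv R n) d2); exact: rV_linear_diff.
apply: etrans (derive_add v dh dv) _; rewrite hvE; congr (_ + _).
  apply: etrans (derive_lin (l := @hh R n) v (lc _ _) d1) _.
  apply: (congr1 (@hh R n)); apply: etrans D1 _.
  exact: (f_equal2 (fun a b => 'D_a (trans i j) b) Dl lz).
apply: etrans (derive_lin (l := @vv R n) v (lc _ _) d2) _.
apply: (congr1 (@vv R n)); apply: etrans D2 _.
apply: (f_equal2 +%R); last exact: (f_equal2 (fun a b => 'D_a (trans i j) b) Dr lz).
apply: etrans D3 _.
apply: etrans (f_equal2 (fun a b => 'D_a ('D_b (trans i j)) (lsub z)) Dl rz) _.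
exact: (congr1 ('D_(lsub v) ('D_(dir u i) (trans i j))) lz).
Qed.

Lemma gamma_tangent u (w : tvec A) : tangent (base u) w -> tangent (A := SA) u (gamma w).
Proof.
move=> [w0 tw]; split=> [i iu|i j iu ju].
  by rewrite /gamma w0 // row_mx0.
rewrite derive_slit_trans // /gamma /lsub /rsub row_mxKl row_mxKr !derive0 add0r.
by rewrite (tw i j iu ju).
Qed.

Lemma base_diff i u : dom i (base u) ->
  diff_at (A := SA) i (crd i \o @base R n M A) u
  /\ forall v, 'D_v (local_expr (A := SA) i (crd i \o @base R n M A)) (crdS i u)
     = lsub v.
Proof.
move=> iu.
have E : \forall z \near crdS i u,
   lsub z = local_expr (A := SA) i (crd i \o @base R n M A) z.
  apply: (near_chart1 slit_good) => // w iw.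
  by rewrite (local_exprE slit_good) // /lsub /= row_mxKl.
split; first by apply: near_eq_differentiable E _; exact: rV_linear_diff.
move=> v; apply: etrans (esym (near_eq_derive v E)) _; exact: rV_derive_lin.
Qed.

Lemma rhoE u (v : tvec SA) j : tangent u v -> dom j (base u) -> rho u v j = lsub (v j).
Proof.
move=> tv ju; rewrite /rho /tmap asboolT //.
have [d D] := base_diff ju.
by rewrite (dirderE slit_good (i := j)).
Qed.

Lemma rho_tangent u (v : tvec SA) : tangent u v -> tangent (base u) (rho u v).
Proof.
move=> tv; split=> [i niu|i j iu ju]; first by rewrite /rho /tmap asboolF.
rewrite !rhoE //; have [_ /(_ i j iu ju) ->] := tv.
by rewrite derive_slit_trans // /lsub row_mxKl.
Qed.

End Slit.

Lemma manifold_good (R : realType) n (M : topologicalType) (A : atlas R n M) :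
  smooth_manifold A -> good_atlas A.
Proof.
move=> [_ _ cp H]; split=> //.
- by move=> i; have [] := H i.
- move=> i j; have [oi _ ho _] := H i; have [oj _ _ _] := H j.
  have sub : dom i `&` dom j `<=` dom i by move=> ? [].
  by apply: (ho _ sub).1; exact: openI.
- by move=> i j; have [_ _ _] := H i.
Qed.

(** * Cut-off functions on the manifold *)

Section Cutoff.
Context {R : realType} {n : nat} {M : topologicalType} (A : atlas R n M).
Hypothesis hM : smooth_manifold A.
Local Notation SA := (slit_atlas A).
Local Notation crdS := (crd (a := slit_atlas A)).
Implicit Types (u w : slit A) (i j : chart A).

Let G : good_atlas A := manifold_good hM.
Let SG : good_atlas SA := slit_good G.

(** A compact set of coordinates is a compact, hence closed, set of points because
the manifold is Hausdorff.  This is what allows a bump function of a chart to be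
extended by zero. *)
Lemma closed_chart_compact i (K : set 'rV[R]_n) p0 : dom i p0 -> compact K ->
  K `<=` crd i @` dom i -> closed [set q | dom i q /\ K (crd i q)].
Proof.
move=> ip0 cK sK; have [hd _ _ H] := hM; have [oi inj ho _] := H i.
pose inv x := xget p0 [set p | dom i p /\ crd i p = x].
have invK p : dom i p -> inv (crd i p) = p.
  move=> ip; rewrite /inv; case: xgetP => [q _ [iq E]|/(_ p)[]//].
  by apply: inj; rewrite ?inE.
have -> : [set q | dom i q /\ K (crd i q)] = inv @` K.
  apply/seteqP; split => [q [iq Kq]|_ [x Kx <-]].
    by exists (crd i q) => //; rewrite invK.
  have [p ip px] := sK x Kx; have -> : inv x = p by rewrite -px invK.
    by split; rewrite ?px.
apply: compact_closed hd _; apply: continuous_compact cK.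
apply: continuous_in_subspaceT => x; rewrite inE => Kx.
have [p ip px] := sK x Kx.
suff : inv @ x --> inv x by [].
rewrite -px invK // => S; rewrite nbhsE => -[S' [oS' S'p] S'S].
have sub : S' `&` dom i `<=` dom i by move=> ? [].
have oI : open (crd i @` (S' `&` dom i)) by apply: (ho _ sub).1; exact: openI.
apply: filterS (open_nbhs_nbhs (conj oI _)); last by exists p.
by move=> _ [q [S'q iq] <-] /=; rewrite invK //; exact: S'S.
Qed.

(** The vertical lift identifies pi-vector fields with vertical vector fields; this
transfers to pi-vector fields the criterion of smoothness in one chart. *)
Lemma pfield_of_gamma (X : slit A -> tvec A) :
  vfield (A := SA) (gamma_f X) -> pfield X.
Proof.
move=> [tX sX]; split=> [u|i].
  have [/(_ u) cu _ _ _] := SG; have := tX u; set c := chart_at SA u in cu *.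
  move=> [t0 t]; split=> [i niu|i j iu ju].
    by have := t0 i niu; rewrite /gamma_f /gamma => /(congr1 rsubmx); rewrite row_mxKr linear0.
  have := t i j iu ju; rewrite (derive_slit_trans G) // /gamma_f /gamma => /(congr1 rsubmx).
  by rewrite !row_mxKr /lsub /rsub row_mxKl row_mxKr !derive0 add0r.
have oi : open (crdS i @` dom (a := SA) i) by exact: good_open.
move=> k; apply: (Ck_cong oi
   (f := fun z => rsub (local_expr (A := SA) i (fun u => gamma_f X u i) z))).
  by move=> _ [u iu <-]; rewrite !(local_exprE SG) // /rsub /gamma_f /gamma row_mxKr.
by apply: (Ck_lin oi _ (sX i k)); exact: rV_linear_continuous.
Qed.

Lemma pfield_near (X : slit A -> tvec A) : (forall u, tangent (base u) (X u)) ->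
  (forall u, exists2 i, dom i (base u) & smooth_near (A := SA) i u (fun w => X w i)) ->
  pfield X.
Proof.
move=> tX H; apply: pfield_of_gamma; apply: (vfield_near SG) => u.
  exact: gamma_tangent.
have [i iu [ O [oO Ou sO s]]] := H u; exists i => //.
exists O; split=> // k.
apply: (Ck_cong oO (f := fun z => vv (local_expr (A := SA) i (fun u => X u i) z))).
  by move=> z /sO[w iw <-]; rewrite !(local_exprE SG).
by apply: (Ck_lin oO _ (s k)); exact: rV_linear_continuous.
Qed.

(** Multiplying by [chi] turns anything smooth over the domain of [i] into something
smooth over the whole slit bundle, without changing it near the fibre of [p0]. *)
Lemma cutoff_exists i p0 : dom i p0 ->
  exists (chi : M -> R) (B : set 'rV[R]_n),
  [/\ [/\ open B, B (crd i p0) & B `<=` crd i @` dom i],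
      forall p, dom i p -> B (crd i p) -> chi p = 1,
      forall p, ~ dom i p -> chi p = 0,
      forall (W : normedModType R) j u (F : slit A -> W), ~ dom i (base u) -> dom j (base u) ->
        smooth_near (A := SA) j u (fun w => chi (base w) *: F w)
    & forall (W : normedModType R) u (F : slit A -> W), dom i (base u) ->
        smooth_near (A := SA) i u F ->
        smooth_near (A := SA) i u (fun w => chi (base w) *: F w)].
Proof.
move=> ip0; have [_ _ /(_ i i) oi _] := G; rewrite setIid in oi.
have Ip0 : (crd i @` dom i) (crd i p0) by exists p0.
have [psi [K [spsi npsi cK sK psi0]]] := bump_exists oi Ip0.
pose chi p := if `[< dom i p >] then psi (crd i p) else 0.
have chiE p : dom i p -> chi p = psi (crd i p) by move=> ip; rewrite /chi asboolT.
have chi0 p : ~ (dom i p /\ K (crd i p)) -> chi p = 0.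
  move=> nK; rewrite /chi; case: asboolP => // ip; apply: psi0 => Kp; exact: nK.
have [B' [oB' B'p] sB'] : exists2 B', open_nbhs (crd i p0) B' & B' `<=` [set x | psi x = 1].
  by have := npsi; rewrite /prop_near1 nbhsE.
exists chi, (B' `&` crd i @` dom i); split.
- split; [exact: openI|by []|by move=> ? []].
- by move=> p ip [Bp _]; rewrite chiE //; exact: sB'.
- by move=> p nip; apply: chi0 => -[].
- move=> W j u F niu ju.
  have [oj inj ho _] : [/\ open (dom j), set_inj (dom j) (crd j),
     forall B, B `<=` dom j -> (open B <-> open (crd j @` B)) & True].
    by have [_ _ _ /(_ j)[]] := hM.
  set S := ~` [set q | dom i q /\ K (crd i q)] `&` dom j.
  have oS : open S.
    by apply: openI => //; apply: closed_openC; exact: closed_chart_compact ip0 cK sK.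
  have sS : S `<=` dom j by move=> ? [].
  have oS' : open [set z : 'rV[R]_(n + n) | (crd j @` S) (lsubmx z) /\ rsubmx z <> 0].
    by apply: open_slit; exact: (ho S sS).1.
  have SIm := slit_image G sS.
  apply: (smooth_near_cong SG (f := fun=> 0) _ oS') => //.
  + by rewrite -SIm; exists u => //; split=> // -[].
  + move=> q jq; rewrite -SIm => -[q' [nq' jq'] E].
    have -> : q = q' by apply: (slit_ext_chart G (i := j)).
    by rewrite chi0 // scale0r.
  + by move=> k; exact: Ck_cst.
- move=> W u F iu [ O [oO Ou sO s]]; exists O; split=> // k.
  apply: (Ck_cong oO (f := fun z => psi (lsub z) *: local_expr (A := SA) i F z)).
    by move=> z /sO[w iw <-]; rewrite !(local_exprE SG) // chiE // /lsub /= row_mxKl.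
  apply: (CkZ oO _ (s k)).
  apply: (Ck_comp (U' := setT) oO _ _ (spsi k)) => //.
  exact: smooth_rV_lin.
Qed.

End Cutoff.

(** * Smooth fields and the locality of connections *)

Section Fields.
Context {R : realType} {n : nat} {M : Type} (A : atlas R n M).
Hypothesis G : good_atlas A.
Local Notation SA := (slit_atlas A).
Local Notation crdS := (crd (a := slit_atlas A)).
Implicit Types (u w : slit A) (i j : chart A).

Let SG : good_atlas SA := slit_good G.

Lemma smooth_on_local (W : normedModType R) i (F : slit A -> W) (f : 'rV[R]_(n+n) -> W) k :
  (forall u, dom i (base u) -> f (crdS i u) = F u) ->
  Ck k (crdS i @` dom (a := SA) i) f ->
  Ck k (crdS i @` dom (a := SA) i) (local_expr (A := SA) i F).
Proof.
move=> fF; apply: Ck_cong; first exact: good_open.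
by move=> _ [u iu <-]; rewrite (local_exprE SG) // fF.
Qed.

Lemma slit_dom_open (i : chart SA) : open (crdS i @` dom (a := SA) i).
Proof. exact: good_open. Qed.

Lemma smooth_cst (k : R) : smooth SA (fun=> k).
Proof.
move=> i k'; apply: (smooth_on_local (f := fun=> k)) => //.
exact (Ck_cst (slit_dom_open (i := i)) _ _).
Qed.

Lemma smoothM (F H : slit A -> R) : smooth SA F -> smooth SA H ->
  smooth SA (fun u => F u * H u).
Proof.
move=> sF sH i k; apply: (smooth_on_local
  (f := fun z => local_expr (A := SA) i F z * local_expr (A := SA) i H z)).
  by move=> u iu; rewrite !(local_exprE SG).
exact (CkM (slit_dom_open (i := i)) (sF i k) (sH i k)).
Qed.

Lemma smoothN (F : slit A -> R) : smooth SA F -> smooth SA (fun u => - F u).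
Proof.
move=> sF i k; apply: (smooth_on_local (f := fun z => - local_expr (A := SA) i F z)).
  by move=> u iu; rewrite !(local_exprE SG).
exact (CkN (slit_dom_open (i := i)) (sF i k)).
Qed.

Lemma smoothV (F : slit A -> R) : (forall u, F u != 0) -> smooth SA F ->
  smooth SA (fun u => (F u)^-1).
Proof.
move=> F0 sF i k; apply: (smooth_on_local (f := fun z => (local_expr (A := SA) i F z)^-1)).
  by move=> u iu; rewrite !(local_exprE SG).
apply: (Ck_inv (slit_dom_open (i := i)) _ (sF i k)) => _ [u iu <-].
by rewrite (local_exprE SG).
Qed.

Lemma pfieldD (X Y : slit A -> tvec A) : pfield X -> pfield Y -> pfield (fun u => X u + Y u).
Proof.
move=> [tX sX] [tY sY]; split=> [u|i k]; first exact: (tangentD G).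
apply: (smooth_on_local (f := fun z => local_expr (A := SA) i (fun u => X u i) z
   + local_expr (A := SA) i (fun u => Y u i) z)).
  by move=> u iu; rewrite !(local_exprE SG).
exact (CkD (slit_dom_open (i := i)) (sX i k) (sY i k)).
Qed.

Lemma pfieldZ (F : slit A -> R) (X : slit A -> tvec A) : smooth SA F -> pfield X ->
  pfield (fun u => F u *: X u).
Proof.
move=> sF [tX sX]; split=> [u|i k]; first exact: (tangentZ G).
apply: (smooth_on_local (f := fun z => local_expr (A := SA) i F z *:
   local_expr (A := SA) i (fun u => X u i) z)).
  by move=> u iu; rewrite !(local_exprE SG).
exact (CkZ (slit_dom_open (i := i)) (sF i k) (sX i k)).
Qed.

Lemma pfield0 : pfield (fun _ : slit A => 0 : tvec A).
Proof.
split=> [u|i k]; first exact: tangent0.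
apply: (smooth_on_local (f := fun=> 0)) => //.
exact (Ck_cst (slit_dom_open (i := i)) _ _).
Qed.

Lemma pfield_sum I (r : seq I) (F : I -> slit A -> tvec A) :
  (forall a, pfield (F a)) -> pfield (fun u => \sum_(a <- r) F a u).
Proof.
move=> pF; elim: r => [|a r IH].
  have -> : (fun u => \sum_(a <- [::]) F a u) = fun=> 0.
    by apply: funext => u; rewrite big_nil.
  exact: pfield0.
have -> : (fun u => \sum_(b <- a :: r) F b u) = fun u => F a u + \sum_(b <- r) F b u.
  by apply: funext => u; rewrite big_cons.
exact: pfieldD.
Qed.

Lemma pfield_fund : pfield (@fund R n M A).
Proof.
split=> [u|i k]; first exact: dir_tangent.
apply: (smooth_on_local (f := @rsub R n)).
  by move=> u iu; rewrite /rsub /= row_mxKr.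
by apply: (smooth_rV_lin); exact: slit_dom_open.
Qed.

Lemma vfield_gamma (X : slit A -> tvec A) : pfield X -> vfield (A := SA) (gamma_f X).
Proof.
move=> [tX sX]; split=> [u|i k]; first exact: gamma_tangent.
apply: (smooth_on_local (f := fun z => vv (local_expr (A := SA) i (fun u => X u i) z))).
  by move=> u iu; rewrite !(local_exprE SG).
apply: (Ck_lin (slit_dom_open (i := i)) _ (sX i k)); exact: rV_linear_continuous.
Qed.

Lemma pfield_diff (X : slit A -> tvec A) i u : pfield X -> dom i (base u) ->
  diff_at (A := SA) i (fun w => X w i) u.
Proof. by move=> [_ s] iu; apply: smooth_diff (s i) _; exists u. Qed.

Lemma smooth_diff_at (W : normedModType R) (F : slit A -> W) i u :
  smooth SA F -> dom i (base u) -> diff_at (A := SA) i F u.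
Proof. by move=> s iu; apply: smooth_diff (s i) _; exists u. Qed.

(** Used for the cut-off functions, which are constant near the point of interest. *)
Lemma dirder_near_cst i u v (F : slit A -> R) (c : R) (O : set 'rV[R]_(n+n)) :
  tangent (A := SA) u v -> smooth SA F -> dom i (base u) -> open O -> O (crdS i u) ->
  (forall w, dom i (base w) -> O (crdS i w) -> F w = c) -> dirder u v F = 0.
Proof.
move=> tv sF iu oO Ou H; rewrite (dirderE SG (i := i)) //; last exact: smooth_diff_at.
rewrite -[RHS](derive_cst c (crdS i u) (v i)).
apply: near_eq_derive; near=> z.
have [w iw wz] : (crdS i @` dom (a := SA) i) z.
  by near: z; apply: open_nbhs_nbhs; split; [exact: slit_dom_open|exists u].
rewrite -wz (local_exprE SG) // (H w) // wz.
by near: z; exact: open_nbhs_nbhs.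
Unshelve. all: by end_near. Qed.

Section Connection.
Variable D : connection A.
Hypothesis hD : is_connection D.

Lemma conn_cst u v k X : tangent u v -> pfield X ->
  D u v (fun w => k *: X w) = k *: D u v X.
Proof.
move=> tv pX; have [_ _ _ L _] := hD.
have [/(_ u) cu _ _ _] := SG.
rewrite (L u v (fun=> k) X tv (smooth_cst k) pX).
have Ou : (crdS (chart_at SA u) @` dom (a := SA) (chart_at SA u))
  (crdS (chart_at SA u) u) by exists u.
have -> : dirder u v (fun=> k) = 0.
  exact: (dirder_near_cst (c := k) tv (smooth_cst k) cu (slit_dom_open (i := chart_at SA u)) Ou).
by rewrite scale0r add0r.
Qed.

Lemma conn0 u v : tangent u v -> D u v (fun=> 0) = 0.
Proof.
move=> tv; have := conn_cst 0 tv pfield0; rewrite [X in _ = X]scale0r => E.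
by rewrite -[RHS]E; congr (D u v _); apply: funext => w; rewrite scale0r.
Qed.

Lemma conn_sum I (r : seq I) (F : I -> slit A -> tvec A) u v : tangent u v ->
  (forall a, pfield (F a)) ->
  D u v (fun w => \sum_(a <- r) F a w) = \sum_(a <- r) D u v (F a).
Proof.
move=> tv pF; have [_ _ aD _ _] := hD; elim: r => [|a r IH].
  rewrite big_nil -[RHS](conn0 tv); congr (D u v _).
  by apply: funext => w; rewrite big_nil.
rewrite big_cons -IH -aD //; last exact: pfield_sum.
by congr (D u v _); apply: funext => w; rewrite big_cons.
Qed.

End Connection.
End Fields.

Section ConnLocal.
Context {R : realType} {n : nat} {M : topologicalType} (A : atlas R n M).
Hypothesis hM : smooth_manifold A.
Local Notation SA := (slit_atlas A).
Local Notation crdS := (crd (a := slit_atlas A)).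
Implicit Types (u w : slit A) (i j : chart A).

Let G : good_atlas A := manifold_good hM.
Let SG : good_atlas SA := slit_good G.

(** [om] is the connection form over [U]: [D] is the derivative of components plus a
zero-order term bilinear in the direction and in the section. *)
Definition local_form i (U : set 'rV[R]_(n + n)) (D : connection A)
    (om : 'rV[R]_(n + n) -> 'rV[R]_(n + n) -> 'rV[R]_n -> 'rV[R]_n) :=
  [/\ forall z c, U z -> linear (fun v => om z v c),
      forall z v, U z -> linear (om z v),
      forall v c, smooth_on U (fun z => om z v c)
    & forall u v X, dom i (base u) -> U (crdS i u) -> tangent (A := SA) u v ->
        pfield X -> D u v X i =
          'D_(v i) (local_expr (A := SA) i (fun w => X w i)) (crdS i u)
          + om (crdS i u) (v i) (X u i)].

(** With [E c] and [V v] the cut-off constant fields, [om z v c] is the value of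
[D_(V v) (E c)].  For a general section [X], the field [chi^2 X] is a global
combination of the fields [E e_a] with the smooth coefficients [chi X^a], and
replacing [X] by [chi^2 X] does not change [D X] where [chi] is constant; the
Leibniz rule then gives the formula. *)
Lemma connection_local i p0 : dom i p0 ->
  exists U : set 'rV[R]_(n + n),
  [/\ [/\ open U, forall u, base u = p0 -> U (crdS i u)
         & U `<=` crdS i @` dom (a := SA) i],
      forall v, exists2 V, vfield (A := SA) V &
         forall u, dom i (base u) -> U (crdS i u) -> V u i = v,
      forall c, exists2 X, pfield (A := A) X &
         forall u, dom i (base u) -> U (crdS i u) -> X u i = c
    & forall D : connection A, is_connection D -> exists om, local_form i U D om].
Proof.
move=> ip0; have [chi [B [[oB Bp sB] chi1 chi0 sm0 sm1]]] := cutoff_exists hM ip0.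
pose U := [set z : 'rV[R]_(n + n) | B (lsubmx z) /\ rsubmx z <> 0].
have oU : open U by exact: open_slit.
have UB u : U (crdS i u) -> B (crd i (base u)).
  by rewrite /U /= row_mxKl => -[].
have sU : U `<=` crdS i @` dom (a := SA) i.
  move=> z [Bz z0]; have [q iq qz] := sB _ Bz; have [u bu du] := slit_exists G iq z0.
  by exists u; rewrite /= bu // du qz hsubmxK.
have [cp _ _ _] := G.
pose E (c : 'rV[R]_n) u : tvec A := chi (base u) *: push i (base u) c.
pose V (v : 'rV[R]_(n + n)) u : tvec SA := chi (base u) *: push (A := SA) i u v.
have pE c : pfield (E c).
  apply: (pfield_near hM) => u.
    have [iu|niu] := pselect (dom i (base u)).
      by apply: (tangentZ G); exact: push_tangent.
    by rewrite /E chi0 // scale0r; exact: tangent0.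
  have [iu|niu] := pselect (dom i (base u)); last first.
    exists (chart_at A (base u)); first exact: cp.
    exact: (sm0 _ _ _ (fun w => push i (base w) c (chart_at A (base u)))).
  exists i => //; apply: (sm1 _ _ (fun w => push i (base w) c i)) => //.
  apply: (smooth_near_cong SG (f := fun=> c) _ (slit_dom_open G (i := i))) => //.
    by move=> q iq _; exact: push_refl.
  by move=> k; exact (Ck_cst (slit_dom_open G (i := i)) _ _).
have vV v : vfield (A := SA) (V v).
  apply: (vfield_near SG) => u.
    have [iu|niu] := pselect (dom i (base u)).
      by apply: (tangentZ SG); exact: push_tangent.
    by rewrite /V chi0 // scale0r; exact: tangent0.
  have [iu|niu] := pselect (dom i (base u)); last first.
    exists (chart_at A (base u)); first exact: cp.
    exact: (sm0 _ _ _ (fun w => push (A := SA) i w v (chart_at A (base u)))).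
  exists i => //; apply: (sm1 _ _ (fun w => push (A := SA) i w v i)) => //.
  apply: (smooth_near_cong SG (f := fun=> v) _ (slit_dom_open G (i := i))) => //.
    by move=> q iq _; exact: push_refl.
  by move=> k; exact (Ck_cst (slit_dom_open G (i := i)) _ _).
have VE v u : dom i (base u) -> U (crdS i u) -> V v u = push (A := SA) i u v.
  by move=> iu /UB Bu; rewrite /V chi1 // scale1r.
have EE c u : dom i (base u) -> U (crdS i u) -> E c u = push i (base u) c.
  by move=> iu /UB Bu; rewrite /E chi1 // scale1r.
exists U; split.
- split=> // u bu; rewrite /U /= row_mxKl row_mxKr bu; split=> //.
  by apply: dir_chart_neq0; rewrite bu.
- by move=> v; exists (V v) => // u iu Uu; rewrite VE // (push_refl SG).
- by move=> c; exists (E c) => // u iu Uu; rewrite EE // (push_refl G).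
move=> D hD; have [smD linD addD leibD tanD] := hD.
pose om z v c := local_expr (A := SA) i (fun u => D u (push (A := SA) i u v) (E c) i) z.
have omE u v c : dom i (base u) ->
   om (crdS i u) v c = D u (push (A := SA) i u v) (E c) i.
  by move=> iu; rewrite /om (local_exprE SG).
have om2 z v : U z -> linear (om z v).
  move=> /sU[u iu <-] k c d; rewrite !omE //.
  have tv : tangent (A := SA) u (push (A := SA) i u v) by exact: push_tangent.
  have -> : E (k *: c + d) = fun w => (fun x => k *: E c x) w + E d w.
    apply: funext => w; have [iw|niw] := pselect (dom i (base w)); last first.
      have E0 f : E f w = 0 by rewrite /E chi0 // scale0r.
      apply: etrans (E0 _) _; apply/esym.
      apply: etrans (f_equal2 (fun a b => k *: a + b) (E0 c) (E0 d)) _.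
      by rewrite scaler0 addr0.
    by rewrite /E (push_linear G iw) scalerDr !scalerA mulrC.
  rewrite addD //; last by apply: pfieldZ => //; exact: smooth_cst.
  by rewrite (conn_cst G hD k tv (pE c)).
exists om; split=> //.
- move=> z c /sU[u iu <-] k v w; rewrite !omE // (push_linear SG iu).
  by rewrite linD //; exact: push_tangent.
- move=> v c k; have [_ s] := smD _ _ (vV v) (pE c).
  apply: (Ck_cong oU) (CkS sU (s i k)) => z Uz; have [u iu uz] := sU _ Uz.
  by rewrite -uz omE // (local_exprE SG) // /cov VE // uz.
move=> u v X iu Uu tv pX.
pose e a : 'rV[R]_n := delta_mx 0 a.
pose F a w : R := chi (base w) * X w i 0 a.
have sX := pX.2.
have sF a : smooth SA (F a).
  apply: (smooth_near_all SG) => w; have [iw|niw] := pselect (dom i (base w)); last first.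
    exists (chart_at A (base w)); first exact: cp.
    exact: (sm0 _ _ _ (fun w => X w i 0 a : R)).
  exists i => //; apply: (sm1 _ _ (fun w => X w i 0 a : R)) => //.
  apply: (smooth_on_near SG) => // k.
  apply: (smooth_on_local G (f := fun z => local_expr (A := SA) i (fun w => X w i) z 0 a)).
    by move=> w' iw'; rewrite (local_exprE SG).
  exact (Ck_coord a (slit_dom_open G (i := i)) (sX i k)).
have schi : smooth SA (fun w => chi (base w) * chi (base w)).
  have s1 : smooth SA (fun w => chi (base w) *: (1 : R)).
    apply: (smooth_near_all SG) => w; have [iw|niw] := pselect (dom i (base w)); last first.
      exists (chart_at A (base w)); first exact: cp.
      exact: (sm0 _ _ _ (fun=> 1 : R)).
    exists i => //; apply: (sm1 _ _ (fun w => 1 : R)) => //.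
    apply: (smooth_on_near SG) => // k; exact: (smooth_cst G).
  have -> : (fun w => chi (base w) * chi (base w)) =
     fun w => (chi (base w) *: (1 : R)) * (chi (base w) *: (1 : R)).
    by apply: funext => w; rewrite /GRing.scale /= mulr1.
  exact: smoothM.
(* The square of [chi] leaves one factor for the coefficient and one for the frame. *)
have XE : (fun w => (chi (base w) * chi (base w)) *: X w)
        = fun w => \sum_a (fun x => F a x *: E (e a) x) w.
  apply: funext => w; have [iw|niw] := pselect (dom i (base w)); last first.
    rewrite chi0 // mul0r scale0r big1 // => a _.
    by rewrite /F chi0 // mul0r scale0r.
  have XW : X w = \sum_a X w i 0 a *: push i (base w) (e a).
    apply: etrans (esym (tangent_push iw (pX.1 w))) _.
    pose lM := GRing.isLinear.Build _ _ _ _ (push i (base w)) (push_linear G iw).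
    pose l : {linear 'rV[R]_n -> tvec A} := HB.pack (push i (base w)) lM.
    rewrite -[push i (base w)]/(l : _ -> _) {1}(row_sum_delta (X w i)) linear_sum.
    by apply: eq_bigr => a _; rewrite linearZ.
  rewrite [X in _ *: X]XW scaler_sumr.
  apply: eq_bigr => a _; rewrite /F /E !scalerA; congr (_ *: _).
  by ring.
have D1 : D u v (fun w => (chi (base w) * chi (base w)) *: X w) = D u v X.
  rewrite (leibD u v _ X tv schi pX).
  rewrite (dirder_near_cst G (c := 1) tv schi iu oU Uu).
    by rewrite scale0r add0r chi1 // ?mulr1 ?scale1r //; exact: UB.
  by move=> w iw /UB Uw; rewrite chi1 // mulr1.
have D2 : D u v X = \sum_a D u v (fun x => F a x *: E (e a) x).
  rewrite -D1 XE (conn_sum G hD) // => a; exact: pfieldZ.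
have Ds (f : 'I_n -> tvec A) : (\sum_a f a) i = \sum_a f a i by rewrite fct_sumE.
rewrite D2 Ds.
set z := crdS i u.
set Xh := local_expr _ _.
have dXh : differentiable Xh z by exact: pfield_diff.
have step a : D u v (fun x => F a x *: E (e a) x) i
   = 'D_(v i) Xh z 0 a *: e a + X u i 0 a *: om z (v i) (e a).
  rewrite leibD //.
  have -> : dirder u v (F a) = 'D_(v i) Xh z 0 a.
    rewrite (dirderE SG (i := i)) //; last exact: smooth_diff_at.
    rewrite -derive_coord //; apply: near_eq_derive.
    apply: near_open oU Uu _ => y Uy; have [w iw wy] := sU _ Uy.
    rewrite -wy !(local_exprE SG) // /F chi1 ?mul1r // /Xh ?(local_exprE SG) //.
    by apply: UB; rewrite wy.
  have -> : F a u = X u i 0 a by rewrite /F chi1 ?mul1r //; exact: UB.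
  rewrite EE // omE // (tangent_push (A := SA) (i := i) iu tv).
  congr (_ + _).
  rewrite -[LHS]/('D_(v i) Xh z 0 a *: push i (base u) (e a) i).
  by rewrite (push_refl G).
rewrite (eq_bigr _ (fun a _ => step a)) big_split /=; congr (_ + _).
  by rewrite -row_sum_delta.
by rewrite -(linear_expand (om2^~ (v i))).
Qed.

End ConnLocal.

(** * Finsler calculus in one chart *)

Section Lin.
Context {R : pzRingType} {V W : lmodType R} (f : V -> W).
Hypothesis fl : linear f.
Lemma lin_D a b : f (a + b) = f a + f b.
Proof. by have := fl 1 a b; rewrite !scale1r. Qed.
Lemma lin_0 : f 0 = 0.
Proof. by apply: (addrI (f 0)); rewrite -lin_D !addr0. Qed.
Lemma lin_Z k a : f (k *: a) = k *: f a.
Proof. by have := fl k a 0; rewrite !addr0 lin_0 addr0. Qed.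
Lemma lin_N a : f (- a) = - f a.
Proof. by rewrite -scaleN1r lin_Z scaleN1r. Qed.
Lemma lin_B a b : f (a - b) = f a - f b.
Proof. by rewrite lin_D lin_N. Qed.
End Lin.

Lemma lin_comp (R : pzRingType) (V V' W : lmodType R) (g : V' -> W) (f : V -> V') :
  linear g -> linear f -> linear (fun a => g (f a)).
Proof. by move=> gl fl k a b; rewrite fl gl. Qed.

Lemma lin_sub (R : pzRingType) (V W : lmodType R) (f g : V -> W) :
  linear f -> linear g -> linear (fun a => f a - g a).
Proof. by move=> fl gl k a b; rewrite fl gl scalerBr opprD addrACA. Qed.

Section BilinearFamily.
Context {R : realType} {V W : normedModType R} {m p : nat}.
Variables (U : set V) (B : V -> 'rV[R]_m -> 'rV[R]_p -> W).
Hypothesis oU : open U.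
Hypothesis Bl : forall z c, U z -> linear (fun a => B z a c).
Hypothesis Br : forall z a, U z -> linear (B z a).

Lemma diff_bil (X : V -> 'rV[R]_m) (Y : V -> 'rV[R]_p) z : U z ->
  (forall a c, differentiable (fun y => B y a c) z) ->
  differentiable X z -> differentiable Y z ->
  differentiable (fun y => B y (X y) (Y y)) z.
Proof.
move=> Uz dB dX dY; pose B2 y c := B y (X y) c.
apply: (diff_frozen (B := B2) oU Uz) => //; first by move=> y Uy; exact: Br.
move=> c; pose B1 y a := B y a c.
have Bl1 y : U y -> linear (B1 y) by move=> Uy; exact: Bl.
exact: (diff_frozen oU Uz Bl1 (fun a => dB a c) dX).
Qed.

Lemma derive_bil (X : V -> 'rV[R]_m) (Y : V -> 'rV[R]_p) z v : U z ->
  (forall a c, differentiable (fun y => B y a c) z) ->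
  differentiable X z -> differentiable Y z ->
  'D_v (fun y => B y (X y) (Y y)) z = 'D_v (fun y => B y (X z) (Y z)) z
    + B z ('D_v X z) (Y z) + B z (X z) ('D_v Y z).
Proof.
move=> Uz dB dX dY; pose B2 y c := B y (X y) c.
pose B1 y a := B y a (Y z).
have Bl1 y : U y -> linear (B1 y) by move=> Uy; exact: Bl.
have Bd1 a : differentiable (B1^~ a) z by exact: dB.
have Bl2 y : U y -> linear (B2 y) by move=> Uy; exact: Br.
have Bd2 c : differentiable (B2^~ c) z.
  pose B3 y a := B y a c.
  have Bl3 y : U y -> linear (B3 y) by move=> Uy; exact: Bl.
  exact: (diff_frozen oU Uz Bl3 (fun a => dB a c) dX).
apply: etrans (derive_frozen oU Uz Bl2 Bd2 v dY) _.
apply: (congr1 (fun t => t + _)).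
exact: (derive_frozen oU Uz Bl1 Bd1 v dX).
Qed.

Lemma smooth_bil (X : V -> 'rV[R]_m) (Y : V -> 'rV[R]_p) :
  (forall a c, smooth_on U (fun y => B y a c)) ->
  smooth_on U X -> smooth_on U Y -> smooth_on U (fun y => B y (X y) (Y y)).
Proof.
move=> sB sX sY; pose B2 y c := B y (X y) c.
apply: (smooth_frozen (B := B2)) => //; first by move=> y Uy; exact: Br.
move=> c; pose B1 y a := B y a c.
have Bl1 y : U y -> linear (B1 y) by move=> Uy; exact: Bl.
exact: (smooth_frozen oU Bl1 (fun a => sB a c) sX).
Qed.
End BilinearFamily.

Lemma derive_along (R : realType) m (W : normedModType R) (U : set 'rV[R]_m)
    (f : 'rV[R]_m -> W) (w : 'rV[R]_m -> 'rV[R]_m) z v : open U -> smooth_on U f ->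
  U z -> differentiable w z ->
  'D_v (fun y => 'D_(w y) f y) z = 'D_v ('D_(w z) f) z + 'D_('D_v w z) f z.
Proof.
move=> oU sf Uz dw; pose B y a := 'D_a f y.
have Bl y : U y -> linear (B y) by move=> Uy; apply: derive_linear; exact: smooth_diff sf Uy.
have Bd a : differentiable (B^~ a) z by exact: smooth_diff (smooth_derive a sf) Uz.
exact: (derive_frozen oU Uz Bl Bd v dw).
Qed.

(** The lemmas that follow are the linear algebra behind the comparison of the Cartan
and Berwald connections, with [o1], [o2] the values of the Cartan connection form,
[g1], [g2] those of the Berwald one, and [X = Y + t] the derivative of the metric
in the two horizontal directions. *)
Lemma metricity_difference (R : realFieldType) (q1 q2 o1 o2 o2' g1 g2 g2' X Y G t : R) :
  q1 = o1 - g1 -> q2 = o2 - g2 ->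
    X = o1 + o2' -> o2' = o2 -> X = Y + t -> Y = G + g1 + g2' -> g2' = g2 ->
    q1 + q2 = G + t.
Proof. by move=> *; lra. Qed.

(** Koszul: a three-tensor symmetric in its first two arguments is determined by its
symmetrisation in the last two. *)
Lemma koszul_trick (R : realFieldType) (x1 x2 x3 x4 x5 x6 y1 y2 y3 y4 t1 t2 t3 : R) :
  x1 + x2 = y1 + t1 -> x3 + x4 = y2 + t2 ->
   x5 + x6 = y3 + t3 -> x1 = x3 -> x2 = x5 -> x4 = x6 -> y1 = y2 -> y3 = y4 -> y1 = y4 ->
   2 * x1 = y1 + t1 + t2 - t3.
Proof. by move=> *; lra. Qed.

Lemma koszul_at_y (R : realFieldType) (x y g t1 t2 t3 : R) :
  2 * x = g + t1 + t2 - t3 -> x = - y -> g = 0 -> t1 = 0 ->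
    t3 = 0 -> y = - (2^-1 * t2).
Proof. by move=> *; lra. Qed.

Lemma koszul_halved (R : realFieldType) (x g t1 t2 t3 : R) :
  2 * x = g + t1 + t2 - t3 -> t1 = 0 -> t2 = 0 -> t3 = 0 ->
  x = 2^-1 * g.
Proof. by move=> *; lra. Qed.

Lemma symmetric_halved (R : realFieldType) (t x y w : R) :
  t = x + y -> x = w -> y = w -> x = 2^-1 * t.
Proof. by move=> *; lra. Qed.

Section LocalFinsler.
Context {R : realType} {n : nat}.
Local Notation V := 'rV[R]_n.
Local Notation V2 := 'rV[R]_(n + n).
Variables (U : set V2) (F2 : V2 -> R).
Hypothesis oU : open U.
Hypothesis sF : smooth_on U F2.

(** The Finsler metric, [F2] standing for [L^2]. *)
Definition gz (z : V2) (a b : V) : R := 2^-1 * 'D_(vv a) ('D_(vv b) F2) z.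

Lemma vv_lin (W : lmodType R) (f : V2 -> W) : linear f -> linear (fun b : V => f (vv b)).
Proof. by move=> fl k a b; rewrite linearP fl. Qed.

Lemma hh_lin (W : lmodType R) (f : V2 -> W) : linear f -> linear (fun b : V => f (hh b)).
Proof. by move=> fl k a b; rewrite linearP fl. Qed.

Lemma scaler_lin (f : V -> R) k : linear f -> linear (fun b => k * f b).
Proof. by move=> fl c a b; rewrite fl mulrDr /GRing.scale /= mulrCA. Qed.

Lemma diff_F2 z : U z -> differentiable F2 z.
Proof. exact: smooth_diff sF. Qed.

Lemma smooth_DF v : smooth_on U ('D_v F2). Proof. exact: smooth_derive. Qed.
Lemma smooth_DDF v w : smooth_on U ('D_w ('D_v F2)). Proof. by do 2 apply: smooth_derive. Qed.

Lemma F2_schwarz v w z : U z -> 'D_w ('D_v F2) z = 'D_v ('D_w F2) z.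
Proof. by move=> Uz; exact: (schwarz oU v w (sF 2%N) Uz). Qed.

Lemma gz_sym z a b : U z -> gz z a b = gz z b a.
Proof. by move=> Uz; rewrite /gz F2_schwarz. Qed.

Lemma gz_linl z b : U z -> linear (fun a => gz z a b).
Proof.
move=> Uz; apply: scaler_lin; apply: (vv_lin (f := fun v => 'D_v ('D_(vv b) F2) z)).
by apply: derive_linear; exact: smooth_diff (smooth_DF _) Uz.
Qed.

Lemma gz_linr z a : U z -> linear (gz z a).
Proof. by move=> Uz k b c; rewrite !(gz_sym a) // gz_linl. Qed.

Lemma smooth_gz a b : smooth_on U (fun z => gz z a b).
Proof.
move=> k; apply: (CkM oU) (smooth_DDF (vv b) (vv a) k); exact (Ck_cst oU k (2^-1 : R)).
Qed.

Lemma diff_gz a b z : U z -> differentiable (fun z => gz z a b) z.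
Proof. exact: smooth_diff (smooth_gz a b). Qed.

Lemma derive_gz v a b z : U z ->
  'D_v (fun z => gz z a b) z = 2^-1 * 'D_v ('D_(vv a) ('D_(vv b) F2)) z.
Proof.
move=> Uz; have d := smooth_diff (smooth_DDF (vv b) (vv a)) Uz.
apply: etrans (derive_scale v (differentiable_cst (2^-1 : R) z) d) _.
by rewrite derive_cst scale0r add0r.
Qed.

Lemma diff_gzX (X Y : V2 -> V) z : U z -> differentiable X z -> differentiable Y z ->
  differentiable (fun z => gz z (X z) (Y z)) z.
Proof.
move=> Uz; apply: (diff_bil oU) => //; [exact: gz_linl|exact: gz_linr|].
by move=> a c; exact: diff_gz.
Qed.

Lemma derive_gzX (X Y : V2 -> V) z v : U z -> differentiable X z -> differentiable Y z ->
  'D_v (fun z => gz z (X z) (Y z)) z = 'D_v (fun y => gz y (X z) (Y z)) z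
    + gz z ('D_v X z) (Y z) + gz z (X z) ('D_v Y z).
Proof.
move=> Uz; apply: (derive_bil oU) => //; [exact: gz_linl|exact: gz_linr|].
by move=> a c; exact: diff_gz.
Qed.

(** The vertical derivative of the metric, twice the Cartan tensor. *)
Definition T3 z a b c : R := 'D_(vv a) (fun z => gz z b c) z.

Lemma T3_sym23 z a b c : U z -> T3 z a b c = T3 z a c b.
Proof.
move=> Uz; apply: near_eq_derive; apply: near_open oU Uz _ => y Uy; exact: gz_sym.
Qed.

Lemma T3_linl z b c : U z -> linear (fun a => T3 z a b c).
Proof.
move=> Uz; apply: (vv_lin (f := fun v => 'D_v (fun z => gz z b c) z)).
by apply: derive_linear; exact: diff_gz.
Qed.

Hypothesis euler : forall z, U z -> 'D_(vv (rsub z)) F2 z = 2 * F2 z.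

Lemma diff_rsub (z : V2) : differentiable (@rsub R n) z.
Proof. exact: rV_linear_diff. Qed.

Lemma derive_rsub (z v : V2) : 'D_v (@rsub R n) z = rsub v.
Proof. exact: rV_derive_lin. Qed.

(** The vertical derivative of the Euler relation. *)
Lemma gz_y z b : U z -> gz z (rsub z) b = 2^-1 * 'D_(vv b) F2 z.
Proof.
move=> Uz.
have E : \near z, 'D_(vv (rsub z)) F2 z = 2 * F2 z by apply: near_open oU Uz _; exact: euler.
have := near_eq_derive (vv b) E.
pose B y a := 'D_(vv a) F2 y.
have Bl y : U y -> linear (B y).
  by move=> Uy; apply: (vv_lin (f := fun v => 'D_v F2 y)); apply: derive_linear; exact: diff_F2.
have Bd a : differentiable (B^~ a) z by exact: smooth_diff (smooth_DF _) Uz.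
have D := derive_frozen oU Uz Bl Bd (vv b) (diff_rsub z).
move=> H; have {D H} := etrans (esym D) H; rewrite /B derive_rsub rsubV.
have -> : 'D_(vv b) (fun y => 2 * F2 y) z = 2 * 'D_(vv b) F2 z.
  apply: etrans (derive_scale _ (differentiable_cst (2 : R) z) (diff_F2 Uz)) _.
  by rewrite derive_cst scale0r add0r.
rewrite /gz (F2_schwarz _ _ Uz).
by move=> H; congr (_ * _); move: H; set p := derive _ _ _; set q := derive _ _ _ => H; lra.
Qed.

(** The metric is homogeneous of degree zero in [y]; here this is read off from the
vertical derivative of [gz_y]. *)
Lemma T3_y z a b : U z -> T3 z a (rsub z) b = 0.
Proof.
move=> Uz.
have E : \near z, gz z (rsub z) b = 2^-1 * 'D_(vv b) F2 z.
  by apply: near_open oU Uz _ => y Uy; exact: gz_y.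
have dD : differentiable ('D_(vv b) F2) z by exact: smooth_diff (smooth_DF _) Uz.
have H := near_eq_derive (vv a) E.
have D := derive_gzX (vv a) Uz (diff_rsub z) (differentiable_cst b z).
have H2 := etrans (esym D) H.
have D2 := derive_scale (vv a) (differentiable_cst (2^-1 : R) z) dD.
have := etrans H2 D2.
rewrite derive_cst (derive_cst (2^-1 : R)) derive_rsub rsubV (lin_0 (gz_linr _ Uz)).
rewrite scale0r add0r addr0 -/(gz z a b).
by move=> H3; apply: (addIr (gz z a b)); rewrite add0r.
Qed.

Variable Gam : V2 -> V -> V -> V.
Hypothesis Gl : forall z c, U z -> linear (fun a => Gam z a c).
Hypothesis Gr : forall z a, U z -> linear (Gam z a).
Hypothesis sG : forall a c, smooth_on U (fun z => Gam z a c).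
Hypothesis Gs : forall z a c, U z -> Gam z a c = Gam z c a.
Hypothesis Gy : forall z a b, U z -> 'D_(vv b) (fun y => Gam y a (rsub z)) z = 0.

Definition Nl z a := Gam z a (rsub z).
Definition bet z a : V2 := hh a - vv (Nl z a).

Hypothesis dL : forall z a, U z -> 'D_(bet z a) F2 z = 0.

Lemma smooth_rsub : smooth_on U (@rsub R n). Proof. exact: smooth_rV_lin. Qed.
Lemma smooth_cstv (W : normedModType R) (c : W) : smooth_on U (fun=> c).
Proof. by move=> k; exact: Ck_cst. Qed.

Lemma smooth_Nl a : smooth_on U (fun z => Nl z a).
Proof. exact: (smooth_bil oU Gl Gr sG (smooth_cstv a) smooth_rsub). Qed.

Lemma smooth_bet a : smooth_on U (fun z => bet z a).
Proof.
move=> k; apply: (CkB oU); first exact: Ck_cst.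
by apply: (Ck_lin oU _ (smooth_Nl a k)); exact: rV_linear_continuous.
Qed.

Lemma diff_Gam a c z : U z -> differentiable (fun z => Gam z a c) z.
Proof. exact: smooth_diff (sG a c). Qed.
Lemma diff_Nl a z : U z -> differentiable (fun z => Nl z a) z.
Proof. exact: smooth_diff (smooth_Nl a). Qed.
Lemma diff_bet a z : U z -> differentiable (fun z => bet z a) z.
Proof. exact: smooth_diff (smooth_bet a). Qed.

Lemma bet_lin z : U z -> linear (bet z).
Proof.
move=> Uz k a b; rewrite /bet /Nl (Gl (rsub z) Uz).
rewrite (hh_is_linear k a b) (vv_is_linear k) scalerBr.
by rewrite opprD addrACA.
Qed.

Lemma lsub_bet z a : lsub (bet z a) = a.
Proof. by rewrite linearB /= lsubH lsubV subr0. Qed.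
Lemma rsub_bet z a : rsub (bet z a) = - Nl z a.
Proof. by rewrite linearB /= rsubH rsubV sub0r. Qed.

Lemma derive_Nl v a z : U z ->
  'D_v (fun z => Nl z a) z = 'D_v (fun y => Gam y a (rsub z)) z + Gam z a (rsub v).
Proof.
move=> Uz; have D := derive_bil oU Gl Gr v Uz (fun a c => diff_Gam a c Uz)
   (differentiable_cst a z) (diff_rsub z).
apply: etrans D _; rewrite derive_cst derive_rsub (lin_0 (Gl _ Uz)) addr0 //.
Qed.

Lemma derive_bet v a z : U z ->
  'D_v (fun z => bet z a) z = - vv ('D_v (fun z => Nl z a) z).
Proof.
move=> Uz.
have dv : differentiable (fun z => vv (Nl z a)) z.
  by apply: (differentiable_comp (g := @vv R n) (diff_Nl a Uz)); exact: rV_linear_diff.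
apply: etrans (derive_sub v (differentiable_cst (hh a) z) dv) _.
rewrite derive_cst sub0r; congr (- _).
by apply: (derive_lin (l := @vv R n)); [exact: rV_linear_continuous|exact: diff_Nl].
Qed.

Lemma derive_Nl_v b a z : U z -> 'D_(vv b) (fun z => Nl z a) z = Gam z a b.
Proof. by move=> Uz; rewrite derive_Nl // Gy // add0r rsubV. Qed.

Lemma derive_bet_v b a z : U z -> 'D_(vv b) (fun z => bet z a) z = - vv (Gam z a b).
Proof. by move=> Uz; rewrite derive_bet // derive_Nl_v. Qed.

(** The vertical derivative of the relation [bet a . F2 = 0]; the term with a
vertical derivative of [N] is [Gam(a, b)]. *)
Lemma delta_DF z a b : U z ->
  'D_(bet z a) ('D_(vv b) F2) z = 'D_(vv (Gam z a b)) F2 z.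
Proof.
move=> Uz.
have E : \near z, 'D_(bet z a) F2 z = 0 by apply: near_open oU Uz _ => y Uy; exact: dL.
have H := near_eq_derive (vv b) E.
have D := derive_along (vv b) oU sF Uz (diff_bet a Uz).
have := etrans (esym D) H.
rewrite derive_cst derive_bet_v // (deriveNv _ (diff_F2 Uz)).
by move=> /eqP; rewrite subr_eq0 => /eqP <-; exact: F2_schwarz.
Qed.

(** [(D°_(bet a) g)(b, c)], the horizontal covariant derivative of the metric for
the Berwald connection; up to a constant factor this is the Landsberg tensor. *)
Definition Gt z a b c : R :=
  'D_(bet z a) (fun z => gz z b c) z - gz z (Gam z a b) c - gz z b (Gam z a c).

(** Second vertical derivative of [bet a . F2 = 0].  In this form the symmetry of [Gt]
in all its arguments is visible, since [Gam] is symmetric. *)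
Lemma GtE z a b c : U z ->
  Gt z a b c = 2^-1 * 'D_(vv ('D_(vv c) (fun z => Gam z a b) z)) F2 z.
Proof.
move=> Uz.
have E : \near z, 'D_(bet z a) ('D_(vv b) F2) z = 'D_(vv (Gam z a b)) F2 z.
  by apply: near_open oU Uz _ => y Uy; exact: delta_DF.
have H := near_eq_derive (vv c) E.
have D1 := derive_along (vv c) oU (smooth_DF (vv b)) Uz (diff_bet a Uz).
have dvG : differentiable (fun z => vv (Gam z a b)) z.
  by apply: (differentiable_comp (g := @vv R n) (diff_Gam a b Uz)); exact: rV_linear_diff.
have D2 := derive_along (vv c) oU sF Uz dvG.
have {H} := etrans (esym D1) (etrans H D2).
have -> : 'D_(vv c) (fun z => vv (Gam z a b)) z = vv ('D_(vv c) (fun z => Gam z a b) z).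
  by apply: (derive_lin (l := @vv R n)); [exact: rV_linear_continuous|exact: diff_Gam].
rewrite derive_bet_v // deriveNv; last exact: smooth_diff (smooth_DF _) Uz.
have S := schwarz oU (bet z a) (vv c) (smooth_DF (vv b) 2%N) Uz.
move=> H.
have {S} S : 'D_(bet z a) ('D_(vv c) ('D_(vv b) F2)) z
   = 'D_(vv c) ('D_(vv (Gam z a b)) F2) z
    + 'D_(vv ('D_(vv c) (fun z => Gam z a b) z)) F2 z + 'D_(vv (Gam z a c)) ('D_(vv b) F2) z.
  have aux (x y p : R) : x - y = p -> x = p + y by move=> <-; rewrite subrK.
  exact: etrans (esym S) (aux _ _ _ H).
rewrite /Gt.
have -> : 'D_(bet z a) (fun z => gz z b c) z = 'D_(bet z a) (fun z => gz z c b) z.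
  by apply: near_eq_derive; apply: near_open oU Uz _ => y Uy; exact: gz_sym.
rewrite derive_gz // S (gz_sym _ c) // (gz_sym b) // /gz.
by rewrite !mulrDr addrAC addrK addrAC subrr add0r.
Qed.

Lemma Gt_sym12 z a b c : U z -> Gt z a b c = Gt z b a c.
Proof.
move=> Uz; apply: etrans (GtE a b c Uz) _; apply: etrans _ (esym (GtE b a c Uz)).
apply: (congr1 (fun w => 2^-1 * 'D_(vv w) F2 z)).
by apply: near_eq_derive; apply: near_open oU Uz _ => y Uy; exact: Gs.
Qed.

Lemma Gt_sym23 z a b c : U z -> Gt z a b c = Gt z a c b.
Proof.
move=> Uz; rewrite /Gt.
have E : 'D_(bet z a) (fun z => gz z b c) z = 'D_(bet z a) (fun z => gz z c b) z.
  by apply: near_eq_derive; apply: near_open oU Uz _ => y Uy; exact: gz_sym.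
apply: etrans (addrAC _ _ _) _; apply: (f_equal2 (fun x y => x - y)); last exact: gz_sym.
by apply: (f_equal2 (fun x y => x - y)); [exact: E|exact: gz_sym].
Qed.

(** The lowered vector [g(y, .)] is half of the vertical differential of [F2], which is
horizontally parallel by [delta_DF]. *)
Lemma Gt_y2 z a b : U z -> Gt z a (rsub z) b = 0.
Proof.
move=> Uz.
have E : \near z, gz z (rsub z) b = 2^-1 * 'D_(vv b) F2 z.
  by apply: near_open oU Uz _ => y Uy; exact: gz_y.
have dD : differentiable ('D_(vv b) F2) z by exact: smooth_diff (smooth_DF _) Uz.
have H := near_eq_derive (bet z a) E.
have D := derive_gzX (bet z a) Uz (diff_rsub z) (differentiable_cst b z).
have D2 := derive_scale (bet z a) (differentiable_cst (2^-1 : R) z) dD.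
have D2' : 'D_(bet z a) (fun y => 2^-1 * 'D_(vv b) F2 y) z = gz z (rsub z) (Gam z a b).
  apply: etrans D2 _; rewrite (derive_cst (2^-1 : R)) scale0r add0r.
  apply: etrans (congr1 (fun t => 2^-1 * t) (delta_DF a b Uz)) _.
  exact/esym/gz_y.
have D' : 'D_(bet z a) (fun z => gz z (rsub z) b) z
    = 'D_(bet z a) (fun y => gz y (rsub z) b) z - gz z (Nl z a) b.
  apply: etrans D _; rewrite derive_cst derive_rsub rsub_bet (lin_N (gz_linl _ Uz)).
  by rewrite (lin_0 (gz_linr _ Uz)) addr0.
by apply/eqP; rewrite subr_eq0; apply/eqP; exact: etrans (esym D') (etrans H D2').
Qed.

Lemma Gt_y1 z a b : U z -> Gt z (rsub z) a b = 0.
Proof. by move=> Uz; apply: etrans (Gt_sym12 _ _ _ Uz) (Gt_y2 _ _ Uz). Qed.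
Lemma Gt_y3 z a b : U z -> Gt z a b (rsub z) = 0.
Proof. by move=> Uz; apply: etrans (Gt_sym23 _ _ _ Uz) (Gt_y2 _ _ Uz). Qed.

Lemma Gt_lin1 z b c : U z -> linear (fun a => Gt z a b c).
Proof.
move=> Uz; have l1 := lin_comp (derive_linear (diff_gz b c Uz)) (bet_lin Uz).
have l2 := lin_comp (gz_linl c Uz) (Gl b Uz).
have l3 := lin_comp (gz_linr b Uz) (Gl c Uz).
exact (lin_sub (lin_sub l1 l2) l3).
Qed.
Lemma Gt_lin2 z a c : U z -> linear (fun b => Gt z a b c).
Proof.
move=> Uz k b b'; apply: etrans (Gt_sym12 _ _ _ Uz) _; apply: etrans (Gt_lin1 _ _ Uz _ _ _) _.
by apply: (f_equal2 (fun x y => k * x + y)); exact: Gt_sym12.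
Qed.
Lemma Gt_lin3 z a b : U z -> linear (Gt z a b).
Proof.
move=> Uz k c c'; apply: etrans (Gt_sym23 _ _ _ Uz) _; apply: etrans (Gt_lin2 _ _ Uz _ _ _) _.
by apply: (f_equal2 (fun x y => k * x + y)); exact: Gt_sym23.
Qed.

Lemma smooth_Gt a b c : smooth_on U (fun z => Gt z a b c).
Proof.
have s1 := smooth_deriveV oU (smooth_gz b c) (smooth_bet a).
have s2 := smooth_bil oU gz_linl gz_linr smooth_gz (sG a b) (smooth_cstv c).
have s3 := smooth_bil oU gz_linl gz_linr smooth_gz (smooth_cstv b) (sG a c).
by move=> k; exact (CkB oU (CkB oU (s1 k) (s2 k)) (s3 k)).
Qed.

(** The horizontal curvature of the Berwald connection; the outer sign is that of the
convention for the curvature. *)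
Definition Rc z a c e : V :=
  - ('D_(bet z a) (fun y => Gam y c e) z - 'D_(bet z c) (fun y => Gam y a e) z
     + Gam z a (Gam z c e) - Gam z c (Gam z a e)).

Lemma Rc_anti z a c e : Rc z a c e = - Rc z c a e.
Proof.
have H (a1 a2 a3 a4 : V) : - (a1 - a2 + a3 - a4) = - - (a2 - a1 + a4 - a3).
  by apply/rowP => j; rewrite !mxE; ring.
exact: H.
Qed.

Lemma Gam_symD v a c z : U z ->
  'D_v (fun y => Gam y a c) z = 'D_v (fun y => Gam y c a) z.
Proof.
by move=> Uz; apply: near_eq_derive; apply: near_open oU Uz _ => y Uy; exact: Gs.
Qed.

Lemma Rc_bianchi z a c e : U z -> Rc z a c e + Rc z c e a + Rc z e a c = 0.
Proof.
move=> Uz; rewrite /Rc (Gam_symD _ e a Uz) (Gam_symD _ c a Uz) (Gam_symD _ e c Uz).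
rewrite (Gs e a Uz) (Gs c a Uz) (Gs e c Uz).
set d1 := derive _ _ _; set d2 := derive _ _ _; set d3 := derive _ _ _.
set g1 := Gam _ _ _; set g2 := Gam _ _ _; set g3 := Gam _ _ _; clearbody d1 d2 d3.
apply/eqP; rewrite -!opprD oppr_eq0; apply/eqP/rowP => j; rewrite !mxE.
by ring.
Qed.

(** Two horizontal directions commute up to the vertical vector [R(a, c) y]: the
bracket of [bet a] and [bet c] has no horizontal part since [Gam] is symmetric. *)
Lemma delta_comm (f : V2 -> R) z a c : U z -> smooth_on U f ->
  'D_(bet z a) (fun y => 'D_(bet y c) f y) z - 'D_(bet z c) (fun y => 'D_(bet y a) f y) z
  = 'D_(vv (Rc z a c (rsub z))) f z.
Proof.
move=> Uz sf; have df : differentiable f z by exact: smooth_diff sf Uz.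
have D1 := derive_along (bet z a) oU sf Uz (diff_bet c Uz).
have D2 := derive_along (bet z c) oU sf Uz (diff_bet a Uz).
have S := schwarz oU (bet z c) (bet z a) (sf 2%N) Uz.
apply: etrans (f_equal2 (fun x y => x - y) D1 D2) _.
have E1 := derive_bet (bet z a) c Uz; have E2 := derive_bet (bet z c) a Uz.
have E3 := derive_Nl (bet z a) c Uz; have E4 := derive_Nl (bet z c) a Uz.
rewrite rsub_bet (lin_N (Gr _ Uz)) in E3; rewrite rsub_bet (lin_N (Gr _ Uz)) in E4.
have -> : vv (Rc z a c (rsub z)) =
   'D_(bet z a) (fun z => bet z c) z - 'D_(bet z c) (fun z => bet z a) z.
  apply: etrans _ (esym (f_equal2 (fun x y => x - y) E1 E2)).
  apply: etrans _ (esym (f_equal2 (fun x y => - vv x - - vv y) E3 E4)).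
  rewrite -opprD -(lin_N (@vv_is_linear R n)) -(lin_D (@vv_is_linear R n)).
  rewrite -(lin_N (@vv_is_linear R n)); congr vv; rewrite /Rc; congr (- _).
  have H (a1 a2 a3 a4 : V) : a1 - a2 + a3 - a4 = a1 - a4 - (a2 - a3).
    by apply/rowP => j; rewrite !mxE; ring.
  exact: H.
apply: etrans _ (esym (deriveDv _ _ df)); rewrite (deriveNv _ df).
have H (x y z1 z2 : R) : x = y -> x + z1 - (y + z2) = z1 - z2 by move=> ->; ring.
exact: H S.
Qed.

Lemma delta_g z a b c : U z -> 'D_(bet z a) (fun y => gz y b c) z
  = Gt z a b c + gz z (Gam z a b) c + gz z b (Gam z a c).
Proof. by move=> Uz; rewrite /Gt addrAC subrK subrK. Qed.

(** [(D°_(bet a) Gt)(c, e, w)]. *)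
Definition DGt z a c e w : R := 'D_(bet z a) (fun y => Gt y c e w) z
   - Gt z (Gam z a c) e w - Gt z c (Gam z a e) w - Gt z c e (Gam z a w).

Lemma DGtE z a c e w : U z -> DGt z a c e w =
  'D_(bet z a) (fun y => 'D_(bet y c) (fun x => gz x e w) y) z
  - (Gt z a (Gam z c e) w + gz z (Gam z a (Gam z c e)) w + gz z (Gam z c e) (Gam z a w)
     + gz z ('D_(bet z a) (fun y => Gam y c e) z) w)
  - (Gt z a e (Gam z c w) + gz z (Gam z a e) (Gam z c w) + gz z e (Gam z a (Gam z c w))
     + gz z e ('D_(bet z a) (fun y => Gam y c w) z))
  - Gt z (Gam z a c) e w - Gt z c (Gam z a e) w - Gt z c e (Gam z a w).
Proof.
move=> Uz; rewrite /DGt; do 3 apply: (congr1 (fun t => t - _)).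
have s1 := smooth_deriveV oU (smooth_gz e w) (smooth_bet c).
have d1 := smooth_diff s1 Uz.
have d2 := diff_gzX Uz (diff_Gam c e Uz) (differentiable_cst w z).
have d3 := diff_gzX Uz (differentiable_cst e z) (diff_Gam c w Uz).
have d12 : differentiable (fun y => 'D_(bet y c) (fun x => gz x e w) y
   - gz y (Gam y c e) w) z by exact: (differentiableB d1 d2).
apply: etrans (derive_sub (bet z a) d12 d3) _.
apply: etrans (congr1 (fun t => t - _) (derive_sub (bet z a) d1 d2)) _.
apply: (f_equal2 (fun x y => x - y)); first apply: (congr1 (fun t => _ - t)).
  apply: etrans (derive_gzX (bet z a) Uz (diff_Gam c e Uz) (differentiable_cst w z)) _.
  apply: etrans (f_equal2 +%R (congr1 (fun t => t + _) (delta_g _ _ _ Uz))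
    (etrans (congr1 _ (derive_cst w z (bet z a))) (lin_0 (gz_linr _ Uz)))) _.
  exact: addr0.
apply: etrans (derive_gzX (bet z a) Uz (differentiable_cst e z) (diff_Gam c w Uz)) _.
apply: etrans (congr1 (fun t => t + _) (f_equal2 +%R (delta_g _ _ _ Uz)
    (etrans (congr1 (gz z ^~ (Gam z c w)) (derive_cst e z (bet z a))) (lin_0 (gz_linl _ Uz))))) _.
exact: (congr1 (fun t => t + _) (addr0 _)).
Qed.

(** The Ricci identity for the metric: alternate in [a] and [c] the second covariant
derivative of [g]; the right-hand side of [delta_comm] contributes the [T3] term. *)
Lemma Rc_skew z a c e w : U z ->
  gz z (Rc z a c e) w + gz z (Rc z a c w) e
  = DGt z a c e w - DGt z c a e w - T3 z (Rc z a c (rsub z)) e w.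
Proof.
move=> Uz; rewrite (gz_sym _ e Uz).
have gRl (x1 x2 x3 x4 y : V) : gz z (- (x1 - x2 + x3 - x4)) y
   = - (gz z x1 y - gz z x2 y + gz z x3 y - gz z x4 y).
  by rewrite (lin_N (gz_linl _ Uz)) (lin_B (gz_linl _ Uz)) (lin_D (gz_linl _ Uz))
   (lin_B (gz_linl _ Uz)).
have gRr (x1 x2 x3 x4 y : V) : gz z y (- (x1 - x2 + x3 - x4))
   = - (gz z y x1 - gz z y x2 + gz z y x3 - gz z y x4).
  by rewrite (lin_N (gz_linr _ Uz)) (lin_B (gz_linr _ Uz)) (lin_D (gz_linr _ Uz))
   (lin_B (gz_linr _ Uz)).
have C := delta_comm a c Uz (smooth_gz e w).
apply: etrans (f_equal2 +%R (gRl _ _ _ _ w) (gRr _ _ _ _ e)) _.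
apply/esym; apply: etrans (f_equal2 (fun x y => x - y)
   (f_equal2 (fun x y => x - y) (DGtE a c e w Uz) (DGtE c a e w Uz)) (esym C)) _.
have H (x1 x2 P1 p2 p3 p4 P5 p6 p7 p8 P9 P10 P11 p2' p4' p7' p8' P9' : R) : P9 = P9' ->
  x1 - (P1 + p2 + p3 + p4) - (P5 + p6 + p7 + p8) - P9 - P10 - P11
  - (x2 - (P10 + p2' + p6 + p4') - (P11 + p3 + p7' + p8') - P9' - P1 - P5) - (x1 - x2)
  = - (p4 - p4' + p2 - p2') + - (p8 - p8' + p7 - p7') by move=> ->; ring.
exact (H _ _ _ _ _ _ _ _ _ _ _ _ _ _ _ _ _ _
  (congr1 (fun t => Gt z t e w) (Gs a c Uz))).
Qed.

Lemma DGt_y4 z a c e : U z -> DGt z a c e (rsub z) = 0.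
Proof.
move=> Uz; pose B y w := Gt y c e w.
have Bl y : U y -> linear (B y) by move=> Uy; exact: Gt_lin3.
have Bd w : differentiable (B^~ w) z by exact: smooth_diff (smooth_Gt c e w) Uz.
have D := derive_frozen oU Uz Bl Bd (bet z a) (diff_rsub z).
have E : \near z, B z (rsub z) = 0 by apply: near_open oU Uz _ => y Uy; exact: Gt_y3.
have := etrans (esym D) (near_eq_derive _ E).
rewrite derive_cst derive_rsub rsub_bet (lin_N (Bl z Uz)) => /eqP.
rewrite subr_eq0 => /eqP H.
rewrite /DGt (Gt_y3 _ _ Uz) (Gt_y3 _ _ Uz) !subr0.
by apply/eqP; rewrite subr_eq0; apply/eqP; exact: H.
Qed.

Lemma DGt_y2 z a e w : U z -> DGt z a (rsub z) e w = 0.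
Proof.
move=> Uz; pose B y c := Gt y c e w.
have Bl y : U y -> linear (B y) by move=> Uy; exact: Gt_lin1.
have Bd c : differentiable (B^~ c) z by exact: smooth_diff (smooth_Gt c e w) Uz.
have D := derive_frozen oU Uz Bl Bd (bet z a) (diff_rsub z).
have E : \near z, B z (rsub z) = 0 by apply: near_open oU Uz _ => y Uy; exact: Gt_y1.
have := etrans (esym D) (near_eq_derive _ E).
rewrite derive_cst derive_rsub rsub_bet (lin_N (Bl z Uz)) => /eqP.
rewrite subr_eq0 => /eqP H.
rewrite /DGt (Gt_y1 _ _ Uz) (Gt_y1 _ _ Uz) !subr0.
by apply/eqP; rewrite subr_eq0; apply/eqP; exact: H.
Qed.

Lemma DGt_sym12 z a c e w : U z -> DGt z a c e w = DGt z a e c w.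
Proof.
move=> Uz; have E : 'D_(bet z a) (fun y => Gt y c e w) z = 'D_(bet z a) (fun y => Gt y e c w) z.
  by apply: near_eq_derive; apply: near_open oU Uz _ => y Uy; exact: Gt_sym12.
have H (x x' p q r p' q' r' : R) : x = x' -> p = q' -> q = p' -> r = r' ->
  x - p - q - r = x' - p' - q' - r' by move=> -> -> -> ->; ring.
exact (H _ _ _ _ _ _ _ _ E (Gt_sym12 _ _ _ Uz) (Gt_sym12 _ _ _ Uz) (Gt_sym12 _ _ _ Uz)).
Qed.

Lemma DGt_sym23 z a c e w : U z -> DGt z a c e w = DGt z a c w e.
Proof.
move=> Uz; have E : 'D_(bet z a) (fun y => Gt y c e w) z = 'D_(bet z a) (fun y => Gt y c w e) z.
  by apply: near_eq_derive; apply: near_open oU Uz _ => y Uy; exact: Gt_sym23.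
have H (x x' p q r p' q' r' : R) : x = x' -> p = p' -> q = r' -> r = q' ->
  x - p - q - r = x' - p' - q' - r' by move=> -> -> -> ->; ring.
exact (H _ _ _ _ _ _ _ _ E (Gt_sym23 _ _ _ Uz) (Gt_sym23 _ _ _ Uz) (Gt_sym23 _ _ _ Uz)).
Qed.

Lemma Rc_y z a c e : U z -> gz z (Rc z a c e) (rsub z) = - gz z (Rc z a c (rsub z)) e.
Proof.
move=> Uz; apply/eqP; rewrite -addr_eq0 (Rc_skew _ _ _ _ Uz).
rewrite (DGt_y4 a c e Uz) (DGt_y4 c a e Uz).
have -> : T3 z (Rc z a c (rsub z)) e (rsub z) = 0.
  exact: etrans (T3_sym23 _ _ _ Uz) (T3_y _ _ Uz).
by rewrite !subrr.
Qed.

Lemma Rc_skew_y z c e w : U z ->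
  gz z (Rc z (rsub z) c e) w + gz z (Rc z (rsub z) c w) e
  = DGt z (rsub z) c e w - T3 z (Rc z (rsub z) c (rsub z)) e w.
Proof. by move=> Uz; rewrite (Rc_skew _ _ _ _ Uz) (DGt_y2 _ _ _ Uz) subr0. Qed.

Section Cartan.
Variables (om : V2 -> V2 -> V -> V) (Nn : V2 -> V -> V).
Hypothesis ol : forall z c, U z -> linear (fun v => om z v c).
Hypothesis orr : forall z v, U z -> linear (om z v).
Hypothesis gpos : forall z a, U z -> a <> 0 -> 0 < gz z a a.
Hypothesis om_metric : forall z v a b, U z ->
  'D_v (fun y => gz y a b) z = gz z (om z v a) b + gz z a (om z v b).
Hypothesis NnE : forall z a, U z -> Nn z a + om z (vv (Nn z a)) (rsub z) = om z (hh a) (rsub z).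

Definition bet' z a : V2 := hh a - vv (Nn z a).
Hypothesis om_tors : forall z a c, U z -> om z (bet' z a) c = om z (bet' z c) a.

Lemma gz_inj z a : U z -> (forall c, gz z a c = 0) -> a = 0.
Proof.
move=> Uz H; apply: contrapT => a0; have := gpos Uz a0.
by rewrite H ltxx.
Qed.

(** The differences between the Berwald and Cartan horizontal maps and connection
forms. *)
Let dd z a := Nl z a - Nn z a.
Let q z a b c := gz z (om z (bet' z a) b - Gam z a b) c.

Lemma bet'E z a : bet' z a = bet z a + vv (dd z a).
Proof. by rewrite /bet' /bet /dd (lin_B (@vv_is_linear R n)) addrA subrK. Qed.

Lemma om_bet'_y z a : U z -> om z (bet' z a) (rsub z) = Nn z a.
Proof.
by move=> Uz; rewrite /bet' (lin_B (ol _ Uz)) -(NnE a Uz) addrK.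
Qed.

Lemma q_y z a c : U z -> q z a (rsub z) c = - gz z (dd z a) c.
Proof.
move=> Uz; rewrite /q om_bet'_y // -(lin_N (gz_linl _ Uz)); congr (gz z _ c).
by rewrite /dd opprB.
Qed.

Lemma q_sym z a b c : U z -> q z a b c = q z b a c.
Proof.
by move=> Uz; exact: (f_equal2 (fun x y => gz z (x - y) c) (om_tors a b Uz) (Gs a b Uz)).
Qed.

Lemma q_metric z a b c : U z -> q z a b c + q z a c b = Gt z a b c + T3 z (dd z a) b c.
Proof.
move=> Uz.
have M := om_metric (bet' z a) b c Uz.
have D : 'D_(bet' z a) (fun y => gz y b c) z
  = 'D_(bet z a) (fun y => gz y b c) z + T3 z (dd z a) b c.
  by rewrite bet'E (deriveDv _ _ (diff_gz b c Uz)).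
have E1 : q z a b c = _ := lin_B (gz_linl c Uz) _ _.
have E2 : q z a c b = _ := lin_B (gz_linl b Uz) _ _.
exact (metricity_difference E1 E2 M (gz_sym _ _ Uz) D (delta_g _ _ _ Uz)
  (gz_sym _ _ Uz)).
Qed.

(** The Koszul formula for the difference tensor: it is symmetric in [a], [b] because
both connections have no horizontal torsion, and its symmetrisation in [b], [c] is
given by metricity. *)
Lemma q_koszul z a b c : U z -> 2 * q z a b c =
  Gt z a b c + T3 z (dd z a) b c + T3 z (dd z b) a c - T3 z (dd z c) a b.
Proof.
move=> Uz; have H1 := q_metric a b c Uz; have H2 := q_metric b a c Uz.
have H3 := q_metric c a b Uz.
have S1 := q_sym a b c Uz; have S2 := q_sym a c b Uz; have S3 := q_sym b c a Uz.
have G1 := Gt_sym12 a b c Uz; have G2 := Gt_sym12 c a b Uz.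
have G3 := Gt_sym23 a b c Uz.
exact (koszul_trick H1 H2 H3 S1 S2 S3 G1 G2 G3).
Qed.

(** Put [b = y] in [q_koszul]: every [dd a] is determined by [dd y].  Then put [a = y]:
the term left over is a value of [T3] at [y], so [dd y = 0]. *)
Lemma dd0 z a : U z -> dd z a = 0.
Proof.
move=> Uz.
have Q a' c : gz z (dd z a') c = - (2^-1 * T3 z (dd z (rsub z)) a' c).
  have H1 := q_koszul a' (rsub z) c Uz; have H2 := q_y a' c Uz.
  have H3 := Gt_y2 a' c Uz; have H4 := T3_y (dd z a') c Uz.
  have H5 := etrans (T3_sym23 _ a' (rsub z) Uz) (T3_y (dd z c) a' Uz).
  exact (koszul_at_y H1 H2 H3 H4 H5).
have dy : dd z (rsub z) = 0.
  by apply: (gz_inj Uz) => c; rewrite Q (T3_y _ _ Uz) mulr0 oppr0.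
by apply: (gz_inj Uz) => c; rewrite Q dy (lin_0 (T3_linl _ _ Uz)) mulr0 oppr0.
Qed.

Lemma Nn_Nl z a : U z -> Nn z a = Nl z a.
Proof. by move=> Uz; have := dd0 a Uz; rewrite /dd => /eqP; rewrite subr_eq0 => /eqP. Qed.

Lemma bet'_bet z a : U z -> bet' z a = bet z a.
Proof. by move=> Uz; rewrite /bet' Nn_Nl. Qed.

Lemma cartan_berwald z a b c : U z ->
  gz z (om z (bet z a) b - Gam z a b) c = 2^-1 * Gt z a b c.
Proof.
move=> Uz; have H1 := q_koszul a b c Uz.
have T0 x p r : T3 z (dd z x) p r = 0 by rewrite dd0 // (lin_0 (T3_linl _ _ Uz)).
rewrite -(bet'_bet a Uz); exact (koszul_halved H1 (T0 _ _ _) (T0 _ _ _) (T0 _ _ _)).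
Qed.

Hypothesis om_mixed : forall z a b c, U z ->
  gz z (om z (vv a) b) c = gz z (om z (vv a) c) b.

Lemma mixed_T3 z a b c : U z -> gz z (om z (vv a) b) c = 2^-1 * T3 z a b c.
Proof.
move=> Uz; have H1 := om_metric (vv a) b c Uz; have H2 := om_mixed a b c Uz.
have H3 := gz_sym b (om z (vv a) c) Uz.
exact (symmetric_halved H1 H2 H3).
Qed.

End Cartan.
End LocalFinsler.

(** * The horizontal map of a regular connection *)

Section MatrixSmooth.
Context {R : realType} {V : normedModType R}.
Variables (U : set V) (oU : open U) (k : nat).

Lemma Ck_prod I (r : seq I) (f : I -> V -> R) :
  (forall i, Ck k U (f i)) -> Ck k U (fun x => \prod_(i <- r) f i x).
Proof.
move=> cf; elim: r => [|i r IH].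
  by apply: (Ck_cong oU) (Ck_cst oU k (1 : R)) => x _; rewrite big_nil.
by apply: (Ck_cong oU) (CkM oU (cf i) IH) => x _; rewrite big_cons.
Qed.

Lemma Ck_det m (P : V -> 'M[R]_m) : (forall i j, Ck k U (fun x => P x i j)) ->
  Ck k U (fun x => \det (P x)).
Proof.
move=> cP; apply: (Ck_sum oU) => s _; apply: (CkM oU).
  exact (Ck_cst oU k (_ : R)).
exact: Ck_prod.
Qed.

Lemma Ck_adj m (P : V -> 'M[R]_m) i j : (forall i j, Ck k U (fun x => P x i j)) ->
  Ck k U (fun x => \adj (P x) i j).
Proof.
move=> cP.
apply: (Ck_cong oU (f := fun x => (-1) ^+ (j + i) * \det (row' j (col' i (P x))))).
  by move=> x _; rewrite mxE.
apply: (CkM oU); first exact (Ck_cst oU k ((-1) ^+ (j + i) : R)).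
apply: Ck_det => a b.
by apply: (Ck_cong oU) (cP (lift j a) (lift i b)) => x _; rewrite !mxE.
Qed.

(** By the formula of Cramer. *)
Lemma Ck_mulinv m (P : V -> 'M[R]_m) (f : V -> 'rV[R]_m) :
  (forall i j, Ck k U (fun x => P x i j)) -> (forall x, U x -> P x \in unitmx) ->
  Ck k U f -> Ck k U (fun x => f x *m invmx (P x)).
Proof.
move=> cP uP cf; apply: (Ck_rV oU) => j.
have c a : Ck k U (fun x => f x 0 a * ((\det (P x))^-1 * \adj (P x) a j)).
  apply: (CkM oU); first exact: (Ck_coord a oU cf).
  apply: (CkM oU); last exact: Ck_adj.
  apply: (Ck_inv oU); last exact: Ck_det.
  by move=> x /uP; rewrite unitmxE unitfE.
apply: (Ck_cong oU) (Ck_sum oU (index_enum _) (P := xpredT) (fun a _ => c a)) => x Ux.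
rewrite mxE; apply: eq_bigr => a _; congr (_ * _).
by rewrite /invmx uP // !mxE.
Qed.

End MatrixSmooth.

Section Regular.
Context {R : realType} {n : nat} {M : topologicalType} (A : atlas R n M).
Hypothesis hM : smooth_manifold A.
Local Notation SA := (slit_atlas A).
Local Notation crdS := (crd (a := slit_atlas A)).
Implicit Types (u : slit A) (i j : chart A).

Let G : good_atlas A := manifold_good hM.
Let SG : good_atlas SA := slit_good G.

Variable D : connection A.
Hypothesis (hD : is_connection D) (hR : regular D).

Lemma rho_linear u k (v w : tvec SA) : tangent u v -> tangent u w ->
  rho u (k *: v + w) = k *: rho u v + rho u w.
Proof.
move=> tv tw; have [/(_ (base u)) cu _ _ _] := G.
have tvw : tangent u (k *: v + w) by exact: (tangentP SG).
apply: (tangent_inj cu).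
- exact: (rho_tangent G).
- by apply: (tangentP G); exact: (rho_tangent G).
rewrite (rhoE G tvw cu).
apply: etrans _ (esym (f_equal2 (fun x y => k *: x + y) (rhoE G tv cu) (rhoE G tw cu))).
exact: (lsub_is_linear k).
Qed.

Lemma lift_exists u w : tangent (base u) w -> exists2 v : tvec SA, tangent u v & rho u v = w.
Proof.
move=> tw; have [/(_ (base u)) cu _ _ _] := G; set i := chart_at A (base u) in cu *.
have tv : tangent u (push (A := SA) i u (hh (w i))) by exact: (push_tangent SG).
exists (push (A := SA) i u (hh (w i))); first exact: tv.
have E : rho u (push (A := SA) i u (hh (w i))) i = w i.
  by rewrite (rhoE G tv cu) (push_refl SG) ?lsubH.
exact (tangent_inj cu (rho_tangent G tv) tw E).
Qed.

Lemma conn_linN u (v w : tvec SA) X : tangent u v -> tangent u w -> pfield X ->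
  D u (w - v) X = D u w X - D u v X.
Proof.
move=> tv tw pX; have [_ L _ _ _] := hD.
have e : -1 *: v + w = w - v by rewrite scaleN1r addrC.
by rewrite -e (L u v w (-1) X tv tw pX) scaleN1r addrC.
Qed.

Lemma horizontal_inj u (v w : tvec SA) : horizontal D u v -> horizontal D u w ->
  rho u v = rho u w -> v = w.
Proof.
move=> [tv hv] [tw hw] E.
have tvw := tangentD SG tv (tangentN SG tw).
have e : -1 *: w + v = v - w by rewrite scaleN1r addrC.
have r0 : rho u (v - w) = 0.
  rewrite -e; apply: etrans (rho_linear (-1) tw tv) _.
  by rewrite E scaleN1r addNr.
have h0 : D u (v - w) (@fund R n M A) = 0.
  by apply: etrans (conn_linN tw tv (pfield_fund G)) _; rewrite hv hw subrr.
have [K _] := hR u.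
have : [set (0 : tvec SA)] (v - w) by rewrite -K; exact: (conj (conj tvw r0) (conj tvw h0)).
exact: subr0_eq.
Qed.

Lemma betaP u w : tangent (base u) w ->
  [/\ tangent u (beta D u w), D u (beta D u w) (@fund R n M A) = 0 & rho u (beta D u w) = w].
Proof.
move=> tw; have [v tv rv] := lift_exists tw.
have [_ /(_ v tv)[a [b [[ta ra] hb E]]]] := hR u.
have rb : rho u b = w.
  rewrite -rv E; have := rho_linear 1 ta hb.1; rewrite !scale1r ra add0r.
  exact: esym.
have [[t1 h1] r1] : [set v | horizontal D u v /\ rho u v = w] (beta D u w).
  exact: (xgetI 0 (conj hb rb)).
by split; [exact: t1|exact: h1|exact: r1].
Qed.

(** Regularity, in the form used below: a horizontal vector is determined by its
projection. *)
Lemma beta_uniq u v w : tangent u v -> D u v (@fund R n M A) = 0 -> rho u v = w ->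
  beta D u w = v.
Proof.
move=> tv hv rv; have tw : tangent (base u) w by rewrite -rv; exact: (rho_tangent G).
have [tb hb rb] := betaP tw.
exact: (horizontal_inj (conj tb hb) (conj tv hv) (etrans rb (esym rv))).
Qed.

Section Local.
Variables (i : chart A) (U : set 'rV[R]_(n + n)).
Variable (om : 'rV[R]_(n + n) -> 'rV[R]_(n + n) -> 'rV[R]_n -> 'rV[R]_n).
Hypothesis oU : open U.
Hypothesis sU : U `<=` crdS i @` dom (a := SA) i.
Hypothesis hom : local_form i U D om.

Let om1 : forall z c, U z -> linear (fun v => om z v c). Proof. by have [] := hom. Qed.
Let om2 : forall z v, U z -> linear (om z v). Proof. by have [] := hom. Qed.

Lemma rsub_crd u : rsub (crdS i u) = dir u i.
Proof. by rewrite /rsub /= row_mxKr. Qed.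

Lemma derive_fund u v : dom i (base u) ->
  'D_v (local_expr (A := SA) i (fun w => @fund R n M A w i)) (crdS i u) = rsub v.
Proof.
move=> iu; rewrite -(derive_rsub (crdS i u) v).
apply: near_eq_derive; apply: (near_chart1 SG) => // w iw.
by rewrite (local_exprE SG) // rsub_crd.
Qed.

Lemma conn_fund u (v : tvec SA) : dom i (base u) -> U (crdS i u) -> tangent u v ->
  D u v (@fund R n M A) i = rsub (v i) + om (crdS i u) (v i) (rsub (crdS i u)).
Proof.
move=> iu Uu tv; have [_ _ _ H] := hom; apply: etrans (H u v _ iu Uu tv (pfield_fund G)) _.
by apply: (f_equal2 (fun x y => x + om _ _ y)); [exact: derive_fund|rewrite rsub_crd].
Qed.

(** The matrix of [b |-> D_(vv b) eta].  Regularity says exactly that it is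
invertible, which makes the nonlinear coefficients [Nn] smooth. *)
Definition Pm z : 'M[R]_n :=
  \matrix_(a, b) (delta_mx 0 a + om z (vv (delta_mx 0 a)) (rsub z)) 0 b.

Lemma mul_Pm z b : U z -> b *m Pm z = b + om z (vv b) (rsub z).
Proof.
move=> Uz; have fl : linear (fun b => b + om z (vv b) (rsub z)).
  move=> k x y; rewrite (vv_is_linear k) (om1 _ Uz) scalerDr addrACA //.
have E : b + om z (vv b) (rsub z) =
   \sum_j b 0 j *: (delta_mx 0 j + om z (vv (delta_mx 0 j)) (rsub z)).
  pose lM := GRing.isLinear.Build _ _ _ _ (fun b => b + om z (vv b) (rsub z)) fl.
  pose l : {linear 'rV[R]_n -> 'rV[R]_n} := HB.pack (fun b => b + om z (vv b) (rsub z)) lM.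
  rewrite -[LHS]/(l b) {1}(row_sum_delta b) linear_sum.
  by apply: eq_bigr => j _; rewrite linearZ.
rewrite E; apply/rowP => j; rewrite !mxE summxE; apply: eq_bigr => a _.
by rewrite !mxE.
Qed.

Lemma Pm_unit z : U z -> Pm z \in unitmx.
Proof.
move=> Uz; have [u iu' uz] := sU Uz; have iu : dom (a := A) i (base u) by exact: iu'.
rewrite -row_free_unit -kermx_eq0; apply/eqP/row_matrixP => a; rewrite row0.
set b := row a _.
have b0 : b *m Pm z = 0 by rewrite /b -row_mul mulmx_ker row0.
rewrite mul_Pm // in b0.
have tv : tangent u (push (A := SA) i u (vv b)) by exact: (push_tangent SG).
have vi : push (A := SA) i u (vv b) i = vv b by exact: (push_refl SG).
have [_ _ _ _ tD] := hD.
have r0 : rho u (push (A := SA) i u (vv b)) = 0.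
  apply: (tangent_inj iu (rho_tangent G tv) (tangent0 A _)).
  by rewrite (rhoE G tv iu) vi lsubV.
have Uu : U (crdS i u) by rewrite uz.
have h0 : D u (push (A := SA) i u (vv b)) (@fund R n M A) = 0.
  apply: (tangent_inj iu (tD _ _ _ tv (pfield_fund G)) (tangent0 A _)).
  apply: etrans (conn_fund iu Uu tv) _.
  by rewrite vi uz rsubV b0.
have [K _] := hR u.
have : [set (0 : tvec SA)] (push (A := SA) i u (vv b)).
  by rewrite -K; exact: (conj (conj tv r0) (conj tv h0)).
move=> /= E; have := congr1 (fun v : tvec SA => v i) E; rewrite vi => /(congr1 (@rsub R n)).
by rewrite rsubV linear0.
Qed.

Definition Nn z a : 'rV[R]_n := om z (hh a) (rsub z) *m invmx (Pm z).

Lemma NnE z a : U z -> Nn z a + om z (vv (Nn z a)) (rsub z) = om z (hh a) (rsub z).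
Proof. by move=> Uz; rewrite -mul_Pm // /Nn mulmxKV //; exact: Pm_unit. Qed.

Lemma Nn_lin z : U z -> linear (Nn z).
Proof.
by move=> Uz k a b; rewrite /Nn (hh_is_linear k) (om1 _ Uz) mulmxDl scalemxAl.
Qed.

Lemma smooth_om_y v : smooth_on U (fun z => om z v (rsub z)).
Proof.
have [_ _ so _] := hom; pose B z c := om z v c.
have Bl z : U z -> linear (B z) by move=> Uz; exact: om2.
exact: (smooth_frozen oU Bl (so v) (smooth_rV_lin _ oU)).
Qed.

Lemma smooth_Nn a : smooth_on U (fun z => Nn z a).
Proof.
move=> k; apply: (Ck_mulinv oU) (smooth_om_y _ k); last exact: Pm_unit.
move=> p q.
have c : Ck k U (fun z => delta_mx 0 p + om z (vv (delta_mx 0 p)) (rsub z)).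
  exact (CkD oU (Ck_cst oU k (delta_mx 0 p : 'rV[R]_n)) (smooth_om_y _ k)).
by apply: (Ck_cong oU) (Ck_coord q oU c) => z Uz; rewrite [RHS]mxE.
Qed.

Lemma beta_chart u w : dom i (base u) -> U (crdS i u) -> tangent (base u) w ->
  beta D u w i = hh (w i) - vv (Nn (crdS i u) (w i)).
Proof.
move=> iu Uu tw; set z := crd _ _; set v := hh _ - _.
have tv : tangent u (push (A := SA) i u v) by exact: (push_tangent SG).
have vi : push (A := SA) i u v i = v by exact: (push_refl SG).
have lv : lsub v = w i by rewrite /v linearB /= lsubH lsubV subr0.
have rv : rsub v = - Nn z (w i) by rewrite /v linearB /= rsubH rsubV sub0r.
have [_ _ _ _ tD] := hD.
have h0 : D u (push (A := SA) i u v) (@fund R n M A) = 0.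
  apply: (tangent_inj iu (tD _ _ _ tv (pfield_fund G)) (tangent0 A _)).
  apply: etrans (conn_fund iu Uu tv) _.
  by rewrite vi rv /v (lin_B (om1 _ Uu)) -(NnE (w i) Uu) addrK addNr.
have r0 : rho u (push (A := SA) i u v) = w.
  by apply: (tangent_inj iu (rho_tangent G tv) tw); rewrite (rhoE G tv iu) vi lv.
by rewrite (beta_uniq tv h0 r0) vi.
Qed.

End Local.

(** Smoothness of horizontal lifts is not built into the definition of a regular
connection: it comes from the explicit formula [beta_chart]. *)
Lemma vfield_beta X : pfield X -> vfield (A := SA) (beta_f D X).
Proof.
move=> [tX sX]; apply: (vfield_near SG) => u; first by have [] := betaP (tX u).
have [/(_ (base u)) iu _ _ _] := G; set i := chart_at A (base u) in iu *; exists i => //.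
have [U [[oU Uu sU] _ _ /(_ D hD)[om hom]]] := connection_local hM iu.
pose Xh := local_expr (A := SA) i (fun w => X w i).
pose f z := hh (Xh z) - vv (Nn om z (Xh z)).
apply: (smooth_near_cong SG (f := f) iu oU (Uu _ _)) => //.
  move=> w iw Uw; rewrite /beta_f (beta_chart sU hom iw Uw (tX w)).
  by rewrite /f /Xh (local_exprE SG).
have sXh : smooth_on U Xh by move=> k; exact: CkS sU (sX i k).
have sN : smooth_on U (fun z => Nn om z (Xh z)).
  exact: (smooth_frozen oU (Nn_lin hom) (smooth_Nn oU sU hom) sXh).
move=> k; apply: (CkB oU); apply: (Ck_lin oU) => //; exact: rV_linear_continuous.
Qed.

Lemma cov_beta_fund X : pfield X -> cov D (beta_f D X) (@fund R n M A) = fun=> 0.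
Proof. by move=> [tX _]; apply: funext => u; have [] := betaP (tX u). Qed.

End Regular.

(** * The Finsler metric in charts *)

Section Metric.
Context {R : realType} {n : nat} {M : Type} (A : atlas R n M).
Hypothesis G : good_atlas A.
Local Notation SA := (slit_atlas A).
Local Notation crdS := (crd (a := slit_atlas A)).
Implicit Types (u w : slit A) (i j : chart A).
Let SG : good_atlas SA := slit_good G.

Variable L : slit A -> R.
Hypothesis hL : finsler L.

Definition F2 (i : chart A) : 'rV[R]_(n + n) -> R :=
  local_expr (A := SA) i (fun w => L w ^+ 2).

Definition slit_dom (i : chart A) := crdS i @` dom (a := SA) i.

Lemma slit_domI i u : dom i (base u) -> slit_dom i (crdS i u).
Proof. by exists u. Qed.

Lemma smooth_F2 i : smooth_on (slit_dom i) (F2 i).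
Proof.
have [sL _ _ _] := hL; have : smooth SA (fun w => L w * L w) by exact: (smoothM G).
have -> : (fun w => L w * L w) = (fun w => L w ^+ 2) by apply: funext => w; rewrite expr2.
by move=> s; exact: s.
Qed.

Lemma scale_point u (c : R) : 0 < c ->
  exists w, [/\ base w = base u, dir w = c *: dir u
    & forall i, dom i (base u) -> dir w i = c *: dir u i].
Proof.
move=> c0; have [/(_ (base u)) cu _ _ _] := G; set i := chart_at A (base u) in cu *.
have d0 : c *: dir u i <> 0.
  move=> /eqP; rewrite scaler_eq0 gt_eqF //= => /eqP; exact: dir_chart_neq0.
have [w bw dw] := slit_exists G cu d0.
have tw : tangent (base u) (dir w) by rewrite -bw; exact: dir_tangent.
have tcu : tangent (base u) (c *: dir u) by apply: (tangentZ G); exact: dir_tangent.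
have E : dir w = c *: dir u by exact: (tangent_inj cu tw tcu).
by exists w; split=> // j _; rewrite E.
Qed.

(** The derivative at [t = 0] of [F2 (x, (1 + t) y) = (1 + t)^2 F2 (x, y)]. *)
Lemma euler_F2 i z : slit_dom i z -> 'D_(vv (rsub z)) (F2 i) z = 2 * F2 i z.
Proof.
move=> Uz; have [u iu' uz] := Uz; have iu : dom (a := A) i (base u) by exact: iu'.
set v := vv (rsub z).
have E (t : R) : -1 < t -> F2 i (z + t *: v) = (1 + t) ^+ 2 * F2 i z.
  move=> t1; have c0 : 0 < 1 + t by rewrite -ltrBlDl sub0r.
  have [w [bw dw dwi]] := scale_point u c0.
  have iw : dom i (base w) by rewrite bw.
  have zw : z + t *: v = crdS i w.
    have H (x y : 'rV[R]_n) : row_mx x y + t *: vv y = row_mx x ((1 + t) *: y).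
      by rewrite /vv scale_row_mx add_row_mx scaler0 addr0 scalerDl scale1r.
    have yz : rsub z = dir u i by rewrite -uz /rsub /= row_mxKr.
    by rewrite /v yz -uz /= bw dwi // H.
  rewrite zw /F2 -uz !(local_exprE SG) //.
  have [_ _ H _] := hL; rewrite (H u w _ c0 bw dw) expr1 exprMn //.
have df : differentiable (F2 i) (z + 0 *: v).
  by rewrite scale0r addr0; exact: smooth_diff (smooth_F2 i) Uz.
have D1 := derive_line df; rewrite scale0r addr0 in D1.
have N : \forall t \near (0 : R), (1 + t) ^+ 2 * F2 i z = F2 i (z + t *: v).
  near=> t; rewrite E //; near: t; exact: lt_nbhsr (ltrN10 R).
have D2 : is_derive (0 : R) 1 (fun t => (1 + t) ^+ 2 * F2 i z) (2 * F2 i z).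
  have h : is_derive (0 : R) 1 (fun t : R => 1 + t) 1.
    have -> : (fun t : R => 1 + t) = cst 1 + id by [].
    by apply: is_derive_eq; exact: add0r.
  have h2 : is_derive (0 : R) 1 (fun t : R => (1 + t) * (1 + t)) 2.
    have -> : (fun t : R => (1 + t) * (1 + t)) = (fun t : R => 1 + t) * (fun t => 1 + t) by [].
    by apply: is_derive_eq; rewrite addr0 scale1r.
  have -> : (fun t => (1 + t) ^+ 2 * F2 i z) =
     (fun t : R => (1 + t) * (1 + t)) * (fun=> F2 i z).
    by apply: funext => t; rewrite expr2.
  have h3 : is_derive (0 : R) 1 (fun _ : R => F2 i z) 0 by exact: is_derive_cst.
  apply: is_derive_eq; rewrite scaler0 add0r /GRing.scale /=; exact: mulrC.
have D3 := near_eq_is_derive N D2.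
by have [_ <-] := D3; have [_ ->] := D1.
Unshelve. all: by end_near. Qed.

Lemma derive_v_change i j w b : dom i (base w) -> dom j (base w) ->
  'D_(vv b) (F2 i) (crdS i w) =
  'D_(vv ('D_b (trans i j) (crd i (base w)))) (F2 j) (crdS j w).
Proof.
move=> iw jw.
have dF : diff_at (A := SA) j (fun w => L w ^+ 2) w.
  exact: smooth_diff (smooth_F2 j) (slit_domI jw).
apply: etrans (derive_change SG (vv b) iw jw dF) _.
apply: (congr1 (fun v => 'D_v (F2 j) (crdS j w))).
apply: etrans (derive_slit_trans G (vv b) iw jw) _.
by rewrite lsubV rsubV !derive0 add0r.
Qed.

(** The vertical Hessian is tensorial because the transition maps are linear in the
vertical direction. *)
Lemma gz_change i j u a b : dom i (base u) -> dom j (base u) ->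
  gz (F2 i) (crdS i u) a b =
  gz (F2 j) (crdS j u) ('D_a (trans i j) (crd i (base u)))
     ('D_b (trans i j) (crd i (base u))).
Proof.
move=> iu ju; rewrite /gz; apply: (congr1 (fun t => 2^-1 * t)).
set z := crdS i u; have [_ _ o st] := G.
have lz : lsub z = crd i (base u) by rewrite /lsub /z /= row_mxKl.
pose p y := 'D_b (trans i j) (lsub y).
pose Tr := local_expr (A := SA) i (crdS j).
have sD := smooth_diff (smooth_F2 j).
have W : (crd i @` (dom i `&` dom j)) (crd i (base u)) by exists (base u).
have dp0 : differentiable ('D_b (trans i j)) (lsub z).
  by rewrite lz; exact: smooth_diff (smooth_derive b (st i j)) W.
have dlz : differentiable (@lsub R n) z by exact: rV_linear_diff.
have dp : differentiable p z by exact: (differentiable_comp dlz dp0).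
have Dp : 'D_(vv a) p z = 0.
  apply: etrans (derive_comp (vv a) dlz dp0) _.
  have -> : 'D_(vv a) (@lsub R n) z = 0.
    exact: etrans (rV_derive_lin _ _ _) (lsubV a).
  exact: derive0.
pose B y q := 'D_(vv q) (F2 j) (Tr y).
pose O := crdS i @` (dom (a := SA) i `&` dom (a := SA) j).
have oO : open O by have [_ _ + _] := SG; exact.
have Oz : O z by exists u.
have TO y : O y -> slit_dom j (Tr y).
  by move=> [w [iw jw] <-]; rewrite /Tr (local_exprE SG) //; exact: slit_domI.
have Bl y : O y -> linear (B y).
  move=> Oy; apply: (vv_lin (f := fun v => 'D_v (F2 j) (Tr y))).
  by apply: derive_linear; apply: sD; exact: TO.
have dT : differentiable Tr z by exact: (trans_diff SG).
have Tz : Tr z = crdS j u by rewrite /Tr (local_exprE SG).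
have dDF q : differentiable ('D_(vv q) (F2 j)) (Tr z).
  by apply: smooth_diff (smooth_derive (vv q) (smooth_F2 j)) _; exact: TO.
have Bd q : differentiable (B^~ q) z by exact: (differentiable_comp dT (dDF q)).
have E : \near z, B z (p z) = 'D_(vv b) (F2 i) z.
  apply: near_open oO Oz _ => y [w [iw jw] <-].
  apply: etrans _ (esym (derive_v_change b iw jw)).
  have e1 : Tr (crdS i w) = crdS j w by exact: (local_exprE SG).
  have e2 : p (crdS i w) = 'D_b (trans i j) (crd i (base w)).
    apply: (congr1 ('D_b (trans i j))); exact: row_mxKl.
  exact: (f_equal2 (fun t y => 'D_(vv t) (F2 j) y) e2 e1).
apply: etrans (esym (near_eq_derive (vv a) E)) _.
apply: etrans (derive_frozen oO Oz Bl Bd (vv a) dp) _.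
rewrite Dp (lin_0 (Bl z Oz)) addr0.
apply: etrans (derive_comp (vv a) dT (dDF (p z))) _.
have DT : 'D_(vv a) Tr z = vv ('D_a (trans i j) (crd i (base u))).
  apply: etrans (derive_slit_trans G (vv a) iu ju) _.
  by rewrite lsubV rsubV !derive0 add0r.
have pz : p z = 'D_b (trans i j) (crd i (base u)) by rewrite /p lz.
exact: (etrans (congr1 (fun t => 'D_t ('D_(vv (p z)) (F2 j)) (Tr z)) DT)
  (f_equal2 (fun t y => 'D_(vv ('D_a (trans i j) (crd i (base u)))) ('D_(vv t) (F2 j)) y) pz Tz)).
Qed.

Lemma metricE i u (v w : tvec A) : dom i (base u) -> tangent (base u) v ->
  tangent (base u) w -> metric L u v w = gz (F2 i) (crdS i u) (v i) (w i).
Proof.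
move=> iu tv tw; have [/(_ (base u)) cu _ _ _] := G; set c := chart_at A (base u) in cu *.
have Uc := slit_domI cu.
have E : metric L u v w = gz (F2 c) (crdS c u) (v c) (w c).
  pose B1 y a := gz (F2 c) y a (w c).
  have l1 y : slit_dom c y -> linear (B1 y).
    by move=> Uy; exact (gz_linl (smooth_F2 c) (w c) Uy).
  apply: etrans _ (esym (linear_expand l1 (v c) Uc)).
  rewrite /metric; apply: eq_bigr => a _.
  pose B2 y b := gz (F2 c) y (delta_mx 0 a) b.
  have l2 y : slit_dom c y -> linear (B2 y).
    by move=> Uy; exact (gz_linr (slit_dom_open G (i := c)) (smooth_F2 c) (delta_mx 0 a) Uy).
  apply: etrans _ (esym (congr1 (fun t => v c 0 a * t) (linear_expand l2 (w c) Uc))).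
  rewrite mulr_sumr; apply: eq_bigr => b _.
  have H (x y t : R) : x * y * t = y * (t * x) by ring.
  exact: H.
apply: etrans E _; apply: etrans (gz_change (v c) (w c) cu iu) _.
exact: (f_equal2 (gz (F2 i) (crdS i u)) (esym (tv.2 c i cu iu))
  (esym (tw.2 c i cu iu))).
Qed.

Lemma gmE i u X Y : dom i (base u) -> pfield X -> pfield Y ->
  gm L X Y u = gz (F2 i) (crdS i u) (X u i) (Y u i).
Proof. by move=> iu [tX _] [tY _]; exact: metricE. Qed.

Lemma smooth_gm X Y : pfield X -> pfield Y -> smooth SA (gm L X Y).
Proof.
move=> pX pY i k.
pose Xh := local_expr (A := SA) i (fun w => X w i).
pose Yh := local_expr (A := SA) i (fun w => Y w i).
apply: (smooth_on_local G (f := fun z => gz (F2 i) z (Xh z) (Yh z))).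
  by move=> u iu; rewrite (gmE iu pX pY) /Xh /Yh !(local_exprE SG).
have s := smooth_F2 i.
exact: (smooth_bil (slit_dom_open G (i := i)) (gz_linl s) (gz_linr (slit_dom_open G (i := i)) s)
  (smooth_gz (slit_dom_open G (i := i)) s) (pX.2 i) (pY.2 i)).
Qed.

Lemma gz_pos i z a : slit_dom i z -> a <> 0 -> 0 < gz (F2 i) z a a.
Proof.
move=> [u iu' <-] a0; have iu : dom (a := A) i (base u) by exact: iu'.
have ta : tangent (base u) (push i (base u) a) by exact: (push_tangent G).
have [_ _ _ pos] := hL.
have := pos u _ ta; rewrite (metricE iu ta ta) (push_refl G) //; apply.
by move=> /(congr1 (fun v : tvec A => v i)); rewrite (push_refl G).
Qed.

End Metric.

(** * Lie brackets and torsion in charts *)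

Section Lie.
Context {R : realType} {n : nat} {T : Type} (A : atlas R n T).
Hypothesis G : good_atlas A.

(** The second derivatives of the transition map cancel in the bracket by their
symmetry. *)
Lemma lie_tangent (V W : T -> tvec A) p : vfield V -> vfield W -> tangent p (lie V W p).
Proof.
move=> vV vW; have [_ _ o st] := G.
split=> [i nip|i j ip jp]; first by rewrite /lie asboolF.
rewrite (lieE _ _ ip) (lieE _ _ jp).
set x := crd i p.
pose O := crd i @` (dom i `&` dom j); have oO : open O by exact: o.
have Ox : O x by exists p.
have sO : O `<=` crd i @` dom i by move=> _ [q [iq _] <-]; exists q.
pose tr := local_expr i (crd j).
have str : smooth_on O tr by exact: st.
have dtr : differentiable tr x by exact: smooth_diff str Ox.
have key (X Y : T -> tvec A) : vfield X -> vfield Y ->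
  'D_(X p j) (local_expr j (fun q => Y q j)) (crd j p) =
  'D_(X p i) ('D_(Y p i) tr) x + 'D_('D_(X p i) (local_expr i (fun q => Y q i)) x) tr x.
  move=> vX vY.
  have dY : diff_at j (fun q => Y q j) p by exact: vfield_diff.
  have dYi : differentiable (local_expr i (fun q => Y q i)) x by exact: (vfield_diff vY ip).
  apply: etrans (congr1 (fun t => 'D_t _ _) ((vX.1 p).2 i j ip jp)) _.
  apply: etrans (esym (derive_change G (X p i) ip jp dY)) _.
  have E : \near x, 'D_(local_expr i (fun q => Y q i) x) tr x = local_expr i (fun q => Y q j) x.
    apply: near_open oO Ox _ => _ [q [iq jq] <-].
    rewrite (local_exprE G) // (local_exprE G) //.
    exact: (esym ((vY.1 q).2 i j iq jq)).
  apply: etrans (esym (near_eq_derive (X p i) E)) _.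
  apply: etrans (derive_along (X p i) oO str Ox dYi) _.
  by rewrite (local_exprE G).
apply: etrans (f_equal2 (fun a b => a - b) (key V W vV vW) (key W V vW vV)) _.
have S := schwarz_rV (W p i) (V p i) oO (str 2%N) Ox.
have H (x1 x2 z1 z2 : 'rV[R]_n) : x1 = x2 -> x1 + z1 - (x2 + z2) = z1 - z2.
  by move=> ->; rewrite opprD addrACA subrr add0r.
apply: etrans (H _ _ _ _ S) _; apply/esym.
apply: etrans (deriveDv _ _ dtr) _.
by apply: (congr1 (fun t => _ + t)); exact: (deriveNv _ dtr).
Qed.

Lemma vfield_lie (V W : T -> tvec A) : vfield V -> vfield W -> vfield (lie V W).
Proof.
move=> vV vW; split=> [p|i]; first exact: lie_tangent.
have oi : open (crd i @` dom i) by exact: (good_open G).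
have key (X Y : T -> tvec A) : vfield X -> vfield Y -> smooth_on (crd i @` dom i)
  (fun x => 'D_(local_expr i (fun q => X q i) x) (local_expr i (fun q => Y q i)) x).
  by move=> [_ sX] [_ sY]; apply: smooth_deriveV.
move=> k; apply: (Ck_cong oi) (CkB oi (key V W vV vW k) (key W V vW vV k)) => _ [p ip <-].
by rewrite !(local_exprE G) // lieE.
Qed.

End Lie.

Section Torsion.
Context {R : realType} {n : nat} {M : topologicalType} (A : atlas R n M).
Hypothesis hM : smooth_manifold A.
Local Notation SA := (slit_atlas A).
Local Notation crdS := (crd (a := slit_atlas A)).
Implicit Types (u : slit A) (i j : chart A).

Let G : good_atlas A := manifold_good hM.
Let SG : good_atlas SA := slit_good G.

Definition hat (i : chart A) (X : slit A -> tvec A) : 'rV[R]_(n + n) -> 'rV[R]_n :=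
  local_expr (A := SA) i (fun w => X w i).
Definition hatv (i : chart A) (X : slit A -> tvec SA) : 'rV[R]_(n + n) -> 'rV[R]_(n + n) :=
  local_expr (A := SA) i (fun w => X w i).

Lemma hatE i X u : dom i (base u) -> hat i X (crdS i u) = X u i.
Proof. by move=> iu; rewrite /hat (local_exprE SG). Qed.

Lemma hatvE i X u : dom i (base u) -> hatv i X (crdS i u) = X u i.
Proof. by move=> iu; rewrite /hatv (local_exprE SG). Qed.

Lemma diff_hat i X u : dom i (base u) -> pfield X -> differentiable (hat i X) (crdS i u).
Proof. by move=> iu pX; exact: (pfield_diff pX iu). Qed.

Lemma diff_hatv i X u : dom i (base u) -> vfield (A := SA) X ->
  differentiable (hatv i X) (crdS i u).
Proof. by move=> iu vX; exact: (vfield_diff (A := SA) vX iu). Qed.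

Lemma near_slit i u (P : 'rV[R]_(n + n) -> Prop) : dom i (base u) ->
  (forall w, dom i (base w) -> P (crdS i w)) ->
  \forall z \near crdS i u, P z.
Proof. by move=> iu H; apply: (near_chart1 SG). Qed.

Lemma pfield_rho (V : slit A -> tvec SA) : vfield (A := SA) V -> pfield (rho_f V).
Proof.
move=> [tV sV]; split=> [u|i k]; first exact: (rho_tangent G).
apply: (smooth_on_local G (f := fun z => lsub (hatv i V z))).
  by move=> u iu; rewrite hatvE // /rho_f (rhoE G (tV u) iu).
by apply: (Ck_lin (slit_dom_open G (i := i)) _ (sV i k)); exact: rV_linear_continuous.
Qed.

Lemma derive_hat_rho i V u v : dom i (base u) -> vfield (A := SA) V ->
  'D_v (hat i (rho_f V)) (crdS i u) = lsub ('D_v (hatv i V) (crdS i u)).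
Proof.
move=> iu vV.
have E : \forall z \near crdS i u, lsub (hatv i V z) = hat i (rho_f V) z.
  apply: near_slit => // w iw; rewrite hatvE // hatE // /rho_f.
  by rewrite (rhoE G (vV.1 w) iw).
apply: etrans (esym (near_eq_derive v E)) _.
apply: (derive_lin (l := @lsub R n)); first exact: rV_linear_continuous.
exact: diff_hatv.
Qed.

Lemma torsion_tangent (D : connection A) V W u : is_connection D ->
  vfield (A := SA) V -> vfield (A := SA) W -> tangent (base u) (torsion D V W u).
Proof.
move=> [_ _ _ _ tD] vV vW; rewrite /torsion.
have t1 := tD u _ _ (vV.1 u) (pfield_rho vW).
have t2 := tD u _ _ (vW.1 u) (pfield_rho vV).
have t3 := rho_tangent G (lie_tangent SG u vV vW).
exact: (tangentD G (tangentD G t1 (tangentN G t2)) (tangentN G t3)).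
Qed.

Lemma curvature_tangent (D : connection A) V W Z u : is_connection D ->
  vfield (A := SA) V -> vfield (A := SA) W -> pfield Z ->
  tangent (base u) (curvature D V W Z u).
Proof.
move=> [cD _ _ _ _] vV vW pZ.
have t1 := (cD _ _ vV (cD _ _ vW pZ)).1 u.
have t2 := (cD _ _ vW (cD _ _ vV pZ)).1 u.
have t3 := (cD _ _ (vfield_lie SG vV vW) pZ).1 u.
exact: (tangentD G (tangentD G (tangentN G t1) t2) t3).
Qed.

(** The derivatives of the components of [V] and [W] cancel against the bracket; the
torsion is algebraic in the connection form. *)
Lemma torsion_chart (D : connection A) i U om V W u : is_connection D ->
  local_form i U D om -> dom i (base u) -> U (crdS i u) ->
  vfield (A := SA) V -> vfield (A := SA) W ->
  torsion D V W u i = om (crdS i u) (V u i) (lsub (W u i))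
                    - om (crdS i u) (W u i) (lsub (V u i)).
Proof.
move=> hD [_ _ _ F] iu Uu vV vW.
set z := crdS i u.
have c1 : cov D V (rho_f W) u i = lsub ('D_(V u i) (hatv i W) z) + om z (V u i) (lsub (W u i)).
  apply: etrans (F u _ _ iu Uu (vV.1 u) (pfield_rho vW)) _.
  apply: (f_equal2 +%R); first exact: derive_hat_rho.
  by apply: (congr1 (om z (V u i))); exact: (rhoE G (vW.1 u) iu).
have c2 : cov D W (rho_f V) u i = lsub ('D_(W u i) (hatv i V) z) + om z (W u i) (lsub (V u i)).
  apply: etrans (F u _ _ iu Uu (vW.1 u) (pfield_rho vV)) _.
  apply: (f_equal2 +%R); first exact: derive_hat_rho.
  by apply: (congr1 (om z (W u i))); exact: (rhoE G (vV.1 u) iu).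
have c3 : rho u (lie V W u) i = lsub ('D_(V u i) (hatv i W) z) - lsub ('D_(W u i) (hatv i V) z).
  apply: etrans (rhoE G (lie_tangent SG u vV vW) iu) _.
  apply: etrans (congr1 (@lsub R n) (lieE (A := SA) V W iu)) _.
  exact: (lin_B (@lsub_is_linear R n)).
have E : torsion D V W u i =
  cov D V (rho_f W) u i - cov D W (rho_f V) u i - rho u (lie V W u) i by [].
rewrite E c1 c2 c3.
have H (x y a b : 'rV[R]_n) : x + a - (y + b) - (x - y) = a - b.
  by apply/rowP => j; rewrite !mxE; ring.
exact: H.
Qed.

End Torsion.

(** * The Berwald and Cartan connections in a chart *)


Section Geometry.
Context {R : realType} {n : nat} {M : topologicalType} (A : atlas R n M).
Hypothesis hM : smooth_manifold A.
Local Notation SA := (slit_atlas A).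
Local Notation crdS := (crd (a := slit_atlas A)).
Implicit Types (u : slit A) (i j : chart A).

Let G : good_atlas A := manifold_good hM.
Let SG : good_atlas SA := slit_good G.

Variable L : slit A -> R.
Hypothesis hL : finsler L.

(** An open set over which every constant vector of components extends to a global
smooth field; it allows pointwise identities between tensors to be tested on
constant components. *)
Definition chart_patch i (U : set 'rV[R]_(n + n)) :=
  [/\ open U, U `<=` slit_dom i,
      forall v, exists2 V, vfield (A := SA) V &
         forall u, dom i (base u) -> U (crdS i u) -> V u i = v
    & forall c, exists2 X, pfield (A := A) X &
         forall u, dom i (base u) -> U (crdS i u) -> X u i = c].

Lemma patch_exists i u : dom i (base u) ->
  exists U, [/\ chart_patch i U, U (crdS i u)
    & forall D : connection A, is_connection D -> exists om, local_form i U D om].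
Proof.
move=> iu; have [U [[oU Uu sU] tV tX D]] := connection_local hM iu.
by exists U; split=> //; exact: Uu.
Qed.

Lemma patch_point i U z : chart_patch i U -> U z ->
  exists u, [/\ dom i (base u), U (crdS i u) & crdS i u = z].
Proof.
by move=> [_ sU _ _] Uz; have [u iu uz] := sU _ Uz; exists u; split => //; rewrite uz.
Qed.

Lemma sub_smooth_F2 i U : chart_patch i U -> smooth_on U (F2 L i).
Proof. by move=> [_ sU _ _] k; exact: CkS sU (smooth_F2 G hL i k). Qed.

Lemma sub_euler i U : chart_patch i U ->
  forall z, U z -> 'D_(vv (rsub z)) (F2 L i) z = 2 * F2 L i z.
Proof. by move=> [_ sU _ _] z /sU Uz; exact: (euler_F2 G hL). Qed.

Lemma sub_pos i U : chart_patch i U ->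
  forall z a, U z -> a <> 0 -> 0 < gz (F2 L i) z a a.
Proof. by move=> [_ sU _ _] z a /sU Uz; exact: (gz_pos G hL). Qed.

Section Berwald.
Variable Do : connection A.
Hypothesis hB : is_berwald L Do.

Let hD : is_connection Do. Proof. by have [] := hB. Qed.
Let hR : regular Do. Proof. by have [] := hB. Qed.

Section Local.
Variables (i : chart A) (U : set 'rV[R]_(n + n)).
Variable (om : 'rV[R]_(n + n) -> 'rV[R]_(n + n) -> 'rV[R]_n -> 'rV[R]_n).
Hypothesis hU : chart_patch i U.
Hypothesis hom : local_form i U Do om.

Let oU : open U. Proof. by have [] := hU. Qed.
Let sU : U `<=` slit_dom i. Proof. by have [] := hU. Qed.
Let om1 : forall z c, U z -> linear (fun v => om z v c). Proof. by have [] := hom. Qed.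
Let om2 : forall z v, U z -> linear (om z v). Proof. by have [] := hom. Qed.

(** The horizontal part of the connection form. *)
Definition Gam z a c := om z (hh a) c.

(** The torsion vanishes on all pairs of vector fields; taking one of them vertical
shows next that the connection form has no vertical part. *)
Lemma om_sym z v w : U z -> om z v (lsub w) = om z w (lsub v).
Proof.
move=> Uz; have [u [iu Uu uz]] := patch_point hU Uz.
have [_ _ tV _] := hU; have [V vV Vi] := tV v; have [W vW Wi] := tV w.
have [_ _ T0 _ _] := hB.
have := torsion_chart hM hD hom iu Uu vV vW.
rewrite (T0 V W vV vW u) (Vi u iu Uu) (Wi u iu Uu) uz => H.
by apply/esym/subr0_eq; rewrite -opprB -H oppr0.
Qed.

Lemma om_Gam z v c : U z -> om z v c = Gam z (lsub v) c.
Proof.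
move=> Uz; have H : om z (vv (rsub v)) c = 0.
  apply: etrans (congr1 (om z _) (esym (lsubH c))) _.
  apply: etrans (om_sym _ _ Uz) _.
  exact: etrans (congr1 (om z _) (lsubV _)) (lin_0 (om2 _ Uz)).
apply: etrans (congr1 (fun t => om z t c) (hvsubK v)) _.
apply: etrans (lin_D (om1 c Uz) _ _) _.
by rewrite H addr0.
Qed.

Lemma Gam_sym z a c : U z -> Gam z a c = Gam z c a.
Proof.
move=> Uz.
exact: etrans (congr1 (om z (hh a)) (esym (lsubH c)))
  (etrans (om_sym (hh a) (hh c) Uz) (congr1 (om z (hh c)) (lsubH a))).
Qed.

Lemma Gam_linl z c : U z -> linear (fun a => Gam z a c).
Proof. by move=> Uz; exact: (hh_lin (om1 c Uz)). Qed.
Lemma Gam_linr z a : U z -> linear (Gam z a). Proof. exact: om2. Qed.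
Lemma smooth_Gam a c : smooth_on U (fun z => Gam z a c).
Proof. by have [_ _ s _] := hom; exact: s. Qed.

Lemma berwald_fund u (v : tvec SA) : dom i (base u) -> U (crdS i u) -> tangent u v ->
  Do u v (@fund R n M A) i = rsub (v i) + Nl Gam (crdS i u) (lsub (v i)).
Proof.
by move=> iu Uu tv; apply: etrans (conn_fund hM hom iu Uu tv) _; rewrite om_Gam.
Qed.

Lemma berwald_beta u w : dom i (base u) -> U (crdS i u) -> tangent (base u) w ->
  beta Do u w i = bet Gam (crdS i u) (w i).
Proof.
move=> iu Uu tw; apply: etrans (beta_chart hM hD hR sU hom iu Uu tw) _.
rewrite /bet; congr (_ - vv _).
have E := NnE hM hD hR sU hom (w i) Uu; set N := Nn om _ _ in E *.
have H : om (crdS i u) (vv N) (rsub (crdS i u)) = 0.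
  apply: etrans (om_Gam _ _ Uu) _.
  by rewrite lsubV (lin_0 (Gam_linl _ Uu)).
by rewrite H addr0 in E.
Qed.

(** The condition on [L] is squared, because the calculus of the metric uses [L^2]. *)
Lemma berwald_L z a : U z -> 'D_(bet Gam z a) (F2 L i) z = 0.
Proof.
move=> Uz; have [u [iu Uu uz]] := patch_point hU Uz.
have [_ _ _ _ dL] := hB; have [sL _ _ _] := hL.
have tv := push_tangent SG (hh a) (iu : dom (a := SA) i u).
have dLi : diff_at (A := SA) i L u by exact: (smooth_diff_at sL iu).
have tr := rho_tangent G tv.
have ra : rho u (push (A := SA) i u (hh a)) i = a.
  by apply: etrans (rhoE G tv iu) _; apply: etrans (congr1 (@lsub R n) (push_refl SG _ _)) (lsubH a).
have [tb _ _] := betaP hM hR tr.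
have := dL u _ tv; rewrite (dirderE SG (i := i) iu tb dLi) (berwald_beta iu Uu tr) ra uz.
set Lh := local_expr _ L => L0.
have dLh : differentiable Lh z by rewrite -uz.
have E : \near z, Lh z *: Lh z = F2 L i z.
  rewrite -uz; apply: (near_slit hM iu) => w iw.
  by rewrite /Lh /F2 !(local_exprE SG) // expr2.
apply: etrans (esym (near_eq_derive _ E)) _.
apply: etrans (derive_scale _ dLh dLh) _.
by rewrite L0 scale0r scaler0 addr0.
Qed.

End Local.

Lemma berwald_gamma Y : pfield Y -> cov Do (gamma_f Y) (@fund R n M A) = Y.
Proof.
move=> pY; apply: funext => u; have [/(_ (base u)) iu _ _ _] := G.
have [U [hU Uu /(_ Do hD)[om hom]]] := patch_exists iu.
have tg := gamma_tangent G (pY.1 u).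
have [_ _ _ _ tD] := hD.
apply: (tangent_inj iu (tD _ _ _ tg (pfield_fund G)) (pY.1 u)).
apply: etrans (berwald_fund hU hom iu Uu tg) _.
have gi : gamma (Y u) (chart_at A (base u)) = vv (Y u (chart_at A (base u))) by [].
by rewrite gi rsubV lsubV /Nl (lin_0 (Gam_linl hom _ Uu)) addr0.
Qed.

End Berwald.

Section Cartan.
Variable nabla : connection A.
Hypothesis hC : is_cartan L nabla.

Let hD : is_connection nabla. Proof. by have [] := hC. Qed.
Let hR : regular nabla. Proof. by have [] := hC. Qed.

Section Local.
Variables (i : chart A) (U : set 'rV[R]_(n + n)).
Variable (om : 'rV[R]_(n + n) -> 'rV[R]_(n + n) -> 'rV[R]_n -> 'rV[R]_n).
Hypothesis hU : chart_patch i U.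
Hypothesis hom : local_form i U nabla om.

Let oU : open U. Proof. by have [] := hU. Qed.
Let sU : U `<=` slit_dom i. Proof. by have [] := hU. Qed.
Let om1 : forall z c, U z -> linear (fun v => om z v c). Proof. by have [] := hom. Qed.
Let om2 : forall z v, U z -> linear (om z v). Proof. by have [] := hom. Qed.
Let sF := sub_smooth_F2 hU.
Let g := gz (F2 L i).
Let N' := Nn om.

Lemma cartan_metric z v a b : U z ->
  'D_v (fun y => g y a b) z = g z (om z v a) b + g z a (om z v b).
Proof.
move=> Uz; have [u [iu Uu uz]] := patch_point hU Uz.
have [_ _ _ tX] := hU; have [X pX Xi] := tX a; have [Y pY Yi] := tX b.
have [_ _ met _ _] := hC; have [_ _ _ _ tD] := hD; have [_ _ _ F] := hom.
have tv := push_tangent SG v (iu : dom (a := SA) i u).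
have vi : push (A := SA) i u v i = v by exact: (push_refl SG).
have dg : diff_at (A := SA) i (gm L X Y) u.
  exact: (smooth_diff_at (smooth_gm G hL pX pY) iu).
have := met u _ X Y tv pX pY.
rewrite (dirderE SG (i := i) iu tv dg) vi.
rewrite (metricE G hL iu (tD _ _ _ tv pX) (pY.1 u)) (metricE G hL iu (pX.1 u) (tD _ _ _ tv pY)).
rewrite (F u _ X iu Uu tv pX) (F u _ Y iu Uu tv pY) vi (Xi u iu Uu) (Yi u iu Uu) -/g.
have D0 (Z : slit A -> tvec A) c : (forall u, dom i (base u) -> U (crdS i u) -> Z u i = c) ->
   'D_v (hat i Z) (crdS i u) = 0.
  move=> Zi; rewrite -(derive_cst c (crdS i u) v); apply: near_eq_derive.
  apply: near_open oU Uu _ => y Uy; have [w [iw Uw <-]] := patch_point hU Uy.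
  by rewrite (hatE hM) // Zi.
rewrite -/(hat i X) -/(hat i Y) (D0 X a Xi) (D0 Y b Yi) !add0r uz => <-.
apply: near_eq_derive; apply: near_open oU Uz _ => y Uy.
have [w [iw Uw <-]] := patch_point hU Uy.
apply/esym; apply: etrans (local_exprE SG _ (iw : dom (a := SA) i w)) _.
apply: etrans (gmE G hL iw pX pY) _.
exact: (f_equal2 (g _) (Xi w iw Uw) (Yi w iw Uw)).
Qed.

Lemma cartan_beta u w : dom i (base u) -> U (crdS i u) -> tangent (base u) w ->
  beta nabla u w i = bet' N' (crdS i u) (w i).
Proof. by move=> iu Uu tw; exact: (beta_chart hM hD hR sU hom iu Uu tw). Qed.

Lemma lsub_bet' z a : lsub (bet' N' z a) = a.
Proof. by apply: etrans (lin_B (@lsub_is_linear R n) _ _) _; rewrite lsubH lsubV subr0. Qed.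

Lemma cartan_NnE z a : U z -> N' z a + om z (vv (N' z a)) (rsub z) = om z (hh a) (rsub z).
Proof. exact: (NnE hM hD hR sU hom). Qed.

Lemma cartan_torsion z a c : U z -> om z (bet' N' z a) c = om z (bet' N' z c) a.
Proof.
move=> Uz; have [u [iu Uu uz]] := patch_point hU Uz.
have [_ _ _ tX] := hU; have [X pX Xi] := tX a; have [Y pY Yi] := tX c.
have [_ _ _ T0 _] := hC.
have := torsion_chart hM hD hom iu Uu (vfield_beta hM hD hR pX) (vfield_beta hM hD hR pY).
rewrite (T0 X Y pX pY u) /beta_f (cartan_beta iu Uu (pX.1 u)) (cartan_beta iu Uu (pY.1 u)).
rewrite !lsub_bet' (Xi u iu Uu) (Yi u iu Uu) uz => H.
by apply/esym/subr0_eq; rewrite -opprB -H oppr0.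
Qed.

Lemma mixed_chart X Y u : dom i (base u) -> U (crdS i u) -> pfield X -> pfield Y ->
  mixed_torsion nabla X Y u i = om (crdS i u) (vv (X u i)) (Y u i).
Proof.
move=> iu Uu pX pY.
apply: etrans (torsion_chart hM hD hom iu Uu (vfield_gamma G pX) (vfield_beta hM hD hR pY)) _.
have gi : gamma_f X u i = vv (X u i) by [].
rewrite gi /beta_f (cartan_beta iu Uu (pY.1 u)) lsub_bet' lsubV.
by rewrite (lin_0 (om2 _ Uu)) subr0.
Qed.

Lemma mixed_tangent X Y u : pfield X -> pfield Y -> tangent (base u) (mixed_torsion nabla X Y u).
Proof.
move=> pX pY; exact: (torsion_tangent hM u hD (vfield_gamma G pX) (vfield_beta hM hD hR pY)).
Qed.

Lemma gm_mixed X Y Z u : dom i (base u) -> U (crdS i u) ->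
  pfield X -> pfield Y -> pfield Z ->
  gm L (mixed_torsion nabla X Y) Z u =
  g (crdS i u) (om (crdS i u) (vv (X u i)) (Y u i)) (Z u i).
Proof.
move=> iu Uu pX pY pZ.
apply: etrans (metricE G hL iu (mixed_tangent u pX pY) (pZ.1 u)) _.
by rewrite (mixed_chart iu Uu pX pY).
Qed.

Lemma cartan_mixed z a b c : U z ->
  g z (om z (vv a) b) c = g z (om z (vv a) c) b.
Proof.
move=> Uz; have [u [iu Uu uz]] := patch_point hU Uz.
have [_ _ _ tX] := hU; have [X pX Xi] := tX a; have [Y pY Yi] := tX b; have [Z pZ Zi] := tX c.
have [_ _ _ _ H] := hC.
have e1 := gm_mixed iu Uu pX pY pZ; have e2 := gm_mixed iu Uu pX pZ pY.
rewrite uz (Xi u iu Uu) (Yi u iu Uu) (Zi u iu Uu) in e1.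
rewrite uz (Xi u iu Uu) (Yi u iu Uu) (Zi u iu Uu) in e2.
exact: etrans (esym e1) (etrans (H X Y Z pX pY pZ u) e2).
Qed.

(** The mixed torsion is half of the vertical derivative of the metric, which vanishes
on [y]. *)
Lemma cartan_y z b : U z -> om z (vv b) (rsub z) = 0.
Proof.
move=> Uz; apply: (gz_inj (sub_pos hU) Uz) => c.
apply: etrans (mixed_T3 oU sF cartan_metric cartan_mixed b (rsub z) c Uz) _.
by rewrite (T3_y oU sF (sub_euler hU) b c Uz) mulr0.
Qed.

Lemma cartan_fund u (v : tvec SA) : dom i (base u) -> U (crdS i u) -> tangent u v ->
  nabla u v (@fund R n M A) i = rsub (v i) + N' (crdS i u) (lsub (v i)).
Proof.
move=> iu Uu tv; apply: etrans (conn_fund hM hom iu Uu tv) _; congr (_ + _).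
have := cartan_NnE (lsub (v i)) Uu; rewrite cartan_y // addr0 => ->.
apply: etrans (congr1 (fun t => om _ t _) (hvsubK (v i))) _.
by apply: etrans (lin_D (om1 _ Uu) _ _) _; rewrite cartan_y // addr0.
Qed.

End Local.

Lemma cartan_gamma Y : pfield Y -> cov nabla (gamma_f Y) (@fund R n M A) = Y.
Proof.
move=> pY; apply: funext => u; have [/(_ (base u)) iu _ _ _] := G.
have [U [hU Uu /(_ nabla hD)[om hom]]] := patch_exists iu.
have tg := gamma_tangent G (pY.1 u).
have [_ _ _ _ tD] := hD.
apply: (tangent_inj iu (tD _ _ _ tg (pfield_fund G)) (pY.1 u)).
apply: etrans (cartan_fund hU hom iu Uu tg) _.
have gi : gamma (Y u) (chart_at A (base u)) = vv (Y u (chart_at A (base u))) by [].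
by rewrite gi rsubV lsubV (lin_0 (Nn_lin hom Uu)) addr0.
Qed.

End Cartan.
End Geometry.

(** * Curvatures in a chart *)

Section Curvatures.
Context {R : realType} {n : nat} {M : topologicalType} (A : atlas R n M).
Hypothesis hM : smooth_manifold A.
Local Notation SA := (slit_atlas A).
Local Notation crdS := (crd (a := slit_atlas A)).
Implicit Types (u : slit A).

Let G : good_atlas A := manifold_good hM.
Let SG : good_atlas SA := slit_good G.

Variables (i : chart A) (U : set 'rV[R]_(n + n)).
Hypothesis hU : chart_patch i U.
Let oU : open U. Proof. by have [] := hU. Qed.
Let sU : U `<=` slit_dom i. Proof. by have [] := hU. Qed.

Variable Gam : 'rV[R]_(n + n) -> 'rV[R]_n -> 'rV[R]_n -> 'rV[R]_n.
Hypothesis Gl : forall z c, U z -> linear (fun a => Gam z a c).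
Hypothesis Gr : forall z a, U z -> linear (Gam z a).
Hypothesis sG : forall a c, smooth_on U (fun z => Gam z a c).
Hypothesis Gs : forall z a c, U z -> Gam z a c = Gam z c a.

Local Notation bt := (bet Gam).
Local Notation N := (Nl Gam).

(** The vertical component relative to [bet], that is, [D_l eta]. *)
Let vert z (l : 'rV[R]_(n + n)) : 'rV[R]_n := rsub l + N z (lsub l).

Lemma N_lin z : U z -> linear (N z). Proof. by move=> Uz; exact: Gl. Qed.

Lemma vert_lin z : U z -> linear (vert z).
Proof.
move=> Uz k a b; rewrite /vert (rsub_is_linear k a b) (lsub_is_linear k a b).
by rewrite (N_lin Uz) scalerDr addrACA.
Qed.

Lemma lsubN (a : 'rV[R]_(n + n)) : lsub (- a) = - lsub a.
Proof. exact: (lin_N (@lsub_is_linear R n)). Qed.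

Lemma vert_bet z a : U z -> vert z (bt z a) = 0.
Proof.
move=> Uz; rewrite /vert /bet (lin_B (@rsub_is_linear R n)) (lin_B (@lsub_is_linear R n)).
by rewrite rsubH rsubV lsubH lsubV sub0r subr0 addNr.
Qed.

Lemma vert_vv z a : U z -> vert z (vv a) = a.
Proof. by move=> Uz; rewrite /vert rsubV lsubV (lin_0 (N_lin Uz)) addr0. Qed.

Section Connection.
Variables (D : connection A) (om : 'rV[R]_(n + n) -> 'rV[R]_(n + n) -> 'rV[R]_n -> 'rV[R]_n).
Hypotheses (hD : is_connection D) (hR : regular D) (hom : local_form i U D om).
Hypothesis hbeta : forall u w, dom i (base u) -> U (crdS i u) -> tangent (base u) w ->
  beta D u w i = bt (crdS i u) (w i).
Hypothesis hfund : forall u (v : tvec SA), dom i (base u) -> U (crdS i u) -> tangent u v ->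
  D u v (@fund R n M A) i = vert (crdS i u) (v i).
Hypothesis hgam : forall Y, pfield Y -> cov D (gamma_f Y) (@fund R n M A) = Y.

Lemma derive_hat_beta u Y v : dom i (base u) -> U (crdS i u) -> pfield Y ->
  'D_v (hatv i (beta_f D Y)) (crdS i u) =
  'D_v (fun z => bt z (Y u i)) (crdS i u)
  + bt (crdS i u) ('D_v (hat i Y) (crdS i u)).
Proof.
move=> iu Uu pY; have dY := diff_hat iu pY.
have E : \forall z \near crdS i u, bt z (hat i Y z) = hatv i (beta_f D Y) z.
  apply: near_open oU Uu _ => y Uy; have [w [iw Uw <-]] := patch_point hU Uy.
  apply/esym; apply: etrans (hatvE hM _ iw) _.
  apply: etrans (hbeta iw Uw (pY.1 w)) _.
  exact: (congr1 (bt _) (esym (hatE hM Y iw))).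
have Bl z : U z -> linear (bt z) by move=> Uz; exact: (bet_lin Gl).
have Bd c : differentiable (bt^~ c) (crdS i u).
  exact: (diff_bet oU Gl Gr sG c Uu).
apply: etrans (esym (near_eq_derive v E)) _.
apply: etrans (derive_frozen oU Uu Bl Bd v dY) _.
by rewrite (hatE hM Y iu).
Qed.

Lemma vert_derive_beta u Y v : dom i (base u) -> U (crdS i u) -> pfield Y ->
  vert (crdS i u) ('D_v (hatv i (beta_f D Y)) (crdS i u))
  = - 'D_v (fun z => N z (Y u i)) (crdS i u).
Proof.
move=> iu Uu pY; rewrite (derive_hat_beta v iu Uu pY) (lin_D (vert_lin Uu)) vert_bet // addr0.
rewrite (derive_bet oU Gl Gr sG v (Y u i) Uu) (lin_N (vert_lin Uu)) vert_vv //.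
Qed.

Lemma lsub_derive_beta u Y v : dom i (base u) -> U (crdS i u) -> pfield Y ->
  lsub ('D_v (hatv i (beta_f D Y)) (crdS i u)) = 'D_v (hat i Y) (crdS i u).
Proof.
move=> iu Uu pY; rewrite (derive_hat_beta v iu Uu pY) (lin_D (@lsub_is_linear R n)).
rewrite (derive_bet oU Gl Gr sG v (Y u i) Uu) lsubN lsubV oppr0 add0r.
exact: lsub_bet.
Qed.

Lemma derive_hat_gamma u Y v : dom i (base u) -> pfield Y ->
  'D_v (hatv i (gamma_f Y)) (crdS i u) = vv ('D_v (hat i Y) (crdS i u)).
Proof.
move=> iu pY.
have E : \forall z \near crdS i u, vv (hat i Y z) = hatv i (gamma_f Y) z.
  apply: (near_slit hM iu) => w iw; apply/esym; apply: etrans (hatvE hM _ iw) _.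
  exact: (congr1 (@vv R n) (esym (hatE hM Y iw))).
apply: etrans (esym (near_eq_derive v E)) _.
apply: (derive_lin (l := @vv R n)); first exact: rV_linear_continuous.
exact: diff_hat.
Qed.

Lemma cov_0 V u : vfield (A := SA) V -> cov D V (fun=> 0) u = 0.
Proof. by move=> vV; exact: (conn0 G hD (vV.1 u)). Qed.

(** The fundamental section is horizontally parallel, so only the bracket term of the
curvature survives. *)
Lemma vh_lie X Y u : pfield X -> pfield Y ->
  vh_torsion D X Y u = cov D (lie (beta_f D X) (beta_f D Y)) (@fund R n M A) u.
Proof.
move=> pX pY; rewrite /vh_torsion /h_curv /curvature.
rewrite (cov_beta_fund hM hR pX) (cov_beta_fund hM hR pY).
rewrite (cov_0 u (vfield_beta hM hD hR pX)) (cov_0 u (vfield_beta hM hD hR pY)).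
by rewrite oppr0 !add0r.
Qed.

Lemma vh_chart X Y u : dom i (base u) -> U (crdS i u) -> pfield X -> pfield Y ->
  vh_torsion D X Y u i = Rc Gam (crdS i u) (X u i) (Y u i) (rsub (crdS i u)).
Proof.
move=> iu Uu pX pY; rewrite (vh_lie u pX pY).
have vX := vfield_beta hM hD hR pX; have vY := vfield_beta hM hD hR pY.
set z := crdS i u.
apply: etrans (hfund iu Uu (lie_tangent SG u vX vY)) _.
apply: etrans (congr1 (vert z) (lieE (A := SA) _ _ iu)) _.
have bX : beta_f D X u i = bt z (X u i) by exact: (hbeta iu Uu (pX.1 u)).
have bY : beta_f D Y u i = bt z (Y u i) by exact: (hbeta iu Uu (pY.1 u)).
rewrite bX bY (lin_B (vert_lin Uu)).
apply: etrans (f_equal2 (fun a b => a - b) (vert_derive_beta _ iu Uu pY)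
  (vert_derive_beta _ iu Uu pX)) _.
rewrite (derive_Nl oU Gl Gr sG _ (X u i) Uu) (derive_Nl oU Gl Gr sG _ (Y u i) Uu).
rewrite !(rsub_bet Gam) (lin_N (Gr _ Uu)) (lin_N (Gr _ Uu)) /Rc.
have H (d1 d2 g1 g2 : 'rV[R]_n) : - (d1 - g1) - - (d2 - g2) = - (d1 - d2 + g2 - g1).
  by apply/rowP => j; rewrite !mxE; ring.
exact: H.
Qed.

Lemma cov_chart V Z u : dom i (base u) -> U (crdS i u) -> vfield (A := SA) V -> pfield Z ->
  cov D V Z u i = 'D_(V u i) (hat i Z) (crdS i u) + om (crdS i u) (V u i) (Z u i).
Proof. by move=> iu Uu vV pZ; have [_ _ _ F] := hom; exact: (F u _ Z iu Uu (vV.1 u) pZ). Qed.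

(** Since [D_(gamma Y) eta = Y] and [eta] is horizontally parallel, the curvature on
[eta] reduces to a covariant derivative of [Y] and a bracket, and the derivatives
of the components of [Y] cancel. *)
Lemma vhv_chart X Y u : dom i (base u) -> U (crdS i u) -> pfield X -> pfield Y ->
  vhv_torsion D X Y u i = 'D_(vv (Y u i)) (fun z => N z (X u i)) (crdS i u)
    - om (crdS i u) (bt (crdS i u) (X u i)) (Y u i).
Proof.
move=> iu Uu pX pY.
have vX := vfield_beta hM hD hR pX; have vY := vfield_gamma G pY.
have -> : vhv_torsion D X Y u =
   - cov D (beta_f D X) Y u + cov D (lie (beta_f D X) (gamma_f Y)) (@fund R n M A) u.
  rewrite /vhv_torsion /hv_curv /curvature (cov_beta_fund hM hR pX) (hgam pY).
  by rewrite (cov_0 u vY) addr0.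
set z := crdS i u.
have bX : beta_f D X u i = bt z (X u i) by exact: (hbeta iu Uu (pX.1 u)).
have c1 := cov_chart iu Uu vX pY; rewrite bX in c1.
have c2 : cov D (lie (beta_f D X) (gamma_f Y)) (@fund R n M A) u i =
   'D_(bt z (X u i)) (hat i Y) z + 'D_(vv (Y u i)) (fun z => N z (X u i)) z.
  apply: etrans (hfund iu Uu (lie_tangent SG u vX vY)) _.
  apply: etrans (congr1 (vert z) (lieE (A := SA) _ _ iu)) _.
  rewrite bX (lin_B (vert_lin Uu)).
  apply: etrans (f_equal2 (fun a b => a - b) (congr1 (vert z) (derive_hat_gamma _ iu pY))
    (vert_derive_beta _ iu Uu pX)) _.
  by rewrite vert_vv // opprK.
have E (a b : tvec A) : (- a + b) i = - (a i) + b i by [].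
apply: etrans (E _ _) _; rewrite c1 c2.
have H (d g t : 'rV[R]_n) : - (d + g) + (d + t) = t - g.
  by apply/rowP => j; rewrite !mxE; ring.
exact: H.
Qed.

End Connection.

Section BerwaldCurvature.
Variables (D : connection A) (om : 'rV[R]_(n + n) -> 'rV[R]_(n + n) -> 'rV[R]_n -> 'rV[R]_n).
Hypotheses (hD : is_connection D) (hR : regular D) (hom : local_form i U D om).
Hypothesis hbeta : forall u w, dom i (base u) -> U (crdS i u) -> tangent (base u) w ->
  beta D u w i = bt (crdS i u) (w i).
Hypothesis omG : forall z v c, U z -> om z v c = Gam z (lsub v) c.

(** All the derivatives of the components of [X], [Y], [Z] cancel in the alternation,
the second ones by symmetry and the first ones against the bracket. *)
Lemma h_curv_chart X Y Z u : dom i (base u) -> U (crdS i u) ->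
  pfield X -> pfield Y -> pfield Z ->
  h_curv D X Y Z u i = Rc Gam (crdS i u) (X u i) (Y u i) (Z u i).
Proof.
move=> iu Uu pX pY pZ.
have vX := vfield_beta hM hD hR pX; have vY := vfield_beta hM hD hR pY.
set z := crdS i u.
have smZ : smooth_on U (hat i Z) by move=> k; exact: CkS sU (pZ.2 i k).
have bE W : pfield W -> beta_f D W u i = bt z (W u i).
  by move=> pW; exact: (hbeta iu Uu (pW.1 u)).
have second (V W : slit A -> tvec A) : pfield V -> pfield W ->
  cov D (beta_f D V) (cov D (beta_f D W) Z) u i =
    ('D_(bt z (V u i)) ('D_(bt z (W u i)) (hat i Z)) z
     + 'D_('D_(bt z (V u i)) (hatv i (beta_f D W)) z) (hat i Z) z)
    + ('D_(bt z (V u i)) (fun y => Gam y (W u i) (Z u i)) z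
       + Gam z ('D_(bt z (V u i)) (hat i W) z) (Z u i)
       + Gam z (W u i) ('D_(bt z (V u i)) (hat i Z) z))
    + Gam z (V u i) ('D_(bt z (W u i)) (hat i Z) z + Gam z (W u i) (Z u i)).
  move=> pV pW.
  have vV := vfield_beta hM hD hR pV; have vW := vfield_beta hM hD hR pW.
  have [cD _ _ _ _] := hD; have pC := cD _ _ vW pZ.
  have omB y c d : U y -> om y (bt y c) d = Gam y c d.
    by move=> Uy; rewrite omG // (_ : lsub (bet Gam y c) = c) //; exact: lsub_bet.
  have cWZ w : dom i (base w) -> U (crdS i w) -> cov D (beta_f D W) Z w i =
     'D_(hatv i (beta_f D W) (crdS i w)) (hat i Z) (crdS i w)
     + Gam (crdS i w) (hat i W (crdS i w)) (hat i Z (crdS i w)).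
    move=> iw Uw; apply: etrans (cov_chart hom iw Uw vW pZ) _.
    rewrite (hatvE hM _ iw) (hatE hM W iw) (hatE hM Z iw).
    rewrite /beta_f (hbeta iw Uw (pW.1 w)) omB //.
  apply: etrans (cov_chart hom iu Uu vV pC) _; rewrite (bE V pV) (omB _ _ _ Uu).
  have E : \near z, 'D_(hatv i (beta_f D W) z) (hat i Z) z + Gam z (hat i W z) (hat i Z z)
     = hat i (cov D (beta_f D W) Z) z.
    apply: near_open oU Uu _ => y Uy; have [w [iw Uw <-]] := patch_point hU Uy.
    by apply/esym; apply: etrans (hatE hM _ iw) (cWZ w iw Uw).
  have dW := diff_hatv iu vW; have dWh := diff_hat iu pW; have dZh := diff_hat iu pZ.
  have dG a c : differentiable (fun y => Gam y a c) z by exact: smooth_diff (sG a c) Uu.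
  pose B y q := 'D_q (hat i Z) y.
  have Bl y : U y -> linear (B y) by move=> Uy; apply: derive_linear; exact: smooth_diff smZ Uy.
  have Bd q : differentiable (B^~ q) z by exact: smooth_diff (smooth_derive q smZ) Uu.
  have d1 : differentiable (fun y => 'D_(hatv i (beta_f D W) y) (hat i Z) y) z.
    exact: (diff_frozen oU Uu Bl Bd dW).
  have d2 := diff_bil oU Gl Gr Uu dG dWh dZh.
  apply: (f_equal2 +%R); last first.
    apply: (congr1 (Gam z (V u i))).
    by rewrite (cWZ u iu Uu) (hatvE hM _ iu) (hatE hM W iu) (hatE hM Z iu) (bE W pW).
  apply: etrans (esym (near_eq_derive _ E)) _.
  apply: etrans (derive_add _ d1 d2) _.
  apply: (f_equal2 +%R).
    apply: etrans (derive_along _ oU smZ Uu dW) _.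
    by rewrite (hatvE hM _ iu) (bE W pW).
  apply: etrans (derive_bil oU Gl Gr _ Uu dG dWh dZh) _.
  by rewrite (hatE hM W iu) (hatE hM Z iu).
have tl := lie_tangent SG u vX vY.
have third : cov D (lie (beta_f D X) (beta_f D Y)) Z u i =
   'D_('D_(bt z (X u i)) (hatv i (beta_f D Y)) z) (hat i Z) z
   - 'D_('D_(bt z (Y u i)) (hatv i (beta_f D X)) z) (hat i Z) z
   + (Gam z ('D_(bt z (X u i)) (hat i Y) z) (Z u i)
      - Gam z ('D_(bt z (Y u i)) (hat i X) z) (Z u i)).
  have [_ _ _ F] := hom; apply: etrans (F u _ Z iu Uu tl pZ) _.
  have El := lieE (A := SA) (beta_f D X) (beta_f D Y) iu; rewrite (bE X pX) (bE Y pY) in El.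
  have dZ := diff_hat iu pZ.
  apply: (f_equal2 +%R).
    apply: etrans (congr1 (fun t => 'D_t (hat i Z) z) El) _.
    apply: etrans (deriveDv _ _ dZ) _; apply: (congr1 (fun t => _ + t)).
    exact: deriveNv.
  apply: etrans (omG _ _ Uu) _.
  apply: etrans (congr1 (fun t => Gam z (lsub t) (Z u i)) El) _.
  rewrite (lin_B (@lsub_is_linear R n)).
  apply: etrans (lin_B (Gl _ Uu) _ _) _.
  by apply: (f_equal2 (fun a b => Gam z a (Z u i) - Gam z b (Z u i)));
    [exact: (lsub_derive_beta hbeta _ iu Uu pY)|exact: (lsub_derive_beta hbeta _ iu Uu pX)].
have E0 (a b c : tvec A) : (- a + b + c) i = - a i + b i + c i by [].
apply: etrans (E0 _ _ _) _.
rewrite (second X Y pX pY) (second Y X pY pX) third.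
have S := schwarz_rV (bt z (Y u i)) (bt z (X u i)) oU (smZ 2%N) Uu.
rewrite (lin_D (Gr _ Uu)) (lin_D (Gr _ Uu)) /Rc.
have H (xy yx p q g1 g2 l1 l2 m1 m2 e1 e2 : 'rV[R]_n) : xy = yx ->
  - (xy + p + (g1 + l1 + m1) + (m2 + e1)) + (yx + q + (g2 + l2 + m2) + (m1 + e2))
  + (p - q + (l1 - l2)) = - (g1 - g2 + e1 - e2).
  by move=> ->; apply/rowP => j; rewrite !mxE; ring.
exact: H S.
Qed.

End BerwaldCurvature.
End Curvatures.

(** * Exchange of pairs, projection and the main theorem *)

Section CurvatureAlgebra.
Context {R : realFieldType}.

(** Four instances of the first Bianchi identity, added as for the exchange of pairs
of a Riemannian curvature, with the defects of skew-symmetry in the last two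
arguments recorded as [D1 - t1], [D2 - t2] and [D3 - t3].  In the names, [yYZW]
stands for [R(y, Y, Z, W)]. *)
Lemma pair_exchange_from_bianchi (yYZW yYWZ yZYW yZWY yWYZ yWZY YZyW YZWy ZWyY ZWYy YWyZ YWZy
    ZyYW WyYZ WyZY WYZy D1 D2 D3 t1 t2 t3 : R) :
  yYZW + YZyW + ZyYW = 0 -> WyYZ + yYWZ + YWyZ = 0 ->
  YZWy + ZWYy + WYZy = 0 -> ZWyY + WyZY + yZWY = 0 ->
  ZyYW = - yZYW -> WyYZ = - yWYZ -> WyZY = - yWZY -> WYZy = - YWZy ->
  YZWy = - YZyW -> ZWYy = - ZWyY -> YWZy = - YWyZ ->
  yYZW + yYWZ = D1 - t1 -> yZYW + yZWY = D2 - t2 -> yWYZ + yWZY = D3 - t3 ->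
  D1 = D2 -> D3 = D2 ->
  yYZW = ZWyY - 2^-1 * t2 + 2^-1 * t3 - 2^-1 * t1 + 2^-1 * D2.
Proof. by move=> *; lra. Qed.

(** The two equations differ by terms that cancel identically. *)
Lemma projected_curvature_iff (L k lX lY lZ lW A0 QX QY RXYZ RXYW RyXZ RyXW RyYZ RyYW
   hXZ hYW hYZ hXW : R) : L != 0 ->
  A0 - L^-1 * lX * QY + L^-1 * lY * QX - L^-1 * lZ * RXYW + L^-1 * lW * RXYZ
    + L^-1 * lX * (L^-1 * lZ) * RyYW - L^-1 * lX * (L^-1 * lW) * RyYZ
    - L^-1 * lY * (L^-1 * lZ) * RyXW + L^-1 * lY * (L^-1 * lW) * RyXZ
    = k * (hXZ * hYW - hYZ * hXW) <->
  A0 = L^-1 * (lZ * RXYW - lW * RXYZ)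
    + (L^-1 * lX * QY - L ^- 2 * (RyXZ * lY * lW + RyYW * lX * lZ - k * L ^+ 2 * hXZ * hYW)
       - (L^-1 * lY * QX - L ^- 2 * (RyYZ * lX * lW + RyXW * lY * lZ - k * L ^+ 2 * hYZ * hXW))).
Proof.
move=> L0.
have S x h h' : L ^- 2 * (x - k * L ^+ 2 * h * h') = L^-1 ^+ 2 * x - k * (h * h').
  by rewrite exprVn; field.
rewrite !S; move: L^-1 => c.
(* Compare the differences of the two sides of each equation. *)
set P := (X in X = _ <-> _); set K := (X in _ = X <-> _); set Q := (X in _ <-> _ = X).
have E : P - K = A0 - Q by rewrite /P /K /Q; ring.
by split=> /eqP; rewrite -subr_eq0 => H; apply/eqP; rewrite -subr_eq0; [rewrite -E|rewrite E].
Qed.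

End CurvatureAlgebra.

Section RcLinear.
Context {R : realType} {n : nat}.
Variables (U : set 'rV[R]_(n + n)) (Gam : 'rV[R]_(n + n) -> 'rV[R]_n -> 'rV[R]_n -> 'rV[R]_n).
Hypothesis oU : open U.
Hypothesis Gl : forall z c, U z -> linear (fun a => Gam z a c).
Hypothesis Gr : forall z a, U z -> linear (Gam z a).
Hypothesis sG : forall a c, smooth_on U (fun z => Gam z a c).

(** A derivative with respect to parameters preserves linearity in the remaining
variable. *)
Lemma derive_linear_param (B : 'rV[R]_(n + n) -> 'rV[R]_n -> 'rV[R]_n) z v : U z ->
  (forall y, U y -> linear (B y)) -> (forall c, differentiable (B^~ c) z) ->
  linear (fun c => 'D_v (B^~ c) z).
Proof.
move=> Uz Bl Bd k a b.
have E : \near z, k *: B z a + B z b = B z (k *: a + b).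
  by apply: near_open oU Uz _ => y Uy; rewrite Bl.
apply: etrans (esym (near_eq_derive v E)) _.
have [d D] := diff_scale (differentiable_cst k z) (Bd a).
apply: etrans (derive_add v d (Bd b)) _; apply: (congr1 (fun t => t + _)).
apply: etrans (D v) _; rewrite derive_cst scale0r add0r //.
Qed.

Lemma Rc_lin1 z c e : U z -> linear (fun a => Rc Gam z a c e).
Proof.
move=> Uz.
have dG p q : differentiable (fun y => Gam y p q) z by exact: smooth_diff (sG p q) Uz.
have l1 := lin_comp (derive_linear (dG c e)) (bet_lin Gl Uz).
have l2 := derive_linear_param (B := fun y a => Gam y a e) (bet Gam z c) Uz
  (fun y Uy => Gl e Uy) (fun a => dG a e).
have l3 : linear (fun a => Gam z a (Gam z c e)) by exact: Gl.
have l4 := lin_comp (Gr c Uz) (Gl e Uz).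
move=> k a b; rewrite /Rc (l1 k a b) (l2 k a b) (l3 k a b) (l4 k a b).
have H (x1 x2 x3 x4 y1 y2 y3 y4 : 'rV[R]_n) :
  - (k *: x1 + y1 - (k *: x2 + y2) + (k *: x3 + y3) - (k *: x4 + y4)) =
  k *: (- (x1 - x2 + x3 - x4)) + - (y1 - y2 + y3 - y4).
  by apply/rowP => j; rewrite !mxE; ring.
exact: H.
Qed.

Lemma Rc_lin2 z a e : U z -> linear (fun c => Rc Gam z a c e).
Proof.
move=> Uz k c d; rewrite (Rc_anti Gam z a (_ + _)) (Rc_anti Gam z a c) (Rc_anti Gam z a d).
apply: etrans (congr1 -%R (Rc_lin1 a e Uz k c d)) _.
have H (x y : 'rV[R]_n) : - (k *: x + y) = k *: - x + - y by rewrite opprD scalerN.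
exact: H.
Qed.

Lemma Rc_lin3 z a c : U z -> linear (Rc Gam z a c).
Proof.
move=> Uz.
have dG p q : differentiable (fun y => Gam y p q) z by exact: smooth_diff (sG p q) Uz.
have l1 := derive_linear_param (B := fun y e => Gam y c e) (bet Gam z a) Uz
  (fun y Uy => Gr c Uy) (fun e => dG c e).
have l2 := derive_linear_param (B := fun y e => Gam y a e) (bet Gam z c) Uz
  (fun y Uy => Gr a Uy) (fun e => dG a e).
have l3 := lin_comp (Gr a Uz) (Gr c Uz).
have l4 := lin_comp (Gr c Uz) (Gr a Uz).
move=> k e e'; rewrite /Rc (l1 k e e') (l2 k e e') (l3 k e e') (l4 k e e').
have H (x1 x2 x3 x4 y1 y2 y3 y4 : 'rV[R]_n) :
  - (k *: x1 + y1 - (k *: x2 + y2) + (k *: x3 + y3) - (k *: x4 + y4)) =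
  k *: (- (x1 - x2 + x3 - x4)) + - (y1 - y2 + y3 - y4).
  by apply/rowP => j; rewrite !mxE; ring.
exact: H.
Qed.

End RcLinear.

(** Of the sixteen terms, the seven with [y] twice in the first two or twice in the last
two slots vanish, and a [y] in the last slot can be moved to the third one. *)
Lemma curvature_like_shift (R : realFieldType) (V : lmodType R) (r : V -> V -> V -> V -> R) (y X Y Z W : V)
   (a b c d : R) :
  (forall q s t k p p', r (p - k *: p') q s t = r p q s t - k * r p' q s t) ->
  (forall q s t k p p', r q (p - k *: p') s t = r q p s t - k * r q p' s t) ->
  (forall q s t k p p', r q s (p - k *: p') t = r q s p t - k * r q s p' t) ->
  (forall q s t k p p', r q s t (p - k *: p') = r q s t p - k * r q s t p') ->
  (forall p q s t, r p q s t = - r q p s t) ->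
  (forall p q s, r p q s y = - r p q y s) ->
  r (X - a *: y) (Y - b *: y) (Z - c *: y) (W - d *: y) =
  r X Y Z W - a * r y Y Z W + b * r y X Z W - c * r X Y y W + d * r X Y y Z
  + a * c * r y Y y W - a * d * r y Y y Z - b * c * r y X y W + b * d * r y X y Z.
Proof.
move=> r1 r2 r3 r4 ra ry.
have yy s t : r y y s t = 0 by have := ra y y s t; lra.
have y34 p q : r p q y y = 0 by have := ry p q y; lra.
rewrite r1 !r2 !r3 !r4 !yy !y34 (ra X y Z W) (ra X y y W) (ra X y Z y).
by rewrite (ry X Y Z) (ry y Y Z) (ry y X Z); ring.
Qed.

Section Final.
Context {R : realType} {n : nat} {M : topologicalType} (A : atlas R n M).
Hypothesis hM : smooth_manifold A.
Local Notation SA := (slit_atlas A).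
Local Notation crdS := (crd (a := slit_atlas A)).
Implicit Types (u : slit A).

Let G : good_atlas A := manifold_good hM.
Let SG : good_atlas SA := slit_good G.

Variables (L : slit A -> R) (nabla Do : connection A).
Hypotheses (hL : finsler L) (hC : is_cartan L nabla) (hB : is_berwald L Do).

Let hDo : is_connection Do. Proof. by have [] := hB. Qed.
Let hRo : regular Do. Proof. by have [] := hB. Qed.
Let hDn : is_connection nabla. Proof. by have [] := hC. Qed.
Let hRn : regular nabla. Proof. by have [] := hC. Qed.

Section Local.
Variables (i : chart A) (U : set 'rV[R]_(n + n)).
Variables (omB omC : 'rV[R]_(n + n) -> 'rV[R]_(n + n) -> 'rV[R]_n -> 'rV[R]_n).
Hypotheses (hU : chart_patch i U) (homB : local_form i U Do omB)
  (homC : local_form i U nabla omC).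

Local Notation F := (F2 L i).
Local Notation Ga := (Gam omB).
Let oU : open U. Proof. by have [] := hU. Qed.
Let sU : U `<=` slit_dom i. Proof. by have [] := hU. Qed.
Let sF : smooth_on U F. Proof. exact: (sub_smooth_F2 hM hL hU). Qed.
Let eu : forall z, U z -> 'D_(vv (rsub z)) F z = 2 * F z. Proof. exact: (sub_euler hM hL hU). Qed.
Let Gl : forall z c, U z -> linear (fun a => Ga z a c). Proof. exact: (Gam_linl homB). Qed.
Let Gr : forall z a, U z -> linear (Ga z a). Proof. exact: (Gam_linr homB). Qed.
Let sG : forall a c, smooth_on U (fun z => Ga z a c). Proof. exact: (smooth_Gam homB). Qed.
Let Gs : forall z a c, U z -> Ga z a c = Ga z c a. Proof. exact: (Gam_sym hM hB hU homB). Qed.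
Let dL : forall z a, U z -> 'D_(bet Ga z a) F z = 0.
Proof. exact: (berwald_L hM hL hB hU homB). Qed.
Let hbetaB := berwald_beta hM hB hU homB.
Let hfundB := berwald_fund hM hB hU homB.
Let gB := berwald_gamma hM hB.

(** This is the vanishing of the Berwald (v)hv-torsion, in coordinates. *)
Lemma Gam_y z a b : U z -> 'D_(vv b) (fun y => Ga y a (rsub z)) z = 0.
Proof.
move=> Uz; have [u [iu Uu uz]] := patch_point hU Uz.
have [_ _ _ tX] := hU; have [X pX Xi] := tX a; have [Y pY Yi] := tX b.
have [_ _ _ P0 _] := hB.
have H := vhv_chart hM hU Gl Gr sG hDo hRo homB hbetaB hfundB gB iu Uu pX pY.
rewrite (P0 X Y pX pY u) (Xi u iu Uu) (Yi u iu Uu) uz in H.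
have E1 := derive_Nl oU Gl Gr sG (vv b) a Uz; rewrite rsubV in E1.
have E2 : omB z (bet Ga z a) b = Ga z a b.
  apply: etrans (om_Gam hM hB hU homB _ _ Uz) _.
  by apply: (congr1 (fun t => Ga z t b)); exact: lsub_bet.
rewrite E2 in H.
have aux (d g t : 'rV[R]_n) : t = d + g -> (0 : 'rV[R]_n) = t - g -> d = 0.
  by move=> -> ; rewrite addrK => <-.
exact: aux E1 H.
Qed.

Let Gy : forall z a b, U z -> 'D_(vv b) (fun y => Ga y a (rsub z)) z = 0.
Proof. exact: Gam_y. Qed.

Local Notation N' := (Nn omC).
Let col : forall z c, U z -> linear (fun v => omC z v c). Proof. by have [] := homC. Qed.
Let gpos := sub_pos hM hL hU.
Let cmet := cartan_metric hM hL hC hU homC.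
Let cNn := cartan_NnE hM hC hU homC.
Let ctor := cartan_torsion hM hC hU homC.
Let cmix := cartan_mixed hM hL hC hU homC.

Lemma cartan_N z a : U z -> N' z a = Nl Ga z a.
Proof. exact: (Nn_Nl oU sF eu Gl Gr sG Gs Gy dL col gpos cmet cNn ctor). Qed.

Lemma hbetaC u w : dom i (base u) -> U (crdS i u) -> tangent (base u) w ->
  beta nabla u w i = bet Ga (crdS i u) (w i).
Proof.
move=> iu Uu tw; apply: etrans (cartan_beta hM hC hU homC iu Uu tw) _.
exact: (bet'_bet oU sF eu Gl Gr sG Gs Gy dL col gpos cmet cNn ctor _ Uu).
Qed.

Lemma hfundC u (v : tvec SA) : dom i (base u) -> U (crdS i u) -> tangent u v ->
  nabla u v (@fund R n M A) i = rsub (v i) + Nl Ga (crdS i u) (lsub (v i)).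
Proof.
move=> iu Uu tv; apply: etrans (cartan_fund hM hL hC hU homC iu Uu tv) _.
by apply: (congr1 (fun t => _ + t)); exact: cartan_N.
Qed.

Let gC := cartan_gamma hM hL hC.

(** The Cartan (v)hv-torsion is the difference of the horizontal parts of the Berwald
and Cartan connection forms, hence it is [- G / 2]. *)
Lemma vhv_value w X Y Z : dom i (base w) -> U (crdS i w) ->
  pfield X -> pfield Y -> pfield Z ->
  lower2 L (vhv_torsion nabla) X Y Z w =
  - (2^-1 * Gt F Ga (crdS i w) (X w i) (Y w i) (Z w i)).
Proof.
move=> iw Uw pX pY pZ.
apply: etrans (metricE G hL iw (curvature_tangent hM w hDn (vfield_beta hM hDn hRn pX) (vfield_gamma G pY) (pfield_fund G)) (pZ.1 w)) _.
apply: etrans (congr1 (fun t => gz F (crdS i w) t (Z w i))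
  (vhv_chart hM hU Gl Gr sG hDn hRn homC hbetaC hfundC gC iw Uw pX pY)) _.
rewrite (derive_Nl_v oU Gl Gr sG Gy (Y w i) (X w i) Uw).
rewrite -opprB (lin_N (gz_linl sF (Z w i) Uw)); apply: (congr1 -%R).
exact: (cartan_berwald oU sF eu Gl Gr sG Gs Gy dL col gpos cmet cNn ctor).
Qed.

Variable u : slit A.
Hypotheses (iu : dom i (base u)) (Uu : U (crdS i u)).
Local Notation z := (crdS i u).
Local Notation y := (rsub z).
Local Notation g := (gz F z).
Local Notation rc := (Rc Ga z).
Local Notation eta := (@fund R n M A).

Lemma eta_chart : eta u i = y. Proof. by rewrite rsub_crd. Qed.

Lemma h_curv_value X Y Z W : pfield X -> pfield Y -> pfield Z -> pfield W ->
  lower3 L (h_curv Do) X Y Z W u = g (rc (X u i) (Y u i) (Z u i)) (W u i).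
Proof.
move=> pX pY pZ pW.
apply: etrans (metricE G hL iu (curvature_tangent hM u hDo (vfield_beta hM hDo hRo pX)
  (vfield_beta hM hDo hRo pY) pZ) (pW.1 u)) _.
apply: (congr1 (fun t => g t (W u i))).
have omG : forall p v c, U p -> omB p v c = Ga p (lsub v) c.
  by move=> p v c Up; exact: (om_Gam hM hB hU homB v c Up).
exact: (h_curv_chart hM hU Gl Gr sG hDo hRo homB hbetaB omG iu Uu pX pY pZ).
Qed.

Lemma vh_value X Y W : pfield X -> pfield Y -> pfield W ->
  lower2 L (vh_torsion nabla) X Y W u = g (rc (X u i) (Y u i) y) (W u i).
Proof.
move=> pX pY pW.
apply: etrans (metricE G hL iu (curvature_tangent hM u hDn (vfield_beta hM hDn hRn pX)
  (vfield_beta hM hDn hRn pY) (pfield_fund G)) (pW.1 u)) _.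
apply: (congr1 (fun t => g t (W u i))).
exact: (vh_chart hM hU Gl Gr sG hDn hRn hbetaC hfundC iu Uu pX pY).
Qed.

Lemma deviation_pfield X : pfield X -> pfield (deviation Do X).
Proof.
move=> pX; have [cD _ _ _ _] := hDo; have pE := pfield_fund G.
have vX := vfield_beta hM hDo hRo pX; have vE := vfield_beta hM hDo hRo pE.
have -> : deviation Do X = cov Do (lie (beta_f Do eta) (beta_f Do X)) eta.
  by apply: funext => w; exact: (vh_lie hM hDo hRo w pE pX).
exact: (cD _ _ (vfield_lie SG vE vX) pE).
Qed.

Lemma deviation_chart X : pfield X -> deviation Do X u i = rc y (X u i) y.
Proof.
move=> pX.
apply: etrans (vh_chart hM hU Gl Gr sG hDo hRo hbetaB hfundB iu Uu (pfield_fund G) pX) _.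
by rewrite eta_chart.
Qed.

Lemma mixed_value X Y Z : pfield X -> pfield Y -> pfield Z ->
  lower2 L (mixed_torsion nabla) (deviation Do X) Y Z u =
  2^-1 * T3 F z (rc y (X u i) y) (Y u i) (Z u i).
Proof.
move=> pX pY pZ.
apply: etrans (gm_mixed hM hL hC hU homC iu Uu (deviation_pfield pX) pY pZ) _.
rewrite (deviation_chart pX).
exact: (mixed_T3 oU sF cmet cmix _ _ _ Uu).
Qed.

Let G1 : forall p b c, U p -> linear (fun a => Gt F Ga p a b c).
Proof. by move=> p b c Up; exact (Gt_lin1 oU sF Gl b c Up). Qed.
Let G2 : forall p a c, U p -> linear (fun b => Gt F Ga p a b c).
Proof. move=> p a c Up; eapply Gt_lin2; eassumption. Qed.
Let G3 : forall p a b, U p -> linear (Gt F Ga p a b).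
Proof. move=> p a b Up; eapply Gt_lin3; eassumption. Qed.
Let sGt : forall a b c, smooth_on U (fun p => Gt F Ga p a b c).
Proof. move=> a b c; eapply smooth_Gt; eassumption. Qed.

(** The tensor is [- G / 2] on a whole neighbourhood, so its Berwald covariant
derivative along the horizontal lift of [eta] is that of [- G / 2]. *)
Lemma cov3_vhv_value X Y Z : pfield X -> pfield Y -> pfield Z ->
  cov3 Do (beta_f Do eta) (lower2 L (vhv_torsion nabla)) X Y Z u =
  - (2^-1 * DGt F Ga z y (X u i) (Y u i) (Z u i)).
Proof.
move=> pX pY pZ; have pE := pfield_fund G.
have vE := vfield_beta hM hDo hRo pE.
set v := bet Ga z y.
have vi : beta_f Do eta u i = v.
  by apply: etrans (hbetaB iu Uu (pE.1 u)) _; rewrite eta_chart.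
pose h p := Gt F Ga p (hat i X p) (hat i Y p) (hat i Z p).
have E : \forall p \near z,
    - (2^-1 * h p) = local_expr (A := SA) i (lower2 L (vhv_torsion nabla) X Y Z) p.
  apply: near_open oU Uu _ => p Up; have [w [iw Uw <-]] := patch_point hU Up.
  apply/esym; apply: etrans (local_exprE SG _ (iw : dom (a := SA) i w)) _.
  apply: etrans (vhv_value iw Uw pX pY pZ) _.
  by rewrite /h (hatE hM X iw) (hatE hM Y iw) (hatE hM Z iw).
have dX := diff_hat iu pX; have dY := diff_hat iu pY; have dZ := diff_hat iu pZ.
pose B p c := Gt F Ga p (hat i X p) (hat i Y p) c.
pose B2 c p a b := Gt F Ga p a b c.
have Bl p : U p -> linear (B p) by move=> Up; exact: G3.
have B2l c p b : U p -> linear (fun a => B2 c p a b) by move=> Up; exact: G1.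
have B2r c p a : U p -> linear (B2 c p a) by move=> Up; exact: G2.
have B2d c a b : differentiable (fun p => B2 c p a b) z by exact: smooth_diff (sGt a b c) Uu.
have Bd c : differentiable (B^~ c) z.
  exact: (diff_bil oU (B2l c) (B2r c) Uu (B2d c) dX dY).
have dh : differentiable h z by exact: (diff_frozen oU Uu Bl Bd dZ).
have Dh : 'D_v h z = 'D_v (fun p => Gt F Ga p (X u i) (Y u i) (Z u i)) z
   + Gt F Ga z ('D_v (hat i X) z) (Y u i) (Z u i)
   + Gt F Ga z (X u i) ('D_v (hat i Y) z) (Z u i)
   + Gt F Ga z (X u i) (Y u i) ('D_v (hat i Z) z).
  apply: etrans (derive_frozen oU Uu Bl Bd v dZ) _.
  rewrite (hatE hM Z iu); apply: (f_equal2 +%R); last first.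
    by rewrite /B (hatE hM X iu) (hatE hM Y iu).
  apply: etrans (derive_bil oU (B2l (Z u i)) (B2r (Z u i)) v Uu (B2d (Z u i)) dX dY) _.
  by rewrite (hatE hM X iu) (hatE hM Y iu).
have [d3 D3] := diff_scale (differentiable_cst (- 2^-1 : R) z) dh.
have E' : \forall p \near z, (- 2^-1 : R) *: h p
    = local_expr (A := SA) i (lower2 L (vhv_torsion nabla) X Y Z) p.
  by apply: filterS E => p Ep; exact: etrans (mulNr (2^-1 : R) (h p)) Ep.
have dP : diff_at (A := SA) i (lower2 L (vhv_torsion nabla) X Y Z) u.
  exact: near_eq_differentiable E' d3.
have DP : dirder u (beta_f Do eta u) (lower2 L (vhv_torsion nabla) X Y Z) = - 2^-1 * 'D_v h z.
  apply: etrans (dirderE SG (i := i) iu (vE.1 u) dP) _; rewrite vi.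
  apply: etrans (esym (near_eq_derive v E')) _.
  by apply: etrans (D3 v) _; rewrite derive_cst scale0r add0r.
have cE W : pfield W -> cov Do (beta_f Do eta) W u i = 'D_v (hat i W) z + Ga z y (W u i).
  move=> pW; apply: etrans (cov_chart homB iu Uu vE pW) _; rewrite vi.
  apply: (congr1 (fun t => _ + t)); apply: etrans (om_Gam hM hB hU homB _ _ Uu) _.
  by apply: (congr1 (fun t => Ga z t _)); exact: lsub_bet.
have [cD _ _ _ _] := hDo.
rewrite /cov3 DP (vhv_value iu Uu (cD _ _ vE pX) pY pZ) (vhv_value iu Uu pX (cD _ _ vE pY) pZ).
rewrite (vhv_value iu Uu pX pY (cD _ _ vE pZ)) (cE X pX) (cE Y pY) (cE Z pZ) Dh.
rewrite (lin_D (G1 _ _ Uu)) (lin_D (G2 _ _ Uu)) (lin_D (G3 _ _ Uu)) /DGt.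
have H (d a1 a2 a3 b1 b2 b3 : R) : - 2^-1 * (d + a1 + a2 + a3) - - (2^-1 * (a1 + b1))
  - - (2^-1 * (a2 + b2)) - - (2^-1 * (a3 + b3)) = - (2^-1 * (d - b1 - b2 - b3)) by ring.
exact: H.
Qed.

Lemma pair_exchange Y Z W :
  g (rc y Y Z) W = g (rc Z W y) Y - 2^-1 * T3 F z (rc y Z y) Y W
    + 2^-1 * T3 F z (rc y W y) Y Z - 2^-1 * T3 F z (rc y Y y) Z W
    + 2^-1 * DGt F Ga z y Z Y W.
Proof.
have gN a b : g (- a) b = - g a b by exact: (lin_N (gz_linl sF b Uu)).
have gD a b c : g (a + b) c = g a c + g b c by exact: (lin_D (gz_linl sF c Uu)).
have g0 a : g 0 a = 0 by exact: (lin_0 (gz_linl sF a Uu)).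
have B a b c d : g (rc a b c) d + g (rc b c a) d + g (rc c a b) d = 0.
  by rewrite -!gD (Rc_bianchi oU Gs a b c Uu) g0.
have As a b c d : g (rc a b c) d = - g (rc b a c) d.
  by rewrite -gN; apply: (congr1 (fun t => g t d)); exact: Rc_anti.
have Ry a b c : g (rc a b c) y = - g (rc a b y) c by eapply Rc_y; eassumption.
have Sk a b c : g (rc y a b) c + g (rc y a c) b = DGt F Ga z y a b c - T3 F z (rc y a y) b c.
  by eapply Rc_skew_y; eassumption.
have D12 a b c : DGt F Ga z y a b c = DGt F Ga z y b a c by eapply DGt_sym12; eassumption.
have D23 a b c : DGt F Ga z y a b c = DGt F Ga z y a c b by eapply DGt_sym23; eassumption.
have e1 := B y Y Z W; have e2 := B W y Y Z; have e3 := B Y Z W y; have e4 := B Z W y Y.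
have D3 := etrans (D12 W Y Z) (etrans (D23 Y W Z) (D12 Y Z W)).
exact: (pair_exchange_from_bianchi e1 e2 e3 e4 (As _ _ _ _) (As _ _ _ _) (As _ _ _ _) (As _ _ _ _)
  (Ry _ _ _) (Ry _ _ _) (Ry _ _ _) (Sk _ _ _) (Sk _ _ _) (Sk _ _ _) (D12 _ _ _) D3).
Qed.

Let cL w := (L w)^-1.

Lemma pfield_phi X : pfield X -> pfield (phi L X).
Proof.
move=> pX; have pE := pfield_fund G; have [sL L0 _ _] := hL.
have sLV : smooth SA cL by apply: (smoothV G) => // w; rewrite gt_eqF.
have s : smooth SA (fun w => - (cL w * (cL w * gm L eta X w))).
  apply: (smoothN G); apply: (smoothM G sLV); apply: (smoothM G sLV).
  exact: (smooth_gm G hL pE pX).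
have -> : phi L X = fun w => X w + (- (cL w * (cL w * gm L eta X w))) *: eta w.
  by apply: funext => w; rewrite /phi /ell scaleNr.
exact: (pfieldD G pX (pfieldZ G s pE)).
Qed.

Lemma phi_chart X : phi L X u i = X u i - ((L u)^-1 * ell L X u) *: y.
Proof. by rewrite -eta_chart. Qed.

Lemma projection_value X Y Z W : pfield X -> pfield Y -> pfield Z -> pfield W ->
  proj4 L (lower3 L (h_curv Do)) X Y Z W u =
  (fun r : _ -> _ -> _ -> _ -> R =>
   (fun a b c d : R => r (X u i) (Y u i) (Z u i) (W u i) - a * r y (Y u i) (Z u i) (W u i)
   + b * r y (X u i) (Z u i) (W u i) - c * r (X u i) (Y u i) y (W u i)
   + d * r (X u i) (Y u i) y (Z u i) + a * c * r y (Y u i) y (W u i)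
   - a * d * r y (Y u i) y (Z u i) - b * c * r y (X u i) y (W u i)
   + b * d * r y (X u i) y (Z u i))
   ((L u)^-1 * ell L X u) ((L u)^-1 * ell L Y u) ((L u)^-1 * ell L Z u) ((L u)^-1 * ell L W u))
  (fun p q s t => g (rc p q s) t).
Proof.
move=> pX pY pZ pW.
apply: etrans (h_curv_value (pfield_phi pX) (pfield_phi pY) (pfield_phi pZ) (pfield_phi pW)) _.
rewrite (phi_chart X) (phi_chart Y) (phi_chart Z) (phi_chart W).
have gsubl p q t k : g (p - k *: q) t = g p t - k * g q t.
  by rewrite (lin_B (gz_linl sF t Uu)) (lin_Z (gz_linl sF t Uu)).
have gsubr p q t k : g t (p - k *: q) = g t p - k * g t q.
  by rewrite (lin_B (gz_linr oU sF t Uu)) (lin_Z (gz_linr oU sF t Uu)).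
have l1 q s := Rc_lin1 oU Gl Gr sG q s Uu.
have l2 p s := Rc_lin2 oU Gl Gr sG p s Uu.
have l3 p q := Rc_lin3 oU Gr sG p q Uu.
apply: (curvature_like_shift (r := fun p q s t => g (rc p q s) t)).
- by move=> q s t k p p'; rewrite -gsubl (lin_B (l1 q s)) (lin_Z (l1 q s)).
- by move=> q s t k p p'; rewrite -gsubl (lin_B (l2 q s)) (lin_Z (l2 q s)).
- by move=> q s t k p p'; rewrite -gsubl (lin_B (l3 q s)) (lin_Z (l3 q s)).
- by move=> q s t k p p'; rewrite gsubr.
- move=> p q s t; rewrite -(lin_N (gz_linl sF t Uu)).
  by apply: (congr1 (fun x => g x t)); exact: Rc_anti.
- by move=> p q s; eapply Rc_y; eassumption.
Qed.

(** Both sides are evaluated in one chart around [u]; by [key] the braces on the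
right are the curvature terms that come out of the projection. *)
Lemma pointwise_equivalence (k : slit A -> R) X Y Z W :
  pfield X -> pfield Y -> pfield Z -> pfield W ->
  let l := ell L in
  let hb := hbar L in
  let T := lower2 L (mixed_torsion nabla) in
  let Rh := lower2 L (vh_torsion nabla) in
  let DPh := cov3 Do (beta_f Do (@fund R n M A)) (lower2 L (vhv_torsion nabla)) in
  let H := deviation Do in
  (proj4 L (lower3 L (h_curv Do)) X Y Z W u =
    k u * alt (fun X Y => hbar L X Z u * hbar L Y W u) X Y) <->
  lower3 L (h_curv Do) X Y Z W u =
      (L u)^-1 * (l Z u * Rh X Y W u - l W u * Rh X Y Z u)
      + alt (fun X Y : slit A -> tvec A =>
          (L u)^-1 * l X u *
            (Rh Z W Y u - T (H Z) W Y u + T (H W) Z Y u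
             - T (H Y) Z W u - DPh Z W Y u)
          - (L u) ^- 2 *
            (Rh (@fund R n M A) X Z u * l Y u * l W u
             + Rh (@fund R n M A) Y W u * l X u * l Z u
             - k u * L u ^+ 2 * hb X Z u * hb Y W u)) X Y.
Proof.
move=> pX pY pZ pW l hb T Rh DPh H; have pE := pfield_fund G.
have key V : pfield V -> Rh Z W V u - T (H Z) W V u + T (H W) Z V u - T (H V) Z W u - DPh Z W V u
   = g (rc y (V u i) (Z u i)) (W u i).
  move=> pV.
  have comb (a b c d e a' b' c' d' e' : R) : a = a' -> b = b' -> c = c' -> d = d' -> e = e' ->
    a - b + c - d - e = a' - b' + c' - d' - e' by move=> -> -> -> -> ->.
  have s3 a b c : T3 F z a b c = T3 F z a c b by eapply T3_sym23; eassumption.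
  have d3 a b c : DGt F Ga z y a b c = DGt F Ga z y a c b by eapply DGt_sym23; eassumption.
  apply: etrans (comb _ _ _ _ _ _ _ _ _ _ (vh_value pZ pW pV) (mixed_value pZ pW pV)
    (mixed_value pW pZ pV) (mixed_value pV pZ pW) (cov3_vhv_value pZ pW pV)) _.
  have swap (p q q1 q1' r r1 s s1 : R) : q = q1 -> q1' = r -> s = s1 ->
    p - 2^-1 * q + 2^-1 * q1' - 2^-1 * r1 - - (2^-1 * s) =
    p - 2^-1 * q1 + 2^-1 * r - 2^-1 * r1 + 2^-1 * s1 by move=> -> -> ->; rewrite opprK.
  exact: etrans (swap _ _ _ _ _ _ _ _ (s3 _ _ _) (s3 _ _ _) (d3 _ _ _))
    (esym (pair_exchange (V u i) (Z u i) (W u i))).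
have L0 : L u != 0 by have [_ H0 _ _] := hL; rewrite gt_eqF.
have vhE V S : pfield V -> pfield S -> Rh (@fund R n M A) V S u = g (rc y (V u i) y) (S u i).
  move=> pV pS; apply: etrans (vh_value pE pV pS) _.
  by apply: (congr1 (fun e => g (rc e (V u i) y) (S u i))); exact: eta_chart.
have wrap (K a0 a0' qX qX' qY qY' r1 r1' r2 r2' r3 r3' r4 r4' r5 r5' r6 r6' P P' : R) :
  P = P' -> a0 = a0' -> qX = qX' -> qY = qY' -> r1 = r1' -> r2 = r2' -> r3 = r3' ->
  r4 = r4' -> r5 = r5' -> r6 = r6' ->
  (P' = K <-> a0' = (L u)^-1 * (l Z u * r1' - l W u * r2')
    + ((L u)^-1 * l X u * qY' - L u ^- 2 * (r3' * l Y u * l W u + r4' * l X u * l Z u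
         - k u * L u ^+ 2 * hb X Z u * hb Y W u)
      - ((L u)^-1 * l Y u * qX' - L u ^- 2 * (r5' * l X u * l W u + r6' * l Y u * l Z u
         - k u * L u ^+ 2 * hb Y Z u * hb X W u)))) ->
  (P = K <-> a0 = (L u)^-1 * (l Z u * r1 - l W u * r2)
    + ((L u)^-1 * l X u * qY - L u ^- 2 * (r3 * l Y u * l W u + r4 * l X u * l Z u
         - k u * L u ^+ 2 * hb X Z u * hb Y W u)
      - ((L u)^-1 * l Y u * qX - L u ^- 2 * (r5 * l X u * l W u + r6 * l Y u * l Z u
         - k u * L u ^+ 2 * hb Y Z u * hb X W u)))).
  by do 10 move=> ->.
exact: (wrap _ _ _ _ _ _ _ _ _ _ _ _ _ _ _ _ _ _ _ _ _
  (projection_value pX pY pZ pW) (h_curv_value pX pY pZ pW) (key X pX) (key Y pY)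
  (vh_value pX pY pW) (vh_value pX pY pZ) (vhE X Z pX pZ) (vhE Y W pY pW) (vhE Y Z pY pZ)
  (vhE X W pX pW) (projected_curvature_iff _ _ _ _ _ _ _ _ _ _ _ _ _ _ _ _ _ _ L0)).
Qed.

End Local.

End Final.

Theorem theorem2p7 (R : realType) (n : nat) (M : topologicalType)
    (A : atlas R n M) (L k : slit A -> R) (nabla Do : connection A)
    (hn : (4 <= n)%N) (hM : smooth_manifold A) (hL : finsler L)
    (hk : smooth (slit_atlas A) k) (hk0 : poshomogeneous 0 k)
    (hC : is_cartan L nabla) (hB : is_berwald L Do) :
  let l := ell L in
  let hb := hbar L in
  let T := lower2 L (mixed_torsion nabla) in
  let Rh := lower2 L (vh_torsion nabla) in
  let DPh := cov3 Do (beta_f Do (@fund R n M A)) (lower2 L (vhv_torsion nabla)) in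
  let H := deviation Do in
  Hp_scalar_curvature L Do k <->
  forall X Y Z W : slit A -> tvec A,
    pfield X -> pfield Y -> pfield Z -> pfield W -> forall u : slit A,
    lower3 L (h_curv Do) X Y Z W u =
      (L u)^-1 * (l Z u * Rh X Y W u - l W u * Rh X Y Z u)
      + alt (fun X Y : slit A -> tvec A =>
          (L u)^-1 * l X u *
            (Rh Z W Y u - T (H Z) W Y u + T (H W) Z Y u
             - T (H Y) Z W u - DPh Z W Y u)
          - (L u) ^- 2 *
            (Rh (@fund R n M A) X Z u * l Y u * l W u
             + Rh (@fund R n M A) Y W u * l X u * l Z u
             - k u * L u ^+ 2 * hb X Z u * hb Y W u)) X Y.
Proof.
have [_ _ cA _] := hM; have [hDn _ _ _ _] := hC; have [hDo _ _ _ _] := hB.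
split=> Hs X Y Z W pX pY pZ pW u;
  have iu := cA (base u);
  have [U [hU Uu loc]] := patch_exists hM iu;
  have [omB homB] := loc Do hDo;
  have [omC homC] := loc nabla hDn;
  have E := pointwise_equivalence hM hL hC hB hU homB homC iu Uu k pX pY pZ pW.
- exact (E.1 (Hs X Y Z W pX pY pZ pW u)).
- exact (E.2 (Hs X Y Z W pX pY pZ pW u)).
Qed.
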